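(* There are absolute constants $C,c>0$ such that the following holds. Let $G$ be a compact Abelian group and let $B(\Gamma,\delta)$ be a regular Bohr set in $G$ with $d=|\Gamma|$ and normalised Bohr cutoff $\beta=\beta_{\Gamma,\delta}$. Let $f \in A(G)$ with $\|f\|_{L^\infty(B(\Gamma,\delta))}\neq 0$, let $\epsilon,\eta \in (0,1]$, and write $A_f:=\|f\|_{A(G)}\|f\|_{L^\infty(B(\Gamma,\delta))}^{-1}$. Then there is a finite set $\Lambda$ of characters on $G$ and a $\delta' \in (0,1]$ with $$|\Lambda| \leq C \epsilon^{-1}(1+\log A_f) \quad\text{and}\quad \delta' \geq \frac{c\,\epsilon^2\eta\delta}{d^2(1+\log A_f)},$$ such that $$\{\gamma \in \widehat{G}:|\widehat{f\,d\beta}(\gamma)| \geq \epsilon \|f\|_{L^\infty(B(\Gamma,\delta))}\} \subset \{\gamma\in\widehat G: |1-\gamma(x)| \leq \eta \text{ for all } x \in B(\Gamma \cup \Lambda,\delta')\}.$$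
   Context: For a compact Abelian group $G$, $\mu_G$ is Haar measure with $\mu_G(G)=1$, and $\widehat G$ is the discrete dual group of continuous homomorphisms $\gamma:G\to S^1$. For $f\in L^1(G)$, $\widehat f(\gamma)=\int_G f\overline{\gamma}\,d\mu_G$; $A(G)=\{f\in L^1(G):\|\widehat f\|_1<\infty\}$ with $\|f\|_{A(G)}:=\|\widehat f\|_1=\sum_{\gamma}|\widehat f(\gamma)|$. For $z\in S^1$ put $\|z\|:=\frac1{2\pi}\inf_{n\in\mathbb{Z}}|2\pi n+\arg z|$. For a non-empty finite $\Gamma\subset\widehat G$ and $\delta>0$, the Bohr set is $B(\Gamma,\delta):=\{x\in G:\|\gamma(x)\|\leq\delta\text{ for all }\gamma\in\Gamma\}$; unless stated otherwise Bohr sets have $\delta\in(0,1]$, and $d:=|\Gamma|$. Bohr sets have positive measure; $\beta_{\Gamma,\delta}$ is the restriction of $\mu_G$ to $B(\Gamma,\delta)$ normalised to be a probability measure. $B(\Gamma,\delta)$ is regular ($\delta$ is regular for $\Gamma$) if $\left|\frac{\mu_G(B(\Gamma,(1+\kappa)\delta))}{\mu_G(B(\Gamma,\delta))}-1\right|\leq C_{\mathcal R}|\kappa|d$ for all real $\kappa$ with $|\kappa|d\leq c_{\mathcal R}$, where $c_{\mathcal R},C_{\mathcal R}>0$ are fixed absolute constants chosen so that for every $G$, every $\Gamma$ and every $\delta\in(0,1]$ there is a $\delta'\in[\delta/2,\delta)$ regular for $\Gamma$. With $\beta=\beta_{\Gamma,\delta}$: $\widehat{f\,d\beta}(\gamma):=\int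 f\overline\gamma\,d\beta$, and $\|f\|_{L^\infty(B(\Gamma,\delta))}$ is the essential supremum of $|f|$ with respect to $\beta$. *)

(* Defs.v *)
From HB Require Import structures.
From mathcomp Require Import all_boot all_order all_algebra finmap.
From mathcomp Require Import all_classical all_reals all_analysis ess_sup_inf.
Set Implicit Arguments.
Unset Strict Implicit.
Unset Printing Implicit Defensive.
Import Order.TTheory GRing.Theory Num.Theory.
Import numFieldNormedType.Exports.
From mathcomp Require Export complex.
Export Normc.

Local Open Scope classical_set_scope.
Local Open Scope complex_scope.
Local Open Scope ring_scope.

(* A topological abelian group carrying its Borel sigma-algebra. Measurable
   types are pointed in the library; the point is taken to be 0. *)
Definition Borel (G : topologicalZmodType) : Type := G.

HB.instance Definition _ (G : topologicalZmodType) := Choice.on (Borel G).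
HB.instance Definition _ (G : topologicalZmodType) :=
  isPointed.Build (Borel G) (0 : G).
HB.instance Definition _ (G : topologicalZmodType) :=
  @isMeasurable.Build (sigma_display (@open G)) (Borel G) <<s @open G >>
    (@sigma_algebra0 _ setT _) (@sigma_algebraC (Borel G) (@open G))
    (@sigma_algebra_bigcup _ setT _).

(* Regularity is part of the definition: when G is not metrizable, invariance
   alone does not single out Haar measure among Borel probability measures. *)
Definition haar_measure (R : realType) (G : topologicalZmodType)
    (mu : probability (Borel G) R) : Prop :=
  [/\ forall (a : G) (A : set (Borel G)), measurable A ->
        mu [set (a + x : G) | x in A] = mu A,
      forall A : set (Borel G), measurable A ->
        mu A = ereal_inf [set mu U | U in [set U | @open G U /\ A `<=` U]]
    & forall A : set (Borel G), measurable A ->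
        mu A = ereal_sup [set mu K | K in [set K | @closed G K /\ K `<=` A]]].

Record character (R : realType) (G : topologicalZmodType) := Character {
  char_fun :> G -> R[i];
  char_norm : forall x, normc (char_fun x) = 1;
  charD : forall x y, char_fun (x + y) = char_fun x * char_fun y;
  char_continuous : continuous (char_fun : G -> R[i]^o) }.

HB.instance Definition _ (R : realType) (G : topologicalZmodType) :=
  gen_eqMixin (character R G).
HB.instance Definition _ (R : realType) (G : topologicalZmodType) :=
  gen_choiceMixin (character R G).

(* principal value, in ]-pi, pi] for z != 0 *)
Definition arg (R : realType) (z : R[i]) : R :=
  if 0 <= Im z then acos (Re z / normc z) else - acos (Re z / normc z).

Definition circle_norm (R : realType) (z : R[i]) : R :=
  (2 * pi)^-1 * inf [set `|2 * pi * n%:~R + arg z| | n in [set: int]].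

Definition bohr (R : realType) (G : topologicalZmodType)
    (Gamma : {fset character R G}) (delta : R) : set (Borel G) :=
  [set x : G | forall gamma, gamma \in Gamma -> circle_norm (gamma x) <= delta].

Definition regular_bohr (R : realType) (cR CR : R) (G : topologicalZmodType)
    (mu : probability (Borel G) R) (Gamma : {fset character R G})
    (delta : R) : Prop :=
  forall kappa : R, `|kappa| * #|` Gamma|%:R <= cR ->
    `|fine (mu (bohr Gamma ((1 + kappa) * delta)))
        / fine (mu (bohr Gamma delta)) - 1|
      <= CR * `|kappa| * #|` Gamma|%:R.

Definition regularity_constants (R : realType) (cR CR : R) : Prop :=
  [/\ 0 < cR, 0 < CR &
    forall (G : topologicalZmodType) (mu : probability (Borel G) R),
      compact [set: G] -> hausdorff_space G -> haar_measure mu ->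
    forall (Gamma : {fset character R G}) (delta : R),
      Gamma != fset0%fset -> 0 < delta <= 1 ->
    exists delta' : R,
      delta / 2 <= delta' < delta /\ regular_bohr cR CR mu Gamma delta'].

Section measurable_bohr.
Variables (R : realType) (G : topologicalZmodType).
Implicit Types (gamma : character R G) (z : R[i]).

Lemma circle_normE z : normc z = 1 -> circle_norm z = (2 * pi)^-1 * acos (Re z).
Proof.
move=> z1; rewrite /circle_norm; congr (_ * _).
have Rez : -1 <= Re z <= 1.
  rewrite -ler_norml -z1; case: z {z1} => a b /=.
  by rewrite -sqrtr_sqr ler_wsqrtr // lerDl sqr_ge0.
have /andP[a0 api] : 0 <= acos (Re z) <= pi by rewrite acos_ge0 ?acos_lepi.
have argE : `|arg z| = acos (Re z).
  by rewrite /arg z1 divr1; case: ifP => _; rewrite ?normrN ger0_norm.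
have argpi : `|arg z| <= pi by rewrite argE.
rewrite -argE; apply/eqP; rewrite eq_le; apply/andP; split.
  apply: ge_inf; first by exists 0 => _ [n _ <-].
  by exists 0 => //; rewrite mulr0 add0r.
apply: lb_le_inf; first by exists `|2 * pi * 0%:~R + arg z|, 0.
move=> _ [n _ <-]; have [->|n0] := eqVneq n 0; first by rewrite mulr0 add0r.
have n1 : 1 <= `|n%:~R : R|.
  by rewrite -intr_norm -[1]/(1%:~R) ler_int -gtz0_ge1 normr_gt0.
have p0 : 0 <= pi :> R by exact: pi_ge0.
have : 2 * pi <= `|2 * pi * n%:~R : R|.
  by rewrite normrM (ger0_norm (mulr_ge0 _ p0)) // ler_peMr // mulr_ge0.
move=> h; have := lerB_normD (2 * pi * n%:~R) (arg z).
apply: le_trans; rewrite lerBrDr; apply: le_trans h.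
by rewrite mulr_natl mulr2n lerD.
Qed.

Lemma continuous_Re_char gamma : continuous (fun x => Re (gamma x)).
Proof.
move=> x; apply/cvgrPdist_lt => e e0.
have /cvgrPdist_lt/(_ e%:C) := @char_continuous _ _ gamma x.
rewrite ltcR => /(_ e0); apply: filterS => y.
rewrite normc_def ltcR; apply: le_lt_trans.
rewrite -sqrtr_sqr; case: (gamma x) (gamma y) => [a b] [c d] /=.
by rewrite ler_wsqrtr // lerDl sqr_ge0.
Qed.

Lemma measurable_bohr (Gamma : {fset character R G}) (delta : R) :
  measurable (bohr Gamma delta).
Proof.
have -> : bohr Gamma delta = \bigcap_(gamma in [set` Gamma])
    [set x : Borel G | circle_norm ((gamma : character R G) x) <= delta].
  by apply/seteqP; split.
apply: fin_bigcap_measurable; first exact: finite_fset.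
move=> gamma _; set r := 2 * pi * delta.
have p2 : 0 < 2 * pi :> R by rewrite mulr_gt0 // pi_gt0.
have E (x : G) : (circle_norm (gamma x) <= delta) = (acos (Re (gamma x)) <= r).
  by rewrite circle_normE ?char_norm // ler_pdivrMl.
have Reg (x : G) : -1 <= Re (gamma x) <= 1.
  rewrite -ler_norml -(char_norm gamma x); case: (gamma x) => a b /=.
  by rewrite -sqrtr_sqr ler_wsqrtr // lerDl sqr_ge0.
have [r0|r0] := ltP r 0.
  rewrite (_ : [set _ | _] = set0) //; apply/seteqP; split=> // x /=.
  by rewrite E leNgt (lt_le_trans r0) // acos_ge0.
have [rpi|rpi] := leP pi r.
  rewrite (_ : [set _ | _] = setT) //; apply/seteqP; split=> // x _ /=.
  by rewrite E (le_trans (acos_lepi (Reg x))).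
have -> : [set x : Borel G | circle_norm (gamma x) <= delta] =
    ~` ((fun x : G => Re (gamma x)) @^-1` [set t | t < cos r]).
  have F (x : G) : (acos (Re (gamma x)) <= r) = ~~ (Re (gamma x) < cos r).
    have xI : Re (gamma x) \in `[-1, 1] by rewrite in_itv /= Reg.
    have aI : acos (Re (gamma x)) \in `[0, pi].
      by rewrite in_itv /= acos_ge0 ?acos_lepi.
    have rI : r \in `[0, pi] by rewrite in_itv /= r0 ltW.
    by rewrite -[X in _ = ~~ (X < _)](acosK xI) (ltr_cos rI aI) -leNgt.
  by apply/seteqP; split=> x /=; rewrite E F => /negP.
apply: measurableC; apply: sub_sigma_algebra.
by apply: open_comp; [move=> x _; exact: continuous_Re_char | exact: open_lt].
Qed.

End measurable_bohr.

(* The last argument of mnormalize is the junk value for sets of measure zero;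
   Bohr sets of positive width have positive Haar measure. *)
Definition bohr_cutoff (R : realType) (G : topologicalZmodType)
    (mu : probability (Borel G) R) (Gamma : {fset character R G}) (delta : R) :
    probability (Borel G) R :=
  mnormalize (mrestr mu (measurable_bohr Gamma delta)) mu.

Section fourier.
Variables (R : realType) (G : topologicalZmodType).
Implicit Types (nu : probability (Borel G) R) (f : G -> R[i]).

Definition cintegrable nu f : Prop :=
  nu.-integrable setT (fun x : Borel G => (Re (f x))%:E) /\
  nu.-integrable setT (fun x : Borel G => (Im (f x))%:E).

Definition cintegral nu f : R[i] :=
  (\int[nu]_x Re (f x)) +i* (\int[nu]_x Im (f x)).

Definition fourier nu f (gamma : character R G) : R[i] :=
  cintegral nu (fun x => f x * (gamma x)^*).

Definition wiener_norm nu f : \bar R :=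
  \esum_(gamma in [set: character R G]) (normc (fourier nu f gamma))%:E.

Definition wiener_algebra nu f : Prop :=
  cintegrable nu f /\ (wiener_norm nu f < +oo)%E.

Definition Linfty_norm nu f : \bar R :=
  ess_sup nu (fun x : Borel G => (normc (f x))%:E).

End fourier.

(* Main.v *)
Require Import Defs.
From HB Require Import structures.
From mathcomp Require Import all_boot all_order all_algebra finmap.
From mathcomp Require Import all_classical all_reals all_analysis.
From mathcomp Require Import measurable_realfun ess_sup_inf zify ring lra complex.
Set Implicit Arguments.
Unset Strict Implicit.
Unset Printing Implicit Defensive.
Import Order.TTheory GRing.Theory Num.Theory.
Import numFieldNormedType.Exports.
Local Open Scope classical_set_scope.
Local Open Scope ring_scope.
Local Notation Re := (@complex.Re _).
Local Notation Im := (@complex.Im _).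

(** Let M be the essential supremum of f on the Bohr set, A its norm in the Wiener
    algebra, and S the set of characters at which the transform of f dbeta is at
    least epsilon M. Fix a regular Bohr set B1 with the same frequencies and a width
    of order epsilon delta / (L d), where L is of order epsilon^-1 (1 + log A_f).
    Call a tuple of characters dissociated if each nontrivial product of its entries
    with exponents -1, 0, 1 has over B1 a mean of modulus at most 1/3. The set
    Lambda consists of the entries of a dissociated tuple of maximal length in S. If
    gamma lies in S, the tuple extended by gamma is no longer dissociated, so that
    gamma or its conjugate is the product of a character w, with mean of modulus
    more than 1/3 over B1, and of entries of Lambda and their conjugates.
    Regularity shows that w is close to 1 on a narrow Bohr set, since translating B1
    by a small element hardly changes it (char_dist1_bohr_mean); hence so is gamma
    (spanned_dist1).

    What remains is that a dissociated tuple lam_1, ..., lam_n in S satisfies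
    n epsilon <= 256 N, where 2 ^ N >= A / M (dissociated_bounded_bound). The
    normalised cutoff is replaced by the density h of a convolution of the indicator
    of a slightly narrower Bohr set with an even convolution power of a symmetric
    discrete measure P on B1 (smooth_cutoff, positive_sample). Regularity makes the
    change small in mean. The transform of P is nonnegative, and so small at all
    nontrivial words in the lam_i that the Riesz products
    prod_i (1 + t Re (w_i lam_i)), for |w_i| = 1 and -1 <= t <= 1, have mass at
    most 2 against h. They are nonnegative, so their integrals against f h form a
    polynomial in t that is bounded by 2 M on [-1, 1]. Its linear coefficient
    contains all the large coefficients at the lam_i. The sum of the moduli of all
    coefficients is at most 2 A: this only has to be checked when f is a character
    (wiener_functional), and there it follows from positivity (sum_J). So for
    |t| <= 1/2 the terms of degree more than N are negligible, and Bernstein's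
    inequality at the origin (derivative_at0_functional) bounds the linear
    coefficient by a multiple of N M (riesz_bound).

    The inequality M <= A, without which the logarithm could be negative, and the
    reduction to characters both need f to be the sum of its Fourier series almost
    everywhere (fourier_inversion). By regularity of Haar measure this follows from
    the case of continuous functions (continuous_fourier_unique): a continuous w
    with vanishing Fourier coefficients is zero. If not, consider pairs (phi, psi)
    of positive definite functions with phi 0 = 1, for which the form of psi at each
    finite measure xi is at most the square of the supremum of the convolution of w
    with xi. Convolutions with w provide one with psi nonzero (exists_admissible).
    A pair for which psi has the largest norm exists by compactness
    (exists_maximal). Perturbing it by translations, strict convexity of the norm
    yields psi (x + a) = phi a * psi x (maximal_equivariant), so phi is a character.
    If xi is a Riemann sum for the vanishing Fourier coefficient of w at phi, then
    the convolution of w with xi is small, while the form of psi at xi is close to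
    psi 0: a contradiction. *)

(** * Complex numbers and complex-valued integrals *)

Section complex_numbers.
Variable R : realType.
Implicit Types (z w : R[i]) (r : R).

Lemma Re_addc z w : Re (z + w) = Re z + Re w. Proof. by case: z w => [a b] [c d]. Qed.
Lemma Im_addc z w : Im (z + w) = Im z + Im w. Proof. by case: z w => [a b] [c d]. Qed.
Lemma Re_oppc z : Re (- z) = - Re z. Proof. by case: z. Qed.
Lemma Im_oppc z : Im (- z) = - Im z. Proof. by case: z. Qed.
Lemma Re_subc z w : Re (z - w) = Re z - Re w. Proof. by rewrite Re_addc Re_oppc. Qed.
Lemma Im_subc z w : Im (z - w) = Im z - Im w. Proof. by rewrite Im_addc Im_oppc. Qed.
Lemma Re_mulc z w : Re (z * w) = Re z * Re w - Im z * Im w.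
Proof. by case: z w => [a b] [c d]. Qed.
Lemma Im_mulc z w : Im (z * w) = Re z * Im w + Im z * Re w.
Proof. by case: z w => [a b] [c d]. Qed.
Lemma Re_conjc z : Re z^* = Re z. Proof. by case: z. Qed.
Lemma Im_conjc z : Im z^* = - Im z. Proof. by case: z. Qed.
Lemma complex_eqP z w : Re z = Re w -> Im z = Im w -> z = w.
Proof. by case: z w => [a b] [c d] /= -> ->. Qed.

Lemma Re_sumc I (s : seq I) (P : pred I) (F : I -> R[i]) :
  Re (\sum_(i <- s | P i) F i) = \sum_(i <- s | P i) Re (F i).
Proof. by apply: (big_morph (@complex.Re R)) => // x y; rewrite Re_addc. Qed.
Lemma normc_ge0 z : 0 <= normc z.
Proof. by case: z => a b; exact: sqrtr_ge0. Qed.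

Lemma normcE2 z : normc z ^+ 2 = Re z ^+ 2 + Im z ^+ 2.
Proof. by case: z => a b /=; rewrite sqr_sqrtr // addr_ge0 ?sqr_ge0. Qed.

Lemma normcD z w : normc (z + w) <= normc z + normc w.
Proof. exact: le_normcD. Qed.

Lemma normc_opp z : normc (- z) = normc z.
Proof. exact: normcN. Qed.

Lemma normcB z w : normc (z - w) = normc (w - z).
Proof. by rewrite -normc_opp opprB. Qed.

Lemma normc_conj z : normc z^* = normc z.
Proof. by case: z => a b /=; rewrite sqrrN. Qed.

Lemma normc_real r : normc r%:C%C = `|r|.
Proof. by rewrite /= expr0n /= addr0 sqrtr_sqr. Qed.

Lemma normc_0 : normc (0 : R[i]) = 0. Proof. exact: normc0. Qed.
Lemma normc_1 : normc (1 : R[i]) = 1. Proof. exact: normc1. Qed.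

Lemma normcX z n : normc (z ^+ n) = normc z ^+ n.
Proof. by elim: n => [|n IH]; rewrite ?expr0 ?normc_1 // !exprS normcM IH. Qed.

Lemma Re_le_normc z : `|Re z| <= normc z.
Proof.
by case: z => a b /=; rewrite -sqrtr_sqr ler_wsqrtr // lerDl sqr_ge0.
Qed.

Lemma Im_le_normc z : `|Im z| <= normc z.
Proof.
by case: z => a b /=; rewrite -sqrtr_sqr ler_wsqrtr // lerDr sqr_ge0.
Qed.

Lemma normc_le_ReIm z : normc z <= `|Re z| + `|Im z|.
Proof.
rewrite -(@ler_pXn2r _ 2) ?nnegrE ?normc_ge0 ?addr_ge0 //.
rewrite normcE2 sqrrD !real_normK ?num_real // lerD2r lerDl.
by rewrite mulrn_wge0 // mulr_ge0.
Qed.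

Lemma normc_sum I (s : seq I) (P : pred I) (F : I -> R[i]) :
  normc (\sum_(i <- s | P i) F i) <= \sum_(i <- s | P i) normc (F i).
Proof.
elim/big_ind2 : _ => //; first by rewrite normc_0.
by move=> a b c d ab cd; apply: (le_trans (normcD _ _)); apply: lerD.
Qed.

Lemma normc_prod I (s : seq I) (P : pred I) (F : I -> R[i]) :
  normc (\prod_(i <- s | P i) F i) = \prod_(i <- s | P i) normc (F i).
Proof. by apply: (big_morph (@normc R)); [exact: normcM | exact: normc_1]. Qed.

Lemma mul_conjc z : z * z^* = ((normc z) ^+ 2)%:C%C.
Proof.
apply: complex_eqP; rewrite ?Re_mulc ?Im_mulc Re_conjc Im_conjc /= ?normcE2; ring.
Qed.

Lemma phaseP z : exists2 u, normc u = 1 & u * z = (normc z)%:C%C.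
Proof.
have [->|z0] := eqVneq z 0.
  by exists 1; rewrite ?normc_1 // mulr0 normc_0.
have n0 : normc z != 0 by apply: contra_neq z0 => /eq0_normc.
exists (z^* * ((normc z)^-1)%:C%C).
  by rewrite normcM normc_conj normc_real ger0_norm ?invr_ge0 ?normc_ge0 // divff.
rewrite mulrAC [z^* * z]mulrC mul_conjc -rmorphM /=.
by congr (_%:C)%C; rewrite expr2 mulfK.
Qed.

End complex_numbers.

Section complex_integral.
Variables (R : realType) (G : topologicalZmodType).
Variable nu : probability (Borel G) R.
Implicit Types (f g : G -> R[i]) (u v : G -> R).

(** Integrals are taken against a probability measure, so bounded measurable
    functions are integrable; everything about complex functions is reduced to the
    real and imaginary parts. *)
Definition rint u := nu.-integrable setT (fun x : Borel G => (u x)%:E).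
Definition rmeas u := measurable_fun setT (u : Borel G -> R).
Definition cmeas f := rmeas (fun x => Re (f x)) /\ rmeas (fun x => Im (f x)).

Lemma rint_meas u : rint u -> rmeas u.
Proof. by move=> /measurable_int/measurable_EFinP. Qed.

Lemma cint_meas f : cintegrable nu f -> cmeas f.
Proof. by case=> /rint_meas ? /rint_meas ?; split. Qed.

Lemma rint_bounded u b : rmeas u -> (forall x, `|u x| <= b) -> rint u.
Proof.
move=> mu_ ub; apply: measurable_bounded_integrable => //.
  by rewrite (le_lt_trans (probability_le1 _ _)) // ltry.
exists b; split; first exact: num_real.
by move=> y by_ x _ /=; apply: (le_trans (ub x)); exact: ltW.
Qed.

Lemma rint_cst r : rint (fun=> r).
Proof. by apply: (@rint_bounded _ `|r|) => //; exact: measurable_cst. Qed.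

Lemma rint_le u v : rmeas u -> rint v -> (forall x, `|u x| <= v x) -> rint u.
Proof.
move=> mu_ iv uv; apply: (le_integrable _ _ _ iv) => //.
  exact/measurable_EFinP.
move=> x _ /=; rewrite lee_fin (le_trans (uv x)) // ler_norm //.
Qed.

Lemma rintD u v : rint u -> rint v -> rint (fun x => u x + v x).
Proof. by move=> iu iv; exact: (integrableD measurableT iu iv). Qed.

Lemma rintN u : rint u -> rint (fun x => - u x).
Proof. by move=> iu; exact: (integrableN iu). Qed.

Lemma rintB u v : rint u -> rint v -> rint (fun x => u x - v x).
Proof. by move=> iu iv; apply: rintD => //; exact: rintN. Qed.

Lemma rintZ r u : rint u -> rint (fun x => r * u x).
Proof. by move=> iu; exact: (integrableZl measurableT _ iu). Qed.

Lemma rint_abs u : rint u -> rint (fun x => `|u x|).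
Proof. by move=> iu; exact: (integrable_norm iu). Qed.

Lemma rint_mul u v b : rint u -> rmeas v -> (forall x, `|v x| <= b) ->
  rint (fun x => u x * v x).
Proof.
move=> iu mv vb; apply: (@rint_le _ (fun x => b * `|u x|)).
- by apply: measurable_funM => //; exact: rint_meas.
- by apply: rintZ; exact: rint_abs.
by move=> x; rewrite normrM mulrC ler_wpM2r.
Qed.

Definition RI u : R := \int[nu]_x u x.

Lemma RID u v : rint u -> rint v -> RI (fun x => u x + v x) = RI u + RI v.
Proof. by move=> iu iv; exact: RintegralD. Qed.
Lemma RIB u v : rint u -> rint v -> RI (fun x => u x - v x) = RI u - RI v.
Proof. by move=> iu iv; exact: RintegralB. Qed.
Lemma RIZ r u : rint u -> RI (fun x => r * u x) = r * RI u.
Proof. by move=> iu; exact: RintegralZl. Qed.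
Lemma RI_le u v : rint u -> rint v -> (forall x, u x <= v x) -> RI u <= RI v.
Proof. by move=> iu iv uv; apply: le_Rintegral => // x _; exact: uv. Qed.
Lemma RI_ge0 u : (forall x, 0 <= u x) -> 0 <= RI u.
Proof. by move=> u0; apply: Rintegral_ge0 => x _; exact: u0. Qed.
Lemma RI_cst r : RI (fun=> r) = r.
Proof.
rewrite /RI Rintegral_cst // (_ : fine _ = 1) ?mulr1 //.
by have /(congr1 fine) := probability_setT nu.
Qed.
Lemma RI_abs u : rint u -> `|RI u| <= RI (fun x => `|u x|).
Proof. by move=> iu; exact: le_normr_Rintegral. Qed.

Lemma cint_bounded f b : cmeas f -> (forall x, normc (f x) <= b) ->
  cintegrable nu f.
Proof.
by move=> [mr mi] fb; split; apply: (@rint_bounded _ b) => // x;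
  rewrite (le_trans _ (fb x)) // (Re_le_normc, Im_le_normc).
Qed.

Lemma cintD f g : cintegrable nu f -> cintegrable nu g ->
  cintegrable nu (fun x => f x + g x).
Proof.
move=> [fr fi] [gr gi]; split.
  by under eq_fun do rewrite Re_addc; exact: rintD.
by under eq_fun do rewrite Im_addc; exact: rintD.
Qed.

Lemma cintM_bounded f g b : cintegrable nu f -> cmeas g ->
  (forall x, normc (g x) <= b) -> cintegrable nu (fun x => f x * g x).
Proof.
move=> [fr fi] [gr gi] gb.
have rb x : `|Re (g x)| <= b by apply: le_trans (gb x); exact: Re_le_normc.
have ib x : `|Im (g x)| <= b by apply: le_trans (gb x); exact: Im_le_normc.
split.
  under eq_fun do rewrite Re_mulc.
  by apply: rintB; [exact: rint_mul rb | exact: rint_mul ib].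
under eq_fun do rewrite Im_mulc.
by apply: rintD; [exact: rint_mul ib | exact: rint_mul rb].
Qed.

Lemma cmeas_cst (z : R[i]) : cmeas (fun=> z).
Proof. by split; exact: measurable_cst. Qed.

Lemma cintZ (z : R[i]) f : cintegrable nu f -> cintegrable nu (fun x => z * f x).
Proof.
move=> ifx; under eq_fun do rewrite mulrC.
by apply: (@cintM_bounded _ _ (normc z)) => //; exact: cmeas_cst.
Qed.

Lemma cintB f g : cintegrable nu f -> cintegrable nu g ->
  cintegrable nu (fun x => f x - g x).
Proof.
move=> fi gi; apply: cintD => //; under eq_fun do rewrite -mulN1r.
exact: cintZ.
Qed.

Lemma cint_sum I (s : seq I) (P : pred I) (F : I -> G -> R[i]) :
  (forall i, P i -> cintegrable nu (F i)) ->
  cintegrable nu (fun x => \sum_(i <- s | P i) F i x).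
Proof.
move=> iF; elim: s => [|i s IH].
  under eq_fun do rewrite big_nil.
  by apply: (@cint_bounded _ 0); [exact: cmeas_cst | move=> x; rewrite normc_0].
under eq_fun do rewrite big_cons.
by case Pi: (P i) => //; apply: cintD => //; exact: iF.
Qed.

Lemma cintegralD f g : cintegrable nu f -> cintegrable nu g ->
  cintegral nu (fun x => f x + g x) = cintegral nu f + cintegral nu g.
Proof.
move=> [fr fi] [gr gi]; apply: complex_eqP; rewrite ?Re_addc ?Im_addc /=.
  by rewrite -(RID fr gr); congr Rintegral; apply/funext => x; rewrite Re_addc.
by rewrite -(RID fi gi); congr Rintegral; apply/funext => x; rewrite Im_addc.
Qed.

Lemma cintegralZ (z : R[i]) f : cintegrable nu f ->
  cintegral nu (fun x => z * f x) = z * cintegral nu f.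
Proof.
move=> [fr fi]; apply: complex_eqP; rewrite ?Re_mulc ?Im_mulc /=.
  rewrite -(RIZ _ fr) -(RIZ _ fi) -(RIB (rintZ _ fr) (rintZ _ fi)).
  by congr Rintegral; apply/funext => x; rewrite Re_mulc.
rewrite -(RIZ _ fr) -(RIZ _ fi) -(RID (rintZ _ fi) (rintZ _ fr)).
by congr Rintegral; apply/funext => x; rewrite Im_mulc.
Qed.

Lemma cintegralZr (z : R[i]) f : cintegrable nu f ->
  cintegral nu (fun x => f x * z) = cintegral nu f * z.
Proof.
by move=> fi; rewrite mulrC -cintegralZ //; congr cintegral; apply/funext => x; rewrite mulrC.
Qed.

Lemma cintegralB f g : cintegrable nu f -> cintegrable nu g ->
  cintegral nu (fun x => f x - g x) = cintegral nu f - cintegral nu g.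
Proof.
move=> fi gi; rewrite -mulN1r -cintegralZ // -cintegralD //; last exact: cintZ.
by congr cintegral; apply/funext => x; rewrite mulN1r.
Qed.

Lemma cintegral_sum I (s : seq I) (P : pred I) (F : I -> G -> R[i]) :
  (forall i, P i -> cintegrable nu (F i)) ->
  cintegral nu (fun x => \sum_(i <- s | P i) F i x) =
  \sum_(i <- s | P i) cintegral nu (F i).
Proof.
move=> iF; elim: s => [|i s IH].
  under eq_fun do rewrite big_nil.
  rewrite big_nil; apply: complex_eqP => /=; exact: RI_cst.
under eq_fun do rewrite big_cons.
rewrite big_cons; case Pi: (P i) => //.
by rewrite cintegralD ?IH //; [exact: iF | exact: cint_sum].
Qed.

Lemma cintegral_cst (z : R[i]) : cintegral nu (fun=> z) = z.
Proof. by apply: complex_eqP => /=; exact: RI_cst. Qed.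

(** Rotating the integral onto the positive half-line reduces the bound to the
   monotonicity of the integral of a real part. *)
Lemma normc_cintegral_le f u : cintegrable nu f -> rint u ->
  (forall x, normc (f x) <= u x) -> normc (cintegral nu f) <= RI u.
Proof.
move=> fi iu fu; have [w w1 wE] := phaseP (cintegral nu f).
have -> : normc (cintegral nu f) = Re (cintegral nu (fun x => w * f x)).
  by rewrite cintegralZ // wE.
have [wr _] := cintZ w fi.
apply: RI_le => // x; apply: (le_trans (ler_norm _)).
by apply: (le_trans (Re_le_normc _)); rewrite normcM w1 mul1r.
Qed.

Lemma normc_cintegral_bounded f b : cmeas f -> (forall x, normc (f x) <= b) ->
  normc (cintegral nu f) <= b.
Proof.
move=> mf fb; rewrite -[leRHS]RI_cst; apply: normc_cintegral_le => //.
  exact: cint_bounded fb.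
exact: rint_cst.
Qed.

Lemma cmeasM f g : cmeas f -> cmeas g -> cmeas (fun x => f x * g x).
Proof.
move=> [fr fi] [gr gi]; split.
  rewrite /rmeas; under eq_fun do rewrite Re_mulc.
  by apply: measurable_funB; exact: measurable_funM.
rewrite /rmeas; under eq_fun do rewrite Im_mulc.
by apply: measurable_funD; exact: measurable_funM.
Qed.

Lemma cmeas_real u : rmeas u -> cmeas (fun x => (u x)%:C%C).
Proof. by move=> mu_; split => //=; exact: measurable_cst. Qed.

Lemma cmeas_normc f : cmeas f -> rmeas (fun x => normc (f x)).
Proof.
move=> [fr fi]; rewrite /rmeas.
have -> : (fun x => normc (f x)) =
    (fun x => Num.sqrt (Re (f x) ^+ 2 + Im (f x) ^+ 2)).
  by apply/funext => x; case: (f x).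
apply: measurableT_comp; first exact: (@continuous_measurable_fun R Num.sqrt (@sqrt_continuous R)).
by apply: measurable_funD; apply: measurable_funX.
Qed.

Lemma rint_normc f : cintegrable nu f -> rint (fun x => normc (f x)).
Proof.
move=> [fr fi]; apply: (@rint_le _ (fun x => `|Re (f x)| + `|Im (f x)|)).
- by apply: cmeas_normc; apply: cint_meas.
- by apply: rintD; exact: rint_abs.
by move=> x; rewrite ger0_norm ?normc_ge0 // normc_le_ReIm.
Qed.

Lemma cintegral_real u : cintegral nu (fun x => (u x)%:C%C) = (RI u)%:C%C.
Proof. by apply: complex_eqP => //=; exact: RI_cst. Qed.

End complex_integral.

(** * Compact groups: cells and uniform continuity *)

Section topological_group.
Variable G : topologicalZmodType.

Lemma addr_continuous (a : G) : continuous (fun x : G => a + x).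
Proof.
move=> x; apply: (@continuous_comp _ _ _ (fun x : G => (a, x))
  (fun x : G * G => x.1 + x.2)); last exact: add_continuous.
by apply: cvg_pair; [exact: cvg_cst | exact: cvg_id].
Qed.

Lemma open_shift (a : G) (U : set G) : open U -> open [set x | U (a + x)].
Proof. by move=> oU; apply: open_comp => // x _; exact: addr_continuous. Qed.

Lemma nbhs0_shift (x : G) (A : set G) : nbhs x A -> nbhs (0 : G) [set a | A (x + a)].
Proof. by move=> Ax; apply: addr_continuous; rewrite addr0. Qed.

(** The covering form of compactness is stated for pointed spaces; G becomes one
    with base point 0. *)
Definition pointed_copy : Type := G.
HB.instance Definition _ := TopologicalZmodule.on pointed_copy.
HB.instance Definition _ := isPointed.Build pointed_copy (0 : G).

(** Compactness yields finitely many translates of U covering G, and removing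
   from each translate the previous ones leaves the cells. *)
Lemma compact_cells (U : set G) : compact [set: G] -> nbhs (0 : G) U ->
  exists (n : nat) (x : nat -> G) (E : nat -> set (Borel G)),
  [/\ forall i, measurable (E i), forall i y, E i y -> U (y - x i),
      trivIset setT E & \bigcup_(i < n) E i = setT].
Proof.
move=> cG; rewrite nbhsE => -[V [oV V0] VU].
have cGp : compact [set: pointed_copy] by exact: cG.
move: cGp; rewrite compact_cover.
move=> /(_ _ [set: G] (fun x : G => [set y | V (- x + y)])).
case=> [x _|x _|D _ Dc]; first exact: open_shift.
  by exists x => //=; rewrite addNr.
have [s sD] : exists s : seq G, s =i D by exists (enum_fset D).
pose F i : set (Borel G) := [set y : G | (i < size s)%N /\ V (- nth 0 s i + y)].
have mF i : measurable (F i).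
  have [/= is_|is_] := boolP (i < size s)%N.
    apply: sub_sigma_algebra; rewrite (_ : F i = [set y | V (- nth 0 s i + y)]).
      exact: open_shift.
    by apply/seteqP; split => [y []|y] //.
  rewrite (_ : F i = set0); first exact: measurable0.
  by apply/seteqP; split => [y [/(negP is_)]|].
exists (size s), (nth 0 s), (seqDU F); split.
- exact: seqDU_measurable.
- by move=> i y [[_ Vy] _]; apply: VU; rewrite addrC.
- exact: trivIset_seqDU.
rewrite bigcup_mkord -bigsetU_seqDU -bigcup_mkord.
apply/seteqP; split=> // y _; have [x /= xD Vx] := Dc y I.
have xs : x \in s by rewrite sD.
by exists (index x s); rewrite /= ?index_mem //; split; rewrite ?index_mem // nth_index.
Qed.

End topological_group.

Section compact_group.
Variables (R : realType) (G : topologicalZmodType).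
Hypothesis cG : compact [set: G].
Implicit Types (u v : G -> R) (f g : G -> R[i]).

(** Continuity of both parts, in the form in which measurability and integrability
    of complex functions are expressed. *)
Definition ccont f := continuous (fun x => Re (f x)) /\ continuous (fun x => Im (f x)).

Lemma rcont_rmeas u : continuous u -> rmeas u.
Proof.
move=> cu; apply: (measurability _ (RGenOpens.measurableE R)).
move=> _ [_ [a [b ->] <-]]; apply: measurableI => //.
apply: sub_sigma_algebra; apply: (@open_comp _ _ (u : G -> R)) => //.
Qed.

Lemma ccont_cmeas f : ccont f -> cmeas f.
Proof. by case=> cr ci; split; exact: rcont_rmeas. Qed.

Lemma rcont_bounded u : continuous u -> exists b, forall x, `|u x| <= b.
Proof.
move=> cu; have /compact_near_coveringP := cG.
move=> /(_ R (pinfty_nbhs R) (fun b x => `|u x| <= b) _).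
case=> [x _|M [_ H]]; last first.
  by exists (M + 1) => x; apply: H => //; rewrite ltrDl.
have /cvgrPdist_le /(_ _ ltr01) ux := cu x.
exists ([set y | `|u x - u y| <= 1], [set b | `|u x| + 1 < b]) => /=.
  by split => //; exists (`|u x| + 1); split => //; exact: num_real.
move=> [y b] [/= H1 H2]; apply: ltW; apply: le_lt_trans H2.
by rewrite -lerBlDl; apply: le_trans H1; rewrite distrC lerB_dist.
Qed.

(** Continuity of (x, a) |-> u (x + a) at the points (x, 0) gives a neighbourhood of
    0 for each x, and compactness makes it independent of x. *)
Lemma rcont_unif u e : continuous u -> 0 < e ->
  \forall a \near (0 : G), forall x, `|u (x + a) - u x| <= e.
Proof.
move=> cu e0; have /compact_near_coveringP cov := cG.
suff H : \forall a \near (0 : G), [set: G] `<=` (fun x => `|u (x + a) - u x| <= e).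
  by apply: filterS H => a H x; exact: (H x I).
apply: (cov G (nbhs (0 : G)) (fun a x => `|u (x + a) - u x| <= e)) => x _.
have e2 : 0 < e / 2 by rewrite divr_gt0.
have cux : {for x, continuous u} by exact: cu.
have /cvgrPdist_le /(_ _ e2) ux := cux.
have : nbhs (x, (0 : G)) [set z : G * G | `|u x - u (z.1 + z.2)| <= e / 2].
  apply: (@add_continuous G (x, 0) [set y | `|u x - u y| <= e / 2]) => /=.
  by rewrite addr0.
move=> [[A B] /= [xA B0] AB].
exists (A `&` [set y | `|u x - u y| <= e / 2], B) => /=.
  by split => //; exact: filterI.
move=> [y a] [/= [Ay uy] Ba]; have := AB (y, a) (conj Ay Ba) => /= uya.
rewrite -(subrK (u x) (u (y + a))) -addrA (le_trans (ler_normD _ _)) //.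
by rewrite [e]splitr distrC lerD.
Qed.

Lemma ccont_bounded f : ccont f -> exists b, forall x, normc (f x) <= b.
Proof.
move=> [/rcont_bounded [a fa] /rcont_bounded [b fb]]; exists (a + b) => x.
by apply: (le_trans (normc_le_ReIm _)); apply: lerD.
Qed.

Lemma ccont_unif f e : ccont f -> 0 < e ->
  \forall a \near (0 : G), forall x, normc (f (x + a) - f x) <= e.
Proof.
move=> [cr ci] e0; have e2 : 0 < e / 2 by rewrite divr_gt0.
near=> a => x; apply: (le_trans (normc_le_ReIm _)); rewrite Re_subc Im_subc [e]splitr.
by apply: lerD; move: x; near: a; exact: rcont_unif.
Unshelve. all: by end_near. Qed.

Lemma ccont_cst (z : R[i]) : ccont (fun=> z).
Proof. by split => x; exact: cvg_cst. Qed.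

Lemma ccontD f g : ccont f -> ccont g -> ccont (fun x => f x + g x).
Proof.
move=> [fr fi] [gr gi]; split => x.
  by under eq_fun do rewrite Re_addc; apply: cvgD; [exact: fr|exact: gr].
by under eq_fun do rewrite Im_addc; apply: cvgD; [exact: fi|exact: gi].
Qed.

Lemma ccontM f g : ccont f -> ccont g -> ccont (fun x => f x * g x).
Proof.
move=> [fr fi] [gr gi]; split => x.
  under eq_fun do rewrite Re_mulc.
  by apply: cvgB; apply: cvgM; [exact: fr|exact: gr|exact: fi|exact: gi].
under eq_fun do rewrite Im_mulc.
by apply: cvgD; apply: cvgM; [exact: fr|exact: gi|exact: fi|exact: gr].
Qed.

Lemma ccont_conj f : ccont f -> ccont (fun x => (f x)^*).
Proof.
move=> [fr fi]; split => x.
  by under eq_fun do rewrite Re_conjc; exact: fr.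
by under eq_fun do rewrite Im_conjc; apply: cvgN; exact: fi.
Qed.

Lemma ccont_comp f (h : G -> G) : ccont f -> continuous h ->
  ccont (fun x => f (h x)).
Proof.
move=> [fr fi] ch; split => x.
  by apply: (@continuous_comp G G R h (fun y => Re (f y)) x);
    [exact: ch | exact: fr].
by apply: (@continuous_comp G G R h (fun y => Im (f y)) x);
  [exact: ch | exact: fi].
Qed.

Lemma ccont_shift f a : ccont f -> ccont (fun x => f (a + x)).
Proof. by move=> cf; apply: ccont_comp => //; exact: addr_continuous. Qed.

Lemma ccont_shiftr f a : ccont f -> ccont (fun x => f (x + a)).
Proof.
move=> cf; under eq_fun do rewrite addrC; exact: ccont_shift.
Qed.

Lemma ccont_sum I (s : seq I) (P : pred I) (F : I -> G -> R[i]) :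
  (forall i, P i -> ccont (F i)) -> ccont (fun x => \sum_(i <- s | P i) F i x).
Proof.
move=> cF; elim: s => [|i s IH].
  by under eq_fun do rewrite big_nil; exact: ccont_cst.
under eq_fun do rewrite big_cons.
by case Pi: (P i) => //; apply: ccontD => //; exact: cF.
Qed.

(** A bound on f (x + a) - f x uniform in x is all that the functions built by
    integration and by limits below provide. *)
Lemma ccont_from_unif f :
  (forall e, 0 < e -> \forall a \near (0 : G), forall x,
     normc (f (x + a) - f x) <= e) -> ccont f.
Proof.
move=> H; have K x e : 0 < e -> \forall y \near x, normc (f y - f x) <= e.
  move=> e0; have := H e e0 => He.
  have : nbhs x [set y | forall z, normc (f (z + (- x + y)) - f z) <= e].
    apply: (@addr_continuous G (- x) x
      [set a | forall z, normc (f (z + a) - f z) <= e]).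
    by rewrite addNr.
  by apply: filterS => y /(_ x); rewrite addrA subrr add0r.
split => x; apply/cvgrPdist_le => e e0; apply: filterS (K x e e0) => y;
  apply: le_trans; rewrite distrC -(Re_subc, Im_subc).
  exact: Re_le_normc.
exact: Im_le_normc.
Qed.

Lemma char_ccont (gamma : character R G) : ccont gamma.
Proof.
split; first exact: continuous_Re_char.
move=> x; apply/cvgrPdist_lt => e e0.
have /cvgrPdist_lt/(_ e%:C%C) := @char_continuous _ _ gamma x.
rewrite ltcR => /(_ e0); apply: filterS => y.
rewrite normc_def ltcR; apply: le_lt_trans.
rewrite -sqrtr_sqr; case: (gamma x) (gamma y) => [a b] [c d] /=.
by rewrite ler_wsqrtr // lerDr sqr_ge0.
Qed.

End compact_group.

(** * Haar measure and Riemann sums *)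

Section haar.
Variables (R : realType) (G : topologicalZmodType).
Variable mu : probability (Borel G) R.
Hypothesis cG : compact [set: G].
Hypothesis haar : haar_measure mu.
Implicit Types (u v : G -> R) (f g : G -> R[i]).

Lemma measurable_shift (a : G) :
  measurable_fun setT (fun x : Borel G => (a + (x : G) : G) : Borel G).
Proof.
apply: (@measurability _ _ (Borel G) (Borel G) setT _ (@open G)) => //.
move=> _ [A oA <-]; have := open_shift a oA.
by rewrite setTI => oA'; exact: sub_sigma_algebra.
Qed.

Lemma rmeas_shift a u : rmeas u -> rmeas (fun x => u (a + x)).
Proof.
rewrite /rmeas => mu_.
exact: (measurableT_comp (f := u : Borel G -> R) mu_ (measurable_shift a)).
Qed.

Lemma haar_preimage a (A : set (Borel G)) : measurable A ->
  mu [set x : G | A (a + x)] = mu A.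
Proof.
move=> mA; have [inv _ _] := haar; rewrite -(inv (- a) _ mA); congr (mu _).
apply/seteqP; split=> [x Ax|_ [x Ax <-]] /=; last by rewrite addrA subrr add0r.
by exists (a + x); rewrite ?addrA ?addNr ?add0r.
Qed.

Let shift (a : G) : Borel G -> Borel G := fun x : Borel G => (a + (x : G) : G).

(** Translations preserve Haar measure, so mu is its own image measure. *)
Lemma integral_shift a (u : G -> R) : rint mu u ->
  rint mu (fun x => u (a + x)) /\ RI mu (fun x => u (a + x)) = RI mu u.
Proof.
move=> iu; have ms : measurable_fun setT (shift a) := measurable_shift a.
have E (A : set (Borel G)) : measurable A -> A `<=` setT ->
    mu A = pushforward mu (shift a) A.
  by move=> mA _; rewrite /pushforward -(haar_preimage a mA).
have mu_ := rint_meas iu.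
have ius : rint mu (fun x => u (a + x)).
  have ms' := rmeas_shift a mu_.
  apply/integrableP; split; first by apply/measurable_EFinP.
  have /integrableP[_] := iu; apply: le_lt_trans.
  rewrite [leRHS](eq_measure_integral (pushforward mu (shift a))); last first.
    by move=> A mA AT; exact: E.
  rewrite ge0_integral_pushforward //.
  have mEu : measurable_fun setT (fun x : Borel G => (u x)%:E).
    by apply/measurable_EFinP.
  exact: (measurableT_comp _ mEu).
split => //; rewrite /RI /Rintegral; congr fine.
rewrite [RHS](eq_measure_integral (pushforward mu (shift a))); last first.
  by move=> A mA AT; exact: E.
rewrite integral_pushforward //.
by apply/measurable_EFinP.
Qed.

Lemma RI_shift a u : rint mu u -> RI mu (fun x => u (a + x)) = RI mu u.
Proof. by move=> /(integral_shift a) []. Qed.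

Lemma rint_shift a u : rint mu u -> rint mu (fun x => u (a + x)).
Proof. by move=> /(integral_shift a) []. Qed.

Lemma cint_shift a f : cintegrable mu f -> cintegrable mu (fun x => f (a + x)).
Proof. by move=> [fr fi]; split; [exact: (rint_shift a fr) | exact: (rint_shift a fi)]. Qed.

Lemma cintegral_shift a f : cintegrable mu f ->
  cintegral mu (fun x => f (a + x)) = cintegral mu f.
Proof.
by move=> [fr fi]; apply: complex_eqP => /=; [exact: (RI_shift a fr)|exact: (RI_shift a fi)].
Qed.

Lemma ccont_cint f : ccont f -> cintegrable mu f.
Proof.
by move=> cf; have [b fb] := ccont_bounded cG cf; apply: cint_bounded fb; exact: ccont_cmeas.
Qed.

Lemma indic_partition (n : nat) (E : nat -> set (Borel G)) (y : Borel G) :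
  trivIset setT E -> (\bigcup_(i < n) E i) y -> \sum_(i < n) \1_(E i) y = 1 :> R.
Proof.
move=> tE [i /= lin Eiy]; rewrite (bigD1 (Ordinal lin)) //= indicE mem_set //.
rewrite big1 ?addr0 // => j ji; rewrite indicE memNset // => Ejy.
have /trivIsetP/(_ j i I I) := tE; move=> H.
have /H : (j : nat) != i by apply: contra_neq ji => ji; exact: val_inj.
by move=> /seteqP[/(_ y) /= Z _]; exact: Z.
Qed.

(** Sample points are taken inside B; a cell that misses B has no weight. *)
Lemma cells_in (B : set (Borel G)) (U : set G) : measurable B -> B !=set0 ->
  nbhs (0 : G) U ->
  exists (n : nat) (x : nat -> G) (E : nat -> set (Borel G)),
  [/\ forall i, measurable (E i), forall i, B (x i),
      forall i y, E i y -> U (y - x i)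
    & forall y : G, \sum_(i < n) \1_(E i) y = \1_B y :> R].
Proof.
move=> mB [b Bb] U0.
have : nbhs ((0 : G), (0 : G)) [set z : G * G | U (z.1 - z.2)].
  by apply: (@sub_continuous G (0, 0) U) => /=; rewrite subr0.
move=> [[A C] /= [A0 C0] AC].
have ACn : nbhs (0 : G) (A `&` C) by exact: filterI.
have [n [x [E [mE EU tE cE]]]] := compact_cells cG ACn.
have /choice[x' x'P] : forall i, exists x' : G, B x' /\
    ((E i `&` B) !=set0 -> (E i `&` B) x').
  move=> i; have [[z [Ez Bz]]|H] := pselect ((E i `&` B) !=set0).
    by exists z.
  by exists b; split.
exists n, x', (fun i => E i `&` B); split.
- by move=> i; exact: measurableI.
- by move=> i; case: (x'P i).
- move=> i y [Ey By]; have [_ /(_ _)[|Ex' _]] := x'P i; first by exists y.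
  have [Ay _] := EU _ _ Ey; have [_ Cx] := EU _ _ Ex'.
  have := AC (y - x i, x' i - x i) (conj Ay Cx) => /=.
  by rewrite opprB addrA subrK.
move=> y; have [By|By] := pselect (B y); last first.
  rewrite indicE (memNset By) big1 // => i _.
  by rewrite indicE memNset // => -[].
rewrite indicE (mem_set By) -[RHS](@indic_partition n E y) ?cE //.
by apply: eq_bigr => i _; rewrite !indicE in_setI (mem_set By) andbT.
Qed.

Definition weight g (A : set (Borel G)) : R[i] :=
  cintegral mu (fun y => g y * (\1_A y)%:C%C).

Lemma cmeas_indic (A : set (Borel G)) : measurable A ->
  cmeas (fun y : G => (\1_A y : R)%:C%C).
Proof. by move=> mA; apply: cmeas_real; exact: measurable_indic. Qed.

Lemma normc_indic (A : set (Borel G)) (y : G) : normc ((\1_A y : R)%:C%C) <= 1.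
Proof.
by rewrite normc_real indicE; case: (_ \in _) => /=; rewrite ?normr1 ?normr0.
Qed.

Lemma cint_indic g (A : set (Borel G)) : measurable A -> cintegrable mu g ->
  cintegrable mu (fun y => g y * (\1_A y)%:C%C).
Proof.
move=> mA ig; apply: (cintM_bounded ig (cmeas_indic mA)) => x.
exact: normc_indic.
Qed.

(** On each cell h is within e of its sample value, so the error is at most e times
    the mass of |g|. *)
Lemma riemann_sum (B : set (Borel G)) n (x : nat -> G)
    (E : nat -> set (Borel G)) g h b e :
  (forall i, measurable (E i)) ->
  (forall y : G, \sum_(i < n) \1_(E i) y = \1_B y :> R) ->
  (forall y, ~ B y -> g y = 0) -> cintegrable mu g ->
  cmeas h -> (forall y, normc (h y) <= b) ->
  (forall i y, E i y -> normc (h y - h (x i)) <= e) ->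
  normc (\sum_(i < n) weight g (E i) * h (x i)
           - cintegral mu (fun y => g y * h y)) <= e * RI mu (fun y => normc (g y)).
Proof.
move=> mE pE gB ig mh hb hE.
have igh : cintegrable mu (fun y => g y * h y) by exact: cintM_bounded hb.
have iw i : cintegrable mu (fun y => g y * (\1_(E i) y)%:C%C * h (x i)).
  by apply: (@cintM_bounded _ _ mu _ (fun=> h (x i)) (normc (h (x i)))
    (cint_indic (mE i) ig) (cmeas_cst G _)).
have -> : \sum_(i < n) weight g (E i) * h (x i) =
    cintegral mu (fun y => \sum_(i < n) g y * (\1_(E i) y)%:C%C * h (x i)).
  rewrite cintegral_sum //; apply: eq_bigr => i _.
  by rewrite cintegralZr //; exact: cint_indic.
rewrite -cintegralB //; last by apply: cint_sum.
rewrite -RIZ; last exact: rint_normc.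
apply: normc_cintegral_le.
- by apply: cintB => //; exact: cint_sum.
- by apply: rintZ; exact: rint_normc.
move=> y; have [By|By] := pselect (B y); last first.
  rewrite (gB _ By) mul0r subr0 normc_0 mulr0 big1 ?normc_0 // => i _.
  by rewrite !mul0r.
have -> : g y * h y = \sum_(i < n) g y * (\1_(E i) y)%:C%C * h y.
  rewrite -mulr_suml -mulr_sumr; congr (_ * _).
  by rewrite -(rmorph_sum (real_complex R)) pE indicE (mem_set By) mulr1.
rewrite -sumrB; under eq_bigr do rewrite -mulrBr.
apply: (le_trans (normc_sum _ _ _)).
have -> : e * normc (g y) = \sum_(i < n) normc (g y) * \1_(E i) y * e.
  by rewrite -mulr_suml -mulr_sumr pE indicE (mem_set By) mulr1 mulrC.
apply: ler_sum => i _; rewrite !normcM normc_real indicE.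
case: (boolP (_ \in _)) => [/set_mem Ey|_]; last by rewrite normr0 !(mulr0, mul0r).
by rewrite normr1 ler_wpM2l ?mulr1 ?normc_ge0 // normcB; exact: hE.
Qed.

(** Finitely many translates of a nonempty open set cover the group, so it
   cannot be negligible. *)
Lemma haar_open_gt0 (U : set G) : open U -> U !=set0 -> (0 < mu (U : set (Borel G)))%E.
Proof.
move=> oU [z Uz]; rewrite lt0e measure_ge0 andbT; apply/eqP => U0.
have Un : nbhs (0 : G) [set a | U (z + a)].
  by apply: nbhs0_shift; rewrite nbhsE; exists U.
have [n [x [E [mE EU tE cE]]]] := compact_cells cG Un.
have E0 i : mu (E i) = 0.
  apply/eqP; rewrite eq_le measure_ge0 andbT.
  have mU : measurable (U : set (Borel G)) by exact: sub_sigma_algebra.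
  rewrite -U0 -(haar_preimage (z - x i) mU); apply: le_measure; rewrite ?inE //.
    by apply: sub_sigma_algebra; exact: open_shift.
  by move=> y /EU /=; rewrite addrAC addrA.
have : mu setT = 0.
  rewrite -cE measure_bigcup ?eseries0 //; last exact: sub_trivIset tE.
  by move=> i _ _; exact: E0.
by have -> := probability_setT mu; move=> /eqP; rewrite onee_eq0.
Qed.

End haar.

(** * Positive definite forms *)

Section positive_definite.
Variables (R : realType) (G : zmodType).
Implicit Types (f phi psi : G -> R[i]) (xi zeta : seq (R[i] * G)).

Definition translate_sum f xi : G -> R[i] := fun x => \sum_(p <- xi) p.1 * f (x + p.2).

(** At x = 0 this is the Hermitian form of phi on the measure xi, and phi is positive
    definite when it is nonnegative for all xi. Keeping the variable x makes the
    form an operator on functions, which can be iterated. *)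
Definition pd_form phi xi : G -> R[i] := fun x =>
  \sum_(p <- xi) \sum_(q <- xi) p.1 * q.1^* * phi (x + (p.2 - q.2)).

Definition hermitian_fun phi := forall x, phi (- x) = (phi x)^*.

(** Translations commute. *)
Lemma pdC phi xi zeta : pd_form (pd_form phi xi) zeta = pd_form (pd_form phi zeta) xi.
Proof.
apply/funext => x; rewrite /pd_form.
transitivity (\sum_(p <- zeta) \sum_(q <- zeta) \sum_(p' <- xi) \sum_(q' <- xi)
   p.1 * q.1^* * (p'.1 * q'.1^*) * phi (x + (p.2 - q.2) + (p'.2 - q'.2))).
  do 2 (apply: eq_bigr => ? _); rewrite mulr_sumr; apply: eq_bigr => ? _.
  by rewrite mulr_sumr; apply: eq_bigr => ? _; rewrite mulrA.
under eq_bigr do rewrite exchange_big /=.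
rewrite exchange_big /=; apply: eq_bigr => p _.
under eq_bigr do rewrite exchange_big /=.
rewrite exchange_big /=; apply: eq_bigr => q _.
rewrite mulr_sumr; apply: eq_bigr => p' _.
rewrite mulr_sumr; apply: eq_bigr => q' _.
by rewrite [X in phi X]addrAC; ring.
Qed.

Lemma pd1 phi z x : pd_form phi [:: (z, 0)] x = ((normc z) ^+ 2)%:C%C * phi x.
Proof. by rewrite /pd_form !big_seq1 /= subrr addr0 mul_conjc. Qed.

Lemma pd_hermitian phi xi : hermitian_fun phi -> hermitian_fun (pd_form phi xi).
Proof.
move=> hphi x; rewrite /pd_form rmorph_sum /= exchange_big /=; apply: eq_bigr => q _.
rewrite rmorph_sum /=; apply: eq_bigr => p _.
rewrite !rmorphM /= conjCK -hphi [p.1 * _]mulrC; congr (_ * phi _).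
by rewrite opprD opprB.
Qed.

Lemma hermitian0 phi : hermitian_fun phi -> phi 0 = (Re (phi 0))%:C%C.
Proof.
move=> /(_ 0); rewrite oppr0 => H; apply: complex_eqP => //=.
by have := congr1 Im H; rewrite Im_conjc; lra.
Qed.

(** The Cauchy-Schwarz inequality for the form of phi between xi and the point mass
    at 0: the form of a combination of the two is a nonnegative quadratic polynomial
    in the real parameter t. *)
Lemma pd_cauchy_schwarz phi xi : hermitian_fun phi ->
  (forall zeta, 0 <= Re (pd_form phi zeta 0)) ->
  normc (\sum_(p <- xi) p.1 * phi p.2) ^+ 2 <= Re (pd_form phi xi 0) * Re (phi 0).
Proof.
move=> hphi pos; set S := \sum_(p <- _) _.
have [w w1 wS] := phaseP S.
set P := Re (pd_form phi xi 0); set r := Re (phi 0).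
have key t : 0 <= t ^+ 2 * P - 2 * t * normc S + r.
  pose c : R[i] := - (t%:C%C * w).
  have := pos ([seq (c * p.1, p.2) | p <- xi] ++ [:: (1, 0)]).
  suff -> : pd_form phi ([seq (c * p.1, p.2) | p <- xi] ++ [:: (1, 0)]) 0 =
     c * c^* * pd_form phi xi 0 + (c * S + (c * S)^*) + phi 0.
    have cS : c * S = (- (t * normc S))%:C%C.
      by rewrite /c mulNr -mulrA wS -rmorphM /= rmorphN.
    rewrite mul_conjc cS !Re_addc Re_mulc Re_conjc /= mul0r subr0 /c normc_opp.
    rewrite normcM w1 mulr1 normc_real real_normK ?num_real //.
    by rewrite -/P -/r; lra.
  rewrite /pd_form big_cat big_seq1 big_map /=.
  under eq_bigr do rewrite big_cat big_seq1 big_map /=.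
  rewrite big_cat big_seq1 big_map /= big_split /= !add0r oppr0 -!addrA.
  congr (_ + (_ + (_ + _))).
  - rewrite mulr_sumr; apply: eq_bigr => p _.
    by rewrite mulr_sumr; apply: eq_bigr => q _; rewrite rmorphM /=; ring.
  - rewrite mulr_sumr; apply: eq_bigr => p _.
    by rewrite rmorph1 add0r addr0 mulr1 mulrA.
  - rewrite rmorphM rmorph_sum mulr_sumr; apply: eq_bigr => p _ /=.
    by rewrite !rmorphM /= -hphi !add0r mul1r mulrA.
  by rewrite rmorph1 !mul1r.
have r0 : 0 <= r by have := key 0; rewrite expr0n /= mul0r mulr0 mul0r subr0 add0r.
have P0 : 0 <= P by exact: pos.
have n0 := normc_ge0 S.
have [P_0|P_neq] := eqVneq P 0.
  rewrite P_0 mul0r; suff -> : normc S = 0 by rewrite expr0n.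
  apply/eqP; rewrite eq_le n0 andbT leNgt; apply/negP => Sp.
  have := key ((r + 1) / normc S); rewrite P_0 mulr0 sub0r -mulrA mulfVK ?gt_eqF //.
  lra.
have Pp : 0 < P by rewrite lt0r P_neq.
have := key (normc S / P).
have -> : (normc S / P) ^+ 2 * P - 2 * (normc S / P) * normc S + r =
  (P * r - normc S ^+ 2) / P by field.
by rewrite pmulr_lge0 ?invr_gt0 // subr_ge0.
Qed.

End positive_definite.

(** * Admissible pairs *)

Section admissible_pairs.
Variables (R : realType) (G : topologicalZmodType).
Implicit Types (f phi psi : G -> R[i]) (xi zeta : seq (R[i] * G)).

(** Iterated forms. A condition imposed on all of them is inherited by pd_form phi xi,
    which is why the list s is quantified in the definition of admissible pairs. *)
Definition pd_forms phi (s : seq (seq (R[i] * G))) : G -> R[i] := foldl (@pd_form R G) phi s.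

Variable w : G -> R[i].

(** Both functions are positive definite, psi explicitly and phi because it dominates
    psi: the form of psi at xi is controlled by the supremum of the combination of
    translates of w with the same coefficients. *)
Record admissible phi psi : Prop := Admissible {
  adm_hphi : hermitian_fun phi;
  adm_hpsi : hermitian_fun psi;
  adm_pos : forall s, 0 <= Re (pd_forms psi s 0);
  adm_dom : forall xi b s, (forall x, normc (translate_sum w xi x) <= b) ->
    Re (pd_forms (pd_form psi xi) s 0) <= b ^+ 2 * Re (pd_forms phi s 0) }.

Lemma admissible_pd phi psi xi : admissible phi psi ->
  admissible (pd_form phi xi) (pd_form psi xi).
Proof.
move=> [hphi hpsi pos dom]; split; try exact: pd_hermitian.
  by move=> s; exact: (pos (xi :: s)).
by move=> zeta b s wb; rewrite pdC; exact: (dom zeta b (xi :: s)).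
Qed.

Variable bw : R.
Hypothesis bw0 : 0 < bw.
Hypothesis wb : forall x, normc (w x) <= bw.

Lemma act_dirac f x : translate_sum f [:: (1, 0)] x = f x.
Proof. by rewrite /translate_sum big_seq1 /= addr0 mul1r. Qed.

Section pair.
Variables phi psi : G -> R[i].
Hypothesis adm : admissible phi psi.

Lemma adm_psi_dom s : Re (pd_forms psi s 0) <= bw ^+ 2 * Re (pd_forms phi s 0).
Proof.
have := @adm_dom _ _ adm [:: (1, 0)] bw s; rewrite (_ : pd_form psi _ = psi).
  by apply => x; rewrite act_dirac.
by apply/funext => x; rewrite pd1 normc_1 expr1n mul1r.
Qed.

Lemma adm_posphi s : 0 <= Re (pd_forms phi s 0).
Proof.
have := le_trans (adm_pos adm s) (adm_psi_dom s).
by rewrite pmulr_rge0 // exprn_gt0.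
Qed.

Let translate (phi' : G -> R[i]) x : pd_form phi' [:: (1, x)] 0 = phi' 0.
Proof. by rewrite /pd_form !big_seq1 /= rmorph1 subrr addr0 !mul1r. Qed.

Lemma adm_phi_le x : normc (phi x) <= Re (phi 0).
Proof.
have p0 : 0 <= Re (phi 0) by exact: (adm_posphi [::]).
have := @pd_cauchy_schwarz _ _ phi [:: (1, x)] (adm_hphi adm)
  (fun zeta => adm_posphi [:: zeta]).
by rewrite big_seq1 mul1r translate -expr2 ler_pXn2r ?nnegrE ?normc_ge0.
Qed.

Lemma adm_psi_le x : normc (psi x) <= Re (psi 0).
Proof.
have p0 : 0 <= Re (psi 0) by exact: (adm_pos adm [::]).
have := @pd_cauchy_schwarz _ _ psi [:: (1, x)] (adm_hpsi adm)
  (fun zeta => adm_pos adm [:: zeta]).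
by rewrite big_seq1 mul1r translate -expr2 ler_pXn2r ?nnegrE ?normc_ge0.
Qed.

Lemma adm_psi_bound x : normc (psi x) <= bw ^+ 2 * Re (phi 0).
Proof. by apply: (le_trans (adm_psi_le x)); exact: (adm_psi_dom [::]). Qed.

(** Domination applied to the difference of the point masses at a and 0 turns the
    modulus of continuity of w into one for psi, the same for all admissible pairs
    with a given value of phi at 0. *)
Lemma adm_psi_modulus a b x : 0 <= b -> (forall x, normc (w (x + a) - w x) <= b) ->
  normc (psi (x + a) - psi x) <= b * bw * Re (phi 0).
Proof.
move=> b0 wab; have p0 : 0 <= Re (phi 0) by exact: (adm_posphi [::]).
have := @pd_cauchy_schwarz _ _ psi [:: (1, x + a); (-1, x)] (adm_hpsi adm)
  (fun zeta => adm_pos adm [:: zeta]).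
rewrite big_cons big_seq1 /= mul1r mulN1r.
have -> : pd_form psi [:: (1, x + a); (-1, x)] 0 = pd_form psi [:: (1, a); (-1, 0)] 0.
  have E1 : x + a - x = a by rewrite addrAC subrr add0r.
  have E2 : x - (x + a) = - a by rewrite opprD addrA subrr add0r.
  rewrite /pd_form !big_cons !big_nil /= E1 E2 !subrr !subr0 sub0r.
  by rewrite sub0r.
move=> H; rewrite -(@ler_pXn2r _ 2) ?nnegrE ?normc_ge0 ?mulr_ge0 ?(ltW bw0) //.
apply: (le_trans H).
have -> : (b * bw * Re (phi 0)) ^+ 2 = b ^+ 2 * Re (phi 0) * (bw ^+ 2 * Re (phi 0)).
  by ring.
apply: ler_pM.
- exact: (adm_pos adm [:: _]).
- exact: (adm_pos adm [::]).
- apply: (adm_dom adm [::]) => y.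
  by rewrite /translate_sum big_cons big_seq1 /= addr0 mul1r mulN1r.
- exact: (adm_psi_dom [::]).
Qed.

Hypothesis cG : compact [set: G].
Hypothesis cw : ccont w.

Lemma adm_psi_ccont : ccont psi.
Proof.
apply: ccont_from_unif => e e0.
have p0 : 0 <= bw * (Re (phi 0) + 1).
  by rewrite mulr_ge0 ?(ltW bw0) // addr_ge0 // (adm_posphi [::]).
have pp : 0 < bw * (Re (phi 0) + 1).
  by rewrite mulr_gt0 // ltr_wpDl // (adm_posphi [::]).
have ep : 0 < e / (bw * (Re (phi 0) + 1)) by rewrite divr_gt0.
apply: filterS (ccont_unif cG cw ep) => a wa x.
apply: (le_trans (adm_psi_modulus x (ltW ep) wa)).
rewrite -[leRHS](@divfK _ (bw * (Re (phi 0) + 1))) ?gt_eqF // -mulrA.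
by rewrite ler_wpM2l ?(ltW ep) // ler_wpM2l ?(ltW bw0) // lerDl.
Qed.

End pair.
End admissible_pairs.

(** * Correlations and convolutions *)

Section correlations.
Variables (R : realType) (G : topologicalZmodType).
Variable mu : probability (Borel G) R.
Hypothesis cG : compact [set: G].
Hypothesis haar : haar_measure mu.
Implicit Types (f g v w : G -> R[i]) (xi : seq (R[i] * G)).

Lemma cintegral_conj f : cintegrable mu f ->
  cintegral mu (fun x => (f x)^*) = (cintegral mu f)^*.
Proof.
move=> [fr fi]; apply: complex_eqP; rewrite ?Re_conjc ?Im_conjc /=.
  by congr Rintegral; apply/funext => x; rewrite Re_conjc.
rewrite -mulN1r -(RIZ _ fi); congr Rintegral; apply/funext => x.
by rewrite Im_conjc mulN1r.
Qed.

Lemma act_ccont f xi : ccont f -> ccont (translate_sum f xi).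
Proof.
move=> cf; apply: ccont_sum => p _; apply: ccontM; first exact: ccont_cst.
exact: ccont_shiftr.
Qed.

Lemma acts_ccont f s : ccont f -> ccont (foldl (@translate_sum R G) f s).
Proof. by elim: s f => //= xi s IH f cf; apply: IH; exact: act_ccont. Qed.

Definition correlation f (a : G) : R[i] := cintegral mu (fun y => f (y + a) * (f y)^*).

Let ccorr f a b : ccont f -> cintegrable mu (fun y => f (y + a) * (f (y + b))^*).
Proof.
move=> cf; apply: (ccont_cint _ cG); apply: ccontM; first exact: ccont_shiftr.
by apply: ccont_conj; exact: ccont_shiftr.
Qed.

Let corr_shift f a b : ccont f ->
  cintegral mu (fun y => f (y + a) * (f (y + b))^*) = correlation f (a - b).
Proof.
move=> cf; rewrite -(cintegral_shift haar (- b)); last exact: ccorr.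
congr cintegral; apply/funext => y; congr (f _ * (f _)^*).
  by rewrite [- b + y]addrC -addrA [- b + a]addrC.
by rewrite addrAC addNr add0r.
Qed.

Lemma corr_hermitian f : ccont f -> hermitian_fun (correlation f).
Proof.
move=> cf x; rewrite -[in LHS](sub0r x) -(corr_shift _ _ cf) -cintegral_conj.
  congr cintegral; apply/funext => y; rewrite addr0 rmorphM /= conjCK.
  by rewrite mulrC.
have := @ccorr f x 0 cf.
by under eq_fun do rewrite addr0.
Qed.

(** The forms of an autocorrelation are autocorrelations again, hence squared norms
    at 0: this is where positive definiteness comes from. *)
Lemma pd_corr f xi : ccont f -> pd_form (correlation f) xi = correlation (translate_sum f xi).
Proof.
move=> cf; apply/funext => x; rewrite /pd_form /correlation /translate_sum.
have -> : (fun y => (\sum_(p <- xi) p.1 * f (y + x + p.2)) *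
     (\sum_(q <- xi) q.1 * f (y + q.2))^*) =
   (fun y => \sum_(p <- xi) \sum_(q <- xi)
     (p.1 * q.1^*) * (f (y + (x + p.2)) * (f (y + q.2))^*)).
  apply/funext => y; rewrite rmorph_sum /= mulr_suml; apply: eq_bigr => p _.
  rewrite mulr_sumr; apply: eq_bigr => q _; rewrite rmorphM /= addrA; ring.
have ip p q : cintegrable mu (fun y : G =>
    p.1 * q.1^* * (f (y + (x + p.2)) * (f (y + q.2))^*)).
  by apply: cintZ; exact: ccorr.
rewrite cintegral_sum; last by move=> p _; exact: cint_sum.
apply: eq_bigr => p _; rewrite cintegral_sum //; apply: eq_bigr => q _.
by rewrite cintegralZ ?corr_shift ?addrA //; exact: ccorr.
Qed.

Lemma pds_corr f s : ccont f -> pd_forms (correlation f) s = correlation (foldl (@translate_sum R G) f s).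
Proof.
elim: s f => //= xi s IH f cf; rewrite /pd_forms /= pd_corr // -IH //.
exact: act_ccont.
Qed.

Definition sqnorm f := RI mu (fun y => normc (f y) ^+ 2).

Lemma corr0 f : correlation f 0 = (sqnorm f)%:C%C.
Proof.
rewrite -cintegral_real; congr cintegral; apply/funext => y.
by rewrite addr0 mul_conjc.
Qed.

Lemma rint_sqnorm f : ccont f -> rint mu (fun y => normc (f y) ^+ 2).
Proof.
move=> cf; have [b fb] := ccont_bounded cG cf.
apply: (@rint_bounded _ _ _ _ (b ^+ 2)).
  by apply: measurable_funX; exact: cmeas_normc (ccont_cmeas cf).
move=> x; rewrite normrX (ger0_norm (normc_ge0 _)).
by rewrite ler_pXn2r ?nnegrE ?normc_ge0 // (le_trans (normc_ge0 _) (fb x)).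
Qed.

Lemma sqnorm_ge0 f : 0 <= sqnorm f.
Proof. by apply: RI_ge0 => x; exact: sqr_ge0. Qed.

(** Near z the modulus of f stays above half its value, and nonempty open sets
    have positive Haar measure. *)
Lemma sqnorm_gt0 f z : ccont f -> f z != 0 -> 0 < sqnorm f.
Proof.
move=> cf fz.
have nz : 0 < normc (f z).
  by rewrite lt0r normc_ge0 andbT; apply: contra_neq fz => /eq0_normc.
have n2 : 0 < normc (f z) / 2 by rewrite divr_gt0.
pose A : set G := [set a | normc (f (z + a) - f z) <= normc (f z) / 2].
have : nbhs (0 : G) A.
  by apply: filterS (ccont_unif cG cf n2) => a; exact.
rewrite nbhsE => -[U [oU U0] UA].
pose V : set (Borel G) := [set y : G | U (- z + y)].
have oV : @open G V by exact: open_shift.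
have mV : measurable V by exact: sub_sigma_algebra.
have V0 : (0 < mu V)%E.
  by apply: (haar_open_gt0 cG haar) => //; exists z; rewrite /V /= addNr.
have fV y : V y -> normc (f z) / 2 <= normc (f y).
  move=> /UA; rewrite /A /= addrA subrr add0r => H.
  have := normcD (f z - f y) (f y); rewrite subrK normcB => K.
  by move: H K; move: (normc _) (normc _) (normc _) => a b c; lra.
have : (normc (f z) / 2) ^+ 2 * fine (mu V) <= sqnorm f.
  have -> : (normc (f z) / 2) ^+ 2 * fine (mu V) =
      RI mu (fun y => (normc (f z) / 2) ^+ 2 * \1_V y).
    rewrite RIZ; last by apply: (@rint_bounded _ _ _ _ 1); [exact: measurable_indic|
      move=> x; rewrite indicE; case: (_ \in _); rewrite ?normr1 ?normr0].
    by congr (_ * _); rewrite /RI /Rintegral integral_indic // setIT.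
  apply: RI_le; last 1 first.
  - move=> y; rewrite indicE; case: (boolP (_ \in _)) => [/set_mem Vy|_].
      by rewrite mulr1 ler_pXn2r ?nnegrE ?normc_ge0 ?(ltW n2) //; exact: fV.
    by rewrite mulr0 sqr_ge0.
  - apply: rintZ; apply: (@rint_bounded _ _ _ _ 1); first exact: measurable_indic.
    by move=> x; rewrite indicE; case: (_ \in _); rewrite ?normr1 ?normr0.
  - exact: rint_sqnorm.
apply: lt_le_trans; rewrite mulr_gt0 ?exprn_gt0 //.
by rewrite fine_gt0 // V0 /= (le_lt_trans (probability_le1 mu mV)) // ltry.
Qed.

Lemma sqnorm_le0 f : ccont f -> sqnorm f <= 0 -> forall x, f x = 0.
Proof.
move=> cf f0 x; apply/eqP; rewrite -[_ == _]negbK; apply/negP => /(sqnorm_gt0 cf).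
by rewrite ltNge f0.
Qed.

Definition convol v g (x : G) : R[i] := cintegral mu (fun y => v (x - y) * g y).

Lemma sub_ccont v x : ccont v -> ccont (fun y => v (x - y)).
Proof.
move=> cvv; apply: (ccont_comp (h := fun y => x - y)) => //.
move=> y; apply: (@continuous_comp _ _ _ (fun y : G => - y) (fun y : G => x + y)).
  exact: opp_continuous.
exact: addr_continuous.
Qed.

Lemma convol_int v g x : ccont v -> cintegrable mu g ->
  cintegrable mu (fun y => v (x - y) * g y).
Proof.
move=> vc gi; under eq_fun do rewrite mulrC.
have [b vb] := ccont_bounded cG vc.
by apply: (cintM_bounded gi (ccont_cmeas (sub_ccont x vc))) => y; exact: vb.
Qed.

Lemma convol_bound v g x b : ccont v -> cintegrable mu g -> (forall x, normc (v x) <= b) ->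
  normc (convol v g x) <= b * RI mu (fun y => normc (g y)).
Proof.
move=> vc gi vb; rewrite -RIZ; last exact: rint_normc.
apply: normc_cintegral_le; first exact: convol_int.
  by apply: rintZ; exact: rint_normc.
by move=> y; rewrite normcM ler_wpM2r ?normc_ge0.
Qed.

(** The modulus of continuity of v passes to the convolution. *)
Lemma convol_ccont v g : ccont v -> cintegrable mu g -> ccont (convol v g).
Proof.
move=> vc gi; apply: ccont_from_unif => e e0.
set N := RI mu (fun y => normc (g y)).
have N0 : 0 <= N by apply: RI_ge0 => x; exact: normc_ge0.
have N1 : 0 < N + 1 by rewrite ltr_wpDl.
have eN : 0 < e / (N + 1) by rewrite divr_gt0.
apply: filterS (ccont_unif cG vc eN) => a va x.
rewrite /convol -cintegralB; try exact: convol_int.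
apply: (@le_trans _ _ (e / (N + 1) * N)); last first.
  by rewrite mulrAC ler_pdivrMr // ler_wpM2l ?(ltW e0) // lerDl.
rewrite -RIZ; last exact: rint_normc.
apply: normc_cintegral_le.
- by apply: cintB; exact: convol_int.
- by apply: rintZ; exact: rint_normc.
move=> y; rewrite -mulrBl normcM ler_wpM2r ?normc_ge0 //.
by have := va (x - y); rewrite addrAC.
Qed.

Lemma act_cvl v g xi : ccont v -> cintegrable mu g ->
  translate_sum (convol v g) xi = convol (translate_sum v xi) g.
Proof.
move=> vc gi; apply/funext => x; rewrite /translate_sum /convol.
rewrite (_ : (fun y => (\sum_(p <- xi) p.1 * v (x - y + p.2)) * g y) =
  (fun y => \sum_(p <- xi) p.1 * (v ((x + p.2) - y) * g y))); last first.
  apply/funext => y; rewrite mulr_suml; apply: eq_bigr => p _.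
  by rewrite -mulrA addrAC.
rewrite cintegral_sum; last by move=> p _; apply: cintZ; exact: convol_int.
by apply: eq_bigr => p _; rewrite cintegralZ //; exact: convol_int.
Qed.

Lemma act_cvr v g xi : ccont v -> ccont g -> translate_sum (convol v g) xi = convol v (translate_sum g xi).
Proof.
move=> vc gc; apply/funext => x; rewrite /translate_sum /convol.
have gi y : cintegrable mu (fun z => g (z + y)).
  by apply: (ccont_cint _ cG); exact: ccont_shiftr.
rewrite (_ : (fun y => v (x - y) * \sum_(p <- xi) p.1 * g (y + p.2)) =
  (fun y => \sum_(p <- xi) p.1 * (v (x - y) * g (y + p.2)))); last first.
  apply/funext => y; rewrite mulr_sumr; apply: eq_bigr => p _; ring.
rewrite cintegral_sum; last by move=> p _; apply: cintZ; exact: convol_int.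
apply: eq_bigr => p _; rewrite cintegralZ; last exact: convol_int.
congr (_ * _); rewrite -(cintegral_shift haar p.2); last first.
  by apply: convol_int => //; exact: (ccont_cint _ cG).
congr cintegral; apply/funext => y.
by rewrite opprD addrA addrK [y + _]addrC.
Qed.

Lemma acts_cvr v g s : ccont v -> ccont g ->
  foldl (@translate_sum R G) (convol v g) s = convol v (foldl (@translate_sum R G) g s).
Proof.
move=> vc; elim: s g => //= xi s IH g gc; rewrite act_cvr // IH //.
exact: act_ccont.
Qed.

(** The variance is nonnegative. *)
Lemma sqr_mean_le (u : G -> R) b : rmeas u -> (forall x, `|u x| <= b) ->
  RI mu u ^+ 2 <= RI mu (fun y => u y ^+ 2).
Proof.
move=> mu_ ub; set m := RI mu u.
have iu : rint mu u := rint_bounded mu mu_ ub.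
have iu2 : rint mu (fun y => u y ^+ 2).
  apply: (@rint_bounded _ _ _ _ (b ^+ 2)); first exact: measurable_funX.
  move=> x; rewrite normrX ler_pXn2r ?nnegrE ?normr_ge0 //.
  by rewrite (le_trans (normr_ge0 _) (ub x)).
have : 0 <= RI mu (fun y => (u y ^+ 2 - (2 * m) * u y) + m ^+ 2).
  apply: RI_ge0 => x.
  have -> : u x ^+ 2 - 2 * m * u x + m ^+ 2 = (u x - m) ^+ 2 by ring.
  exact: sqr_ge0.
rewrite RID; [|by apply: rintB => //; exact: rintZ|exact: rint_cst].
rewrite RIB //; last exact: rintZ.
rewrite RIZ // RI_cst -/m; set X := RI _ _; have -> : m ^+ 2 = m * m by ring.
lra.
Qed.

End correlations.

(** * Limits along an ultrafilter *)

Section ultralimit.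
Variables (R : realType) (U : set_system nat).
Context {UU : UltraFilter U}.
Implicit Types (r : nat -> R) (z : nat -> R[i]).

Let PU : ProperFilter U := ultra_proper.

(** An ultrafilter clustering at a point of a compact segment converges to it. *)
Lemma ultra_bounded_cvg r b : (forall n, `|r n| <= b) ->
  exists l : R, r n @[n --> U] --> l.
Proof.
move=> rb; have FU : ProperFilter (r n @[n --> U]) by exact: fmap_proper_filter.
have [|l [_ lc]] := @segment_compact R (- b) b _ FU.
  apply: (@filterS _ U _ setT); last exact: filterT.
  by move=> n _ /=; rewrite in_itv /= -ler_norml.
exists l => A Al; have [//|nA] := in_ultra_setVsetC (r @^-1` A) UU.
by have [y [/= nAy Ay]] := lc (~` A) A nA Al.
Qed.

(** Convergence of a sequence of complex numbers along U, part by part. *)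
Definition clim z (l : R[i]) :=
  (Re (z n) @[n --> U] --> Re l) /\ (Im (z n) @[n --> U] --> Im l).

Lemma ultra_bounded_clim z b : (forall n, normc (z n) <= b) -> exists l, clim z l.
Proof.
move=> zb; have [x xP] : exists l : R, Re (z n) @[n --> U] --> l.
  by apply: (@ultra_bounded_cvg _ b) => n; exact: le_trans (Re_le_normc _) (zb n).
have [y yP] : exists l : R, Im (z n) @[n --> U] --> l.
  by apply: (@ultra_bounded_cvg _ b) => n; exact: le_trans (Im_le_normc _) (zb n).
by exists (Complex x y).
Qed.

Lemma clim_cst c : clim (fun=> c) c.
Proof. by split; exact: cvg_cst. Qed.

Lemma climD z1 z2 l1 l2 : clim z1 l1 -> clim z2 l2 ->
  clim (fun n => z1 n + z2 n) (l1 + l2).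
Proof.
move=> [r1 i1] [r2 i2]; split.
  by under eq_fun do rewrite Re_addc; rewrite Re_addc; exact: cvgD.
by under eq_fun do rewrite Im_addc; rewrite Im_addc; exact: cvgD.
Qed.

Lemma climM z1 z2 l1 l2 : clim z1 l1 -> clim z2 l2 ->
  clim (fun n => z1 n * z2 n) (l1 * l2).
Proof.
move=> [r1 i1] [r2 i2]; split.
  under eq_fun do rewrite Re_mulc.
  by rewrite Re_mulc; apply: cvgB; exact: cvgM.
under eq_fun do rewrite Im_mulc.
by rewrite Im_mulc; apply: cvgD; exact: cvgM.
Qed.

Lemma clim_sum I (s : seq I) (z : I -> nat -> R[i]) l :
  (forall i, clim (z i) (l i)) ->
  clim (fun n => \sum_(i <- s) z i n) (\sum_(i <- s) l i).
Proof.
move=> zl; elim: s => [|i s IH].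
  by under eq_fun do rewrite big_nil; rewrite big_nil; exact: clim_cst.
by under eq_fun do rewrite big_cons; rewrite big_cons; exact: climD.
Qed.

Lemma clim_normc z l e : clim z l -> 0 < e ->
  \forall n \near U, normc (z n - l) <= e.
Proof.
move=> [zr zi] e0; have e2 : 0 < e / 2 by rewrite divr_gt0.
move/cvgrPdist_le : zr => /(_ _ e2) zr; move/cvgrPdist_le : zi => /(_ _ e2) zi.
near=> n; apply: (le_trans (normc_le_ReIm _)); rewrite Re_subc Im_subc [e]splitr.
by apply: lerD; rewrite distrC; near: n.
Unshelve. all: by end_near. Qed.

Lemma clim_unique z l l' : clim z l -> clim z l' -> l = l'.
Proof.
by move=> [zr zi] [zr' zi']; apply: complex_eqP;
  [exact: (cvg_unique _ zr zr') | exact: (cvg_unique _ zi zi')].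
Qed.

Lemma cvg_le_lim r1 r2 l1 l2 : r1 n @[n --> U] --> l1 -> r2 n @[n --> U] --> l2 ->
  (forall n, r1 n <= r2 n) -> l1 <= l2.
Proof.
move=> c1 c2 r12; rewrite -subr_ge0.
have c : (r2 n - r1 n) @[n --> U] --> l2 - l1 by exact: cvgB.
have near0 : \forall n \near U, 0 <= r2 n - r1 n.
  by apply: nearW => n; rewrite subr_ge0.
exact: (closed_cvg _ (@closed_ge R 0) near0 _ c).
Qed.

End ultralimit.

Section pair_limit.
Variables (R : realType) (G : topologicalZmodType).
Variable w : G -> R[i].
Variables (U : set_system nat).
Context {UU : UltraFilter U}.
Variables phi psi : nat -> G -> R[i].
Variables phi' psi' : G -> R[i].
Hypothesis adm : forall n, admissible w (phi n) (psi n).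
Hypothesis phil : forall x, clim U (fun n => phi n x) (phi' x).
Hypothesis psil : forall x, clim U (fun n => psi n x) (psi' x).

Lemma clim_pd (f : nat -> G -> R[i]) f' xi :
  (forall x, clim U (fun n => f n x) (f' x)) ->
  forall x, clim U (fun n => pd_form (f n) xi x) (pd_form f' xi x).
Proof.
move=> fl x; apply: clim_sum => p; apply: clim_sum => q.
by apply: climM; [exact: clim_cst | exact: fl].
Qed.

Lemma clim_pds (f : nat -> G -> R[i]) f' s :
  (forall x, clim U (fun n => f n x) (f' x)) ->
  forall x, clim U (fun n => pd_forms (f n) s x) (pd_forms f' s x).
Proof.
elim: s f f' => //= xi s IH f f' fl x.
by apply: (IH (fun n => pd_form (f n) xi)) => y; exact: clim_pd.
Qed.

Lemma clim_hermitian (f : nat -> G -> R[i]) f' :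
  (forall x, clim U (fun n => f n x) (f' x)) ->
  (forall n, hermitian_fun (f n)) -> hermitian_fun f'.
Proof.
move=> fl fh x; apply: (clim_unique (fl (- x))).
have [fr fi] := fl x; split; rewrite ?Re_conjc ?Im_conjc.
  by under eq_fun do rewrite fh Re_conjc.
by under eq_fun do rewrite fh Im_conjc; exact: cvgN.
Qed.

(** Each condition is a weak inequality or an identity between finitely many values. *)
Lemma admissible_limit : admissible w phi' psi'.
Proof.
split.
- exact: (clim_hermitian phil (fun n => adm_hphi (adm n))).
- exact: (clim_hermitian psil (fun n => adm_hpsi (adm n))).
- move=> s; have [c _] := clim_pds s psil 0.
  apply: (cvg_le_lim (@cvg_cst _ 0 _ U _) c) => n; exact: (adm_pos (adm n)).
- move=> xi b s wb; have [c1 _] := clim_pds s (clim_pd xi psil) 0.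
  have [c2 _] := clim_pds s phil 0.
  have c3 : b ^+ 2 * Re (pd_forms (phi n) s 0) @[n --> U] --> b ^+ 2 * Re (pd_forms phi' s 0).
    by apply: cvgM => //; exact: cvg_cst.
  by apply: (cvg_le_lim c1 c3) => n; exact: (adm_dom (adm n)).
Qed.

End pair_limit.

(** * A maximal admissible pair *)

Section maximal_pair.
Variables (R : realType) (G : topologicalZmodType).
Variable mu : probability (Borel G) R.
Hypothesis cG : compact [set: G].
Hypothesis haar : haar_measure mu.
Variable w : G -> R[i].
Hypothesis cw : ccont w.
Variable bw : R.
Hypothesis bw0 : 0 < bw.
Hypothesis wb : forall x, normc (w x) <= bw.
Implicit Types phi psi : G -> R[i].

(** With g the reflected conjugate of w, the pair formed by the autocorrelations of g
    and of the convolution w * g is admissible: combinations of translates of w * g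
    are convolutions of g with combinations of translates of w. It is not zero, since
    w * g takes at 0 the value of the squared norm of g. *)
Lemma exists_admissible z : w z != 0 ->
  exists phi psi, [/\ admissible w phi psi, phi 0 = 1 & 0 < sqnorm mu psi].
Proof.
move=> wz; pose g (y : G) := (w (- y))^*; pose u := convol mu w g.
have cg : ccont g.
  apply: ccont_conj; apply: ccont_comp => //; exact: opp_continuous.
have gi : cintegrable mu g := ccont_cint mu cG cg.
have cu : ccont u := convol_ccont cG cw gi.
have gz : g (- z) != 0 by rewrite /g opprK conjC_eq0.
have sg : 0 < sqnorm mu g := sqnorm_gt0 cG haar cg gz.
have u0 : u 0 = (sqnorm mu g)%:C%C.
  rewrite -(cintegral_real mu); congr cintegral; apply/funext => y.
  by rewrite sub0r /g mul_conjc normc_conj.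
have u0' : u 0 != 0.
  by apply: contraL sg => /eqP; rewrite u0 => /(congr1 (@complex.Re R)) /= ->; rewrite ltxx.
have su : 0 < sqnorm mu u := sqnorm_gt0 cG haar cu u0'.
have adm : admissible w (correlation mu g) (correlation mu u).
  split.
  - exact: corr_hermitian.
  - exact: corr_hermitian.
  - by move=> s; rewrite (pds_corr cG haar) // corr0 /= sqnorm_ge0.
  move=> xi b s wxi; rewrite (pd_corr cG haar) // !(pds_corr cG haar) //; last exact: act_ccont.
  rewrite !corr0 /= act_cvl // (acts_cvr cG haar) //; last exact: act_ccont.
  set h := foldl _ _ _; have ch : ccont h by exact: acts_ccont.
  have hi : cintegrable mu h := ccont_cint mu cG ch.
  have cx : ccont (translate_sum w xi) by exact: act_ccont.
  have ih2 := rint_sqnorm mu cG ch.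
  have b0 : 0 <= b by exact: le_trans (normc_ge0 _) (wxi 0).
  have [bh hb] := ccont_bounded cG ch.
  pose m := RI mu (fun y => normc (h y)).
  have m0 : 0 <= m by apply: RI_ge0 => x; exact: normc_ge0.
  have mh : m ^+ 2 <= sqnorm mu h.
    apply: (@sqr_mean_le _ _ _ _ bh); first exact: cmeas_normc (ccont_cmeas ch).
    by move=> x; rewrite ger0_norm ?normc_ge0.
  rewrite -(RI_cst mu (_ * _)); apply: RI_le.
  - by apply: rint_sqnorm => //; exact: convol_ccont.
  - exact: rint_cst.
  move=> x; apply: (@le_trans _ _ (b ^+ 2 * m ^+ 2)); last first.
    by rewrite ler_wpM2l ?sqr_ge0.
  rewrite -exprMn ler_pXn2r ?nnegrE ?normc_ge0 ?mulr_ge0 //.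
  exact: convol_bound.
pose k : R := (Num.sqrt (sqnorm mu g))^-1.
have k2 : k ^+ 2 = (sqnorm mu g)^-1 by rewrite exprVn sqr_sqrtr ?ltW.
exists (pd_form (correlation mu g) [:: (k%:C%C, 0)]), (pd_form (correlation mu u) [:: (k%:C%C, 0)]); split.
- exact: admissible_pd.
- rewrite pd1 normc_real real_normK ?num_real // k2 corr0 -rmorphM /= mulVf ?gt_eqF //.
have -> : pd_form (correlation mu u) [:: (k%:C%C, 0)] = translate_sum (correlation mu u) [:: ((k ^+ 2)%:C%C, 0)].
  apply/funext => x; rewrite pd1 normc_real real_normK ?num_real //.
  by rewrite /translate_sum big_seq1 /= addr0.
have cc : ccont (correlation mu u) := adm_psi_ccont bw0 wb adm cG cw.
apply: (@sqnorm_gt0 _ _ _ cG haar _ 0); first exact: act_ccont.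
rewrite /translate_sum big_seq1 /= addr0 corr0 -rmorphM /= k2.
apply/eqP => /(congr1 (@complex.Re R)) /= /eqP; rewrite mulf_eq0 invr_eq0.
by rewrite !gt_eqF.
Qed.

Let bound2 := bw ^+ 2.

Lemma norm_psi_le phi psi x : admissible w phi psi -> phi 0 = 1 -> normc (psi x) <= bound2.
Proof.
by move=> adm p1; have := adm_psi_bound wb adm x; rewrite p1 /= mulr1.
Qed.

Lemma sqnorm_le_shift (f h : G -> R[i]) b e : ccont f -> ccont h -> 0 <= e ->
  (forall x, normc (h x) <= b) -> (forall x, normc (f x - h x) <= e) ->
  sqnorm mu f <= sqnorm mu h + (2 * b * e + e ^+ 2).
Proof.
move=> cf ch e0 hb fh; rewrite -(RI_cst mu (_ + _ ^+ 2)) -RID; last 2 first.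
  exact: rint_sqnorm.
  exact: rint_cst.
apply: RI_le => [||x]; first exact: rint_sqnorm.
  by apply: rintD; [exact: rint_sqnorm | exact: rint_cst].
have H : normc (f x) <= normc (h x) + e.
  by rewrite -[f x](subrK (h x)) addrC (le_trans (normcD _ _)) // lerD.
apply: (@le_trans _ _ ((normc (h x) + e) ^+ 2)).
  by rewrite ler_pXn2r ?nnegrE ?normc_ge0 ?addr_ge0 ?normc_ge0.
have -> : (normc (h x) + e) ^+ 2 = normc (h x) ^+ 2 + (2 * normc (h x) * e + e ^+ 2).
  by ring.
by rewrite lerD2l lerD2r ler_wpM2r // ler_wpM2l.
Qed.

(** The quadratic functional is continuous for pointwise limits along an
   ultrafilter because admissible functions are uniformly equicontinuous. *)
Lemma sqnorm_limit (U : set_system nat) (UU : UltraFilter U)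
    (phi psi : nat -> G -> R[i]) phi' psi' :
  (forall n, admissible w (phi n) (psi n)) -> (forall n, phi n 0 = 1) ->
  admissible w phi' psi' -> phi' 0 = 1 ->
  (forall x, clim U (fun n => psi n x) (psi' x)) ->
  forall e, 0 < e -> \forall n \near U, sqnorm mu (psi n) <= sqnorm mu psi' + e.
Proof.
move=> adm p1 adm' p1' psil e e0.
have PU : ProperFilter U := ultra_proper.
have b20 : 0 <= bound2 by exact: sqr_ge0.
have k0 : 0 < 6 * bound2 + 9 by rewrite ltr_wpDl // mulr_ge0.
pose e1 := Num.min 1 (e / (6 * bound2 + 9)).
have e10 : 0 < e1 by rewrite lt_min ltr01 divr_gt0.
have e11 : e1 <= 1 by rewrite ge_min lexx.
have ew : 0 < e1 / bw by rewrite divr_gt0.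
have [n0 [x [E [_ EU _ cE]]]] := compact_cells cG (ccont_unif cG cw ew).
have mod_ f h y i : admissible w f h -> f 0 = 1 -> E i y -> normc (h y - h (x i)) <= e1.
  move=> fh f1 /EU /= H; have := adm_psi_modulus bw0 wb fh (x i) (ltW ew) H.
  by rewrite [x i + _]addrC subrK f1 /= mulr1 divfK ?gt_eqF.
have : \forall n \near U, forall i : 'I_n0, normc (psi n (x i) - psi' (x i)) <= e1.
  by apply: filter_forall => i; exact: clim_normc.
apply: filterS => n Hn.
have cl y : normc (psi n y - psi' y) <= 3 * e1.
  have : (\bigcup_(i < n0) E i) y by rewrite cE.
  move=> [i /= lin Ey].
  have h1 := mod_ _ _ _ _ (adm n) (p1 n) Ey; have h2 := mod_ _ _ _ _ adm' p1' Ey.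
  have h3 := Hn (Ordinal lin); rewrite /= in h3.
  have -> : psi n y - psi' y = (psi n y - psi n (x i)) + (psi n (x i) - psi' (x i))
     + (psi' (x i) - psi' y) by ring.
  apply: (le_trans (normcD _ _)); apply: (@le_trans _ _ (e1 + e1 + e1)); last by lra.
  by apply: lerD; [apply: (le_trans (normcD _ _)); exact: lerD | rewrite normcB].
have c3 : 0 <= 3 * e1 by rewrite mulr_ge0 // ltW.
apply: (le_trans (sqnorm_le_shift (adm_psi_ccont bw0 wb (adm n) cG cw)
  (adm_psi_ccont bw0 wb adm' cG cw) c3 (fun x => norm_psi_le x adm' p1') cl)).
rewrite lerD2l.
apply: (@le_trans _ _ (e1 * (6 * bound2 + 9))).
  have -> : 2 * bound2 * (3 * e1) + (3 * e1) ^+ 2 = e1 * (6 * bound2 + 9 * e1) by ring.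
  by rewrite ler_wpM2l ?(ltW e10) // lerD2l; lra.
by rewrite -ler_pdivlMr // ge_min lexx orbT.
Qed.

(** Pointwise limits along an ultrafilter of a maximising sequence are admissible, and
    no norm is lost in the limit. *)
Lemma exists_maximal phi0 psi0 : admissible w phi0 psi0 -> phi0 0 = 1 ->
  exists phi psi, [/\ admissible w phi psi, phi 0 = 1 &
    forall phi1 psi1, admissible w phi1 psi1 -> phi1 0 = 1 ->
      sqnorm mu psi1 <= sqnorm mu psi].
Proof.
move=> adm0 p0.
pose V := [set v : R | exists phi psi, [/\ admissible w phi psi, phi 0 = 1 & v = sqnorm mu psi]].
have Vub : ubound V (bound2 ^+ 2).
  move=> _ [phi [psi [adm p1 ->]]]; rewrite -[leRHS](RI_cst mu); apply: RI_le.
  - apply: rint_sqnorm => //; exact: (adm_psi_ccont bw0 wb adm cG cw).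
  - exact: rint_cst.
  by move=> x; rewrite ler_pXn2r ?nnegrE ?normc_ge0 ?sqr_ge0 // (norm_psi_le x adm p1).
have Vs : has_sup V.
  by split; [exists (sqnorm mu psi0), phi0, psi0 | exists (bound2 ^+ 2)].
have /choice[pr prP] : forall n : nat, exists p : (G -> R[i]) * (G -> R[i]),
    [/\ admissible w p.1 p.2, p.1 0 = 1 & sup V - n.+1%:R^-1 < sqnorm mu p.2].
  move=> n; have n0 : 0 < n.+1%:R^-1 :> R by rewrite invr_gt0 ltr0n.
  by have [_ [phi [psi [adm p1 ->]]] H] := sup_adherent n0 Vs; exists (phi, psi).
have [U [UU Uoo]] := @ultraFilterLemma _ (\oo : set_system nat) _.
have adm n : admissible w (pr n).1 (pr n).2 by case: (prP n).
have p1 n : (pr n).1 0 = 1 by case: (prP n).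
have /choice[phi phil] : forall x, exists l, clim U (fun n => (pr n).1 x) l.
  move=> x; apply: (@ultra_bounded_clim _ _ _ _ 1) => n.
  by have := adm_phi_le bw0 wb (adm n) x; rewrite p1.
have /choice[psi psil] : forall x, exists l, clim U (fun n => (pr n).2 x) l.
  move=> x; apply: (@ultra_bounded_clim _ _ _ _ bound2) => n.
  exact: norm_psi_le (adm n) (p1 n).
have phi1 : phi 0 = 1.
  apply: (clim_unique (phil 0)); under eq_fun do rewrite p1.
  exact: clim_cst.
have adm' : admissible w phi psi by exact: admissible_limit adm phil psil.
exists phi, psi; split => [||phi1' psi1' adm1 p1']; [exact: adm'|by []|].
have S1 : sqnorm mu psi1' <= sup V.
  by apply: ub_le_sup; [exact: Vs.2 | exists phi1', psi1'].
apply: (le_trans S1); apply/ler_addgt0Pr => e e0.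
have e2 : 0 < e / 2 by rewrite divr_gt0.
have PU : ProperFilter U := ultra_proper.
have N1 : \forall n \near U, sqnorm mu (pr n).2 <= sqnorm mu psi + e / 2.
  exact: (sqnorm_limit UU adm p1 adm' phi1 psil e2).
have N2 : \forall n \near U, n.+1%:R^-1 < e / 2 :> R.
  by apply: Uoo; exact: near_infty_natSinv_lt (PosNum e2).
have [n [H1 H2]] := filter_ex (filterI N1 N2).
have [_ _ H3] := prP n; rewrite ltrBlDr in H3.
apply: (le_trans (ltW H3)); rewrite [e]splitr addrA.
by apply: lerD => //; exact: ltW.
Qed.

End maximal_pair.

(** * Uniqueness of the Fourier coefficients of a continuous function *)

Section maximal_is_character.
Variables (R : realType) (G : topologicalZmodType).
Variable mu : probability (Borel G) R.
Hypothesis cG : compact [set: G].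
Hypothesis haar : haar_measure mu.
Variable w : G -> R[i].
Hypothesis cw : ccont w.
Variable bw : R.
Hypothesis bw0 : 0 < bw.
Hypothesis wb : forall x, normc (w x) <= bw.
Variables phi psi : G -> R[i].
Hypothesis adm : admissible w phi psi.
Hypothesis phi1 : phi 0 = 1.
Hypothesis psi_gt0 : 0 < sqnorm mu psi.
Hypothesis maxi : forall phi' psi', admissible w phi' psi' -> phi' 0 = 1 ->
  sqnorm mu psi' <= sqnorm mu psi.

Let cont f h : admissible w f h -> ccont h.
Proof. by move=> fh; exact: (adm_psi_ccont bw0 wb fh cG cw). Qed.

Lemma sqnorm_act_dirac h (k : R) : ccont h ->
  sqnorm mu (pd_form h [:: (k%:C%C, 0)]) = k ^+ 4 * sqnorm mu h.
Proof.
move=> ch; rewrite /sqnorm -RIZ; last exact: rint_sqnorm.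
congr RI; apply/funext => y; rewrite pd1 normcM normc_real normc_real real_normK ?num_real //.
by rewrite ger0_norm ?sqr_ge0 // exprMn -exprM.
Qed.

(** Both components may be multiplied by the same positive number, which normalises
    the value of the first one at 0. *)
Lemma maximal_homogeneous phi' psi' : admissible w phi' psi' ->
  sqnorm mu psi' <= sqnorm mu psi * Re (phi' 0) ^+ 2.
Proof.
move=> adm'; set p := Re (phi' 0).
have p0 : 0 <= p by exact: (adm_posphi bw0 wb adm' [::]).
have [p_0|p_neq] := eqVneq p 0.
  have -> : sqnorm mu psi' = 0; last by rewrite p_0 expr0n mulr0.
  rewrite /sqnorm (_ : (fun y => _) = (fun=> 0)) ?RI_cst //; apply/funext => y.
  have := adm_psi_bound wb adm' y; rewrite -/p p_0 mulr0 => H.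
  by have /eqP -> : normc (psi' y) == 0; rewrite ?expr0n // eq_le H normc_ge0.
have pp : 0 < p by rewrite lt0r p_neq.
pose k : R := (Num.sqrt p)^-1.
have k2 : k ^+ 2 = p^-1 by rewrite exprVn sqr_sqrtr.
have := maxi (admissible_pd [:: (k%:C%C, 0)] adm').
rewrite pd1 normc_real real_normK ?num_real // k2.
rewrite (hermitian0 (adm_hphi adm')) -/p -rmorphM /= mulVf // => /(_ erefl).
rewrite sqnorm_act_dirac; last exact: cont adm'.
by rewrite (_ : k ^+ 4 = (p ^+ 2)^-1) ?ler_pdivrMl ?exprn_gt0 // -?exprVn -?k2 -?exprM // mulrC.
Qed.

(** The perturbed pairs have total mass 4 and their second components add up to
   4 psi, so maximality forces equality in the triangle inequality. *)
Lemma perturbation_proportional (c : R[i]) a x : normc c = 1 ->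
  c * psi (x + a) + c^* * psi (x - a) = (c * phi a + (c * phi a)^*) * psi x.
Proof.
move=> c1.
have cc : c * c^* = 1 by rewrite mul_conjc c1 expr1n.
have pdE (f : G -> R[i]) (z : R[i]) y : z * z^* = 1 -> pd_form f [:: (1, 0); (z, a)] y =
    2 * f y + z * f (y + a) + z^* * f (y - a).
  move=> zz; rewrite /pd_form !big_cons !big_nil /= rmorph1 !subrr sub0r subr0 !addr0.
  by rewrite !mul1r !mulr1 zz; ring.
pose ps := pd_form psi [:: (1, 0); (c, a)]; pose ms := pd_form psi [:: (1, 0); (- c, a)].
pose pf := pd_form phi [:: (1, 0); (c, a)]; pose mf := pd_form phi [:: (1, 0); (- c, a)].
have admp : admissible w pf ps by exact: admissible_pd.
have admm : admissible w mf ms by exact: admissible_pd.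
have ncc : - c * (- c)^* = 1 by rewrite rmorphN mulrNN.
have c4 : (4 : R)%:C%C = 4 by rewrite rmorph_nat.
have sumps y : ms y = (4 : R)%:C%C * psi y - ps y.
  by rewrite c4 /ms /ps !pdE // rmorphN; ring.
have summf : mf 0 = (4 : R)%:C%C - pf 0 by rewrite c4 /mf /pf !pdE // phi1 rmorphN; ring.
set p := Re (pf 0).
have p0 : 0 <= p by exact: (adm_posphi bw0 wb admp [::]).
have mE : Re (mf 0) = 4 - p by rewrite summf Re_subc.
have p4 : p <= 4 by rewrite -subr_ge0 -mE; exact: (adm_posphi bw0 wb admm [::]).
have Hp := maximal_homogeneous admp; have Hm := maximal_homogeneous admm.
rewrite mE in Hm; rewrite -/p in Hp.
have cps := cont admp; have cms := cont admm; have cpsi := cont adm.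
pose D y := ps y - p%:C%C * psi y.
have cD : ccont D.
  rewrite (_ : D = fun y => ps y + (- p)%:C%C * psi y).
    by apply: ccontD => //; apply: ccontM => //; exact: ccont_cst.
  by apply/funext => y; rewrite /D rmorphN mulNr.
have DE y : normc (D y) ^+ 2 = (1 - p / 4) * normc (ps y) ^+ 2 +
    (p / 4) * normc (ms y) ^+ 2 + (p ^+ 2 - 4 * p) * normc (psi y) ^+ 2.
  rewrite sumps /D !normcE2 !Re_subc !Im_subc !Re_mulc !Im_mulc /=.
  by field.
have sD : sqnorm mu D <= 0.
  have i1 := rint_sqnorm mu cG cps; have i2 := rint_sqnorm mu cG cms.
  have i3 := rint_sqnorm mu cG cpsi.
  have -> : sqnorm mu D = (1 - p / 4) * sqnorm mu ps + (p / 4) * sqnorm mu ms +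
      (p ^+ 2 - 4 * p) * sqnorm mu psi.
    rewrite /sqnorm -!RIZ // -!RID; try by do ?apply: rintD; exact: rintZ.
    by congr RI; apply/funext => y; rewrite DE.
  have h1 : (1 - p / 4) * sqnorm mu ps <= (1 - p / 4) * (sqnorm mu psi * p ^+ 2).
    by apply: ler_wpM2l => //; lra.
  have h2 : (p / 4) * sqnorm mu ms <= (p / 4) * (sqnorm mu psi * (4 - p) ^+ 2).
    by apply: ler_wpM2l => //; lra.
  apply: (le_trans (lerD (lerD h1 h2) (lexx _))).
  by rewrite le_eqVlt; apply/orP; left; apply/eqP; field.
have := sqnorm_le0 cG haar cD sD x; rewrite /D /ps pdE // => /eqP.
rewrite subr_eq0 => /eqP H.
have pE : p%:C%C = 2 + c * phi a + (c * phi a)^*.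
  rewrite /p -hermitian0; last exact: (adm_hphi admp).
  by rewrite /pf pdE // phi1 add0r sub0r (adm_hphi adm) rmorphM mulr1.
apply: (addrI (2 * psi x)); rewrite addrA H pE; ring.
Qed.

(** The proportionality for c = 1 and for c equal to the imaginary unit add up to it. *)
Lemma maximal_equivariant x a : psi (x + a) = phi a * psi x.
Proof.
have H1 := @perturbation_proportional 1 a x (normc_1 R).
have i1 : normc (Complex 0 1 : R[i]) = 1 by rewrite /= expr0n expr1n add0r sqrtr1.
have H2 := @perturbation_proportional (Complex 0 1) a x i1.
have ii : (Complex 0 1 : R[i]) * Complex 0 1 = -1 by rewrite -expr2 sqr_i.
have ci : (Complex 0 1 : R[i])^* = - Complex 0 1 by apply: complex_eqP; rewrite /= ?oppr0.
rewrite rmorph1 !mul1r in H1; rewrite rmorphM /= ci in H2.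
have H3 : psi (x + a) - psi (x - a) = (phi a - (phi a)^*) * psi x.
  have i0 : (Complex 0 1 : R[i]) != 0 by apply/eqP => /(congr1 (@complex.Im R)) /= /eqP; rewrite oner_eq0.
  by apply: (mulfI i0); move: H2; rewrite !mulNr mulrBr => ->; rewrite mulrA mulrBr.
transitivity ((psi (x + a) + psi (x - a) + (psi (x + a) - psi (x - a))) / 2).
  by field.
by rewrite H1 H3; field.
Qed.

Lemma psi0_neq0 : psi 0 != 0.
Proof.
apply/eqP => p0; move: psi_gt0.
rewrite (_ : sqnorm mu psi = 0) ?ltxx // /sqnorm (_ : (fun y => _) = (fun=> 0)) ?RI_cst //.
apply/funext => y; rewrite -[y]add0r maximal_equivariant p0 mulr0.
by rewrite normc_0 expr0n.
Qed.

Lemma ccont_continuous (f : G -> R[i]) : ccont f -> continuous (f : G -> R[i]^o).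
Proof.
move=> cf x; apply/cvgrPdist_lt => e; rewrite ltcE /= => /andP[/eqP ei e0].
have -> : e = (Re e)%:C%C by apply: complex_eqP.
have e2 : 0 < Re e / 2 by rewrite divr_gt0.
have U := ccont_unif cG cf e2.
have : nbhs x [set y | forall z, normc (f (z + (- x + y)) - f z) <= Re e / 2].
  apply: (@addr_continuous G (- x) x
    [set a | forall z, normc (f (z + a) - f z) <= Re e / 2]).
  by rewrite addNr.
apply: filterS => y /(_ x); rewrite addrA subrr add0r => H.
have -> : `|f x - f y| = (normc (f x - f y))%:C%C by [].
rewrite ltcR normcB (le_lt_trans H) //.
by rewrite ltr_pdivrMr // ltr_pMr // ltr1n.
Qed.

(** Equivariance makes phi multiplicative, and psi is a multiple of phi. *)
Lemma maximal_character : exists chi : character R G, forall x, psi x = psi 0 * chi x.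
Proof.
have p0 := psi0_neq0.
have phiE a : psi a = phi a * psi 0 by rewrite -[in LHS](add0r a) maximal_equivariant.
have phiD x y : phi (x + y) = phi x * phi y.
  by apply: (mulIf p0); rewrite -phiE maximal_equivariant phiE; ring.
have phiN x : normc (phi x) = 1.
  have : phi x * phi (- x) = 1 by rewrite -phiD subrr.
  rewrite (adm_hphi adm) mul_conjc => /(congr1 (@complex.Re R)) /= /eqP.
  by rewrite -[X in _ == X](expr1n _ 2) eqrXn2 ?normc_ge0 // => /eqP.
have cphi : ccont phi.
  rewrite (_ : phi = fun x => (psi 0)^-1 * psi x).
    by apply: ccontM; [exact: ccont_cst | exact: cont adm].
  by apply/funext => x; rewrite [psi x]phiE mulrC mulfK.
exists (Character phiN phiD (ccont_continuous cphi)) => x.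
by rewrite phiE mulrC.
Qed.

End maximal_is_character.

Section peter_weyl.
Variables (R : realType) (G : topologicalZmodType).
Variable mu : probability (Borel G) R.
Hypothesis cG : compact [set: G].
Hypothesis haar : haar_measure mu.

Lemma normc_RI_char (gamma : character R G) : RI mu (fun y => normc ((gamma y)^*)) = 1.
Proof.
rewrite (_ : (fun y => _) = (fun=> 1)) ?RI_cst //.
by apply/funext => y; rewrite normc_conj char_norm.
Qed.

Lemma char0 (gamma : character R G) : gamma 0 = 1.
Proof.
have := charD gamma 0 0; rewrite addr0 => /eqP.
have g0 : gamma 0 != 0.
  apply/eqP => g0; have := char_norm gamma 0; rewrite g0 normc_0 => /eqP.
  by rewrite eq_sym oner_eq0.
by rewrite -{1}[gamma 0]mulr1 (inj_eq (mulfI g0)) eq_sym => /eqP.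
Qed.

Lemma charN (gamma : character R G) x : gamma (- x) = (gamma x)^*.
Proof.
have g0 : gamma x != 0.
  apply/eqP => g0; have := char_norm gamma x; rewrite g0 normc_0 => /eqP.
  by rewrite eq_sym oner_eq0.
by apply: (mulfI g0); rewrite -charD subrr char0 mul_conjc char_norm expr1n.
Qed.

(** A Riemann sum for the Fourier coefficient of w at the character found makes
   the translates of w cancel, but not the translates of the character. *)
Theorem continuous_fourier_unique (w : G -> R[i]) : ccont w ->
  (forall gamma, fourier mu w gamma = 0) -> forall x, w x = 0.
Proof.
move=> cw w0 z; apply/eqP; rewrite -[_ == _]negbK; apply/negP => wz.
have [b0 wb0] := ccont_bounded cG cw.
pose bw := b0 + 1.
have bw0 : 0 < bw by rewrite ltr_wpDl // (le_trans (normc_ge0 _) (wb0 0)).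
have wb x : normc (w x) <= bw by rewrite (le_trans (wb0 x)) // lerDl.
have [f0 [h0 [adm0 f01 h0p]]] := exists_admissible cG haar cw bw0 wb wz.
have [phi [psi [adm p1 mx]]] := exists_maximal mu cG cw bw0 wb adm0 f01.
have psi_gt0 : 0 < sqnorm mu psi by apply: (lt_le_trans h0p); exact: mx adm0 f01.
have [chi psiE] := maximal_character cG haar cw bw0 wb adm p1 psi_gt0 mx.
have psi0 : 0 < Re (psi 0).
  rewrite lt0r (adm_pos adm [::]) andbT.
  have := psi0_neq0 cG haar cw bw0 wb adm p1 psi_gt0 mx; apply: contra_neq => H.
  by rewrite (hermitian0 (adm_hpsi adm)) H.
pose e := Num.min (1 / 2) (Re (psi 0) / 4).
have e0 : 0 < e by rewrite lt_min !divr_gt0.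
have e12 : e <= 1 / 2 by rewrite ge_min lexx.
have e4 : e <= Re (psi 0) / 4 by rewrite ge_min lexx orbT.
have cchi := char_ccont chi.
have Un : nbhs (0 : G) ([set a | forall y, normc (w (y + a) - w y) <= e] `&`
    [set a | forall y, normc (chi (y + a) - chi y) <= e]).
  by apply: filterI; exact: ccont_unif.
have [n [x [E [mE _ EU pE]]]] := @cells_in R G cG _ _ measurableT (ex_intro _ (0 : Borel G) I) Un.
pose g (y : G) := (chi y)^*.
have ig : cintegrable mu g by apply: (ccont_cint _ cG); exact: ccont_conj.
pose xi := [seq (weight mu g (E i), x i) | i <- index_iota 0 n].
have xiE (h : G -> R[i]) y : translate_sum h xi y = \sum_(i < n) weight mu g (E i) * h (y + x i).
  by rewrite /translate_sum big_map big_mkord.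
have gT y : ~ [set: Borel G] y -> g y = 0 by move=> /(_ I).
have wxi y : normc (translate_sum w xi y) <= e.
  have cwy : ccont (fun t => w (y + t)) by exact: ccont_shift.
  have := @riemann_sum _ _ mu setT n x E g (fun t => w (y + t)) bw e mE pE gT ig
    (ccont_cmeas cwy) (fun t => wb (y + t)).
  have -> : cintegral mu (fun t => g t * w (y + t)) = 0.
    rewrite -(cintegral_shift haar (- y)); last first.
      by apply: cintM_bounded (ccont_cmeas cwy) (fun t => wb (y + t)).
    rewrite (_ : (fun t => _) = (fun t => chi y * (w t * (chi t)^*))).
      rewrite cintegralZ; last by apply: (ccont_cint _ cG); apply: ccontM => //; exact: ccont_conj.
      by have := w0 chi; rewrite /fourier => ->; rewrite mulr0.
    apply/funext => t; rewrite /g charD rmorphM /= charN conjCK addrA subrr add0r; ring.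
  rewrite subr0 normc_RI_char mulr1 xiE; apply => i t /EU [/= H _].
  by have := H (y + x i); rewrite -addrA [x i + _]addrC subrK.
have cxi : normc (translate_sum chi xi 0 - 1) <= e.
  have := @riemann_sum _ _ mu setT n x E g chi 1 e mE pE gT ig
    (ccont_cmeas cchi).
  have -> : cintegral mu (fun t => g t * chi t) = 1.
    rewrite (_ : (fun t => _) = (fun=> 1)) ?cintegral_cst //; apply/funext => t.
    by rewrite /g mulrC mul_conjc char_norm expr1n.
  rewrite normc_RI_char mulr1 xiE => H.
  under eq_bigr do rewrite add0r.
  apply: H => [t|i t /EU [/= _ H]]; first by rewrite char_norm.
  by have := H (x i); rewrite [x i + _]addrC subrK.
have := adm_dom adm [::] wxi; rewrite /pd_forms /= p1 /= mulr1.
have -> : pd_form psi xi 0 = psi 0 * ((normc (translate_sum chi xi 0)) ^+ 2)%:C%C.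
  rewrite -mul_conjc /translate_sum /pd_form rmorph_sum mulr_suml mulr_sumr; apply: eq_bigr => p _.
  rewrite !mulr_sumr; apply: eq_bigr => q _.
  by rewrite psiE !add0r charD charN rmorphM; ring.
rewrite Re_mulc /= mulr0 subr0 => H.
have n1 : 1 / 2 <= normc (translate_sum chi xi 0).
  have := normcD (1 - translate_sum chi xi 0) (translate_sum chi xi 0); rewrite subrK normc_1 normcB.
  by move: cxi e12; move: (normc _) (normc _) => A B; lra.
have n2 : 1 / 4 <= normc (translate_sum chi xi 0) ^+ 2.
  have -> : 1 / 4 = (1 / 2) ^+ 2 :> R by field.
  by rewrite ler_pXn2r ?nnegrE ?normc_ge0 // divr_ge0.
have : Re (psi 0) / 4 <= e ^+ 2.
  by apply: le_trans H; rewrite ler_wpM2l ?(ltW psi0) // -div1r.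
have : e ^+ 2 <= 1 / 2 * (Re (psi 0) / 4).
  by rewrite expr2; apply: ler_pM => //; exact: ltW.
by move: psi0; move: (Re _) => A; lra.
Qed.

End peter_weyl.

(** * Orthogonality to continuous functions *)

Section regular_orthogonality.
Variables (R : realType) (G : topologicalZmodType).
Variable mu : probability (Borel G) R.
Hypothesis cG : compact [set: G].
Hypothesis hG : hausdorff_space G.
Hypothesis haar : haar_measure mu.

Lemma open_borel (U : set G) : open U -> measurable (U : set (Borel G)).
Proof. by move=> oU; exact: sub_sigma_algebra. Qed.

Lemma closed_borel (K : set G) : closed K -> measurable (K : set (Borel G)).
Proof.
by move=> cK; rewrite -[K]setCK; apply: measurableC; apply: open_borel; exact: closed_openC.
Qed.

Lemma fine_mu_fin (A : set (Borel G)) : measurable A -> mu A = (fine (mu A))%:E.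
Proof.
by move=> mA; rewrite fineK // fin_num_measure.
Qed.

(** Regularity of Haar measure squeezes a Borel set between a closed and an open
   set of nearly the same measure. *)
Lemma urysohn_approx (A : set (Borel G)) (d : R) : measurable A -> 0 < d ->
  exists (k : G -> R) (D : set (Borel G)),
  [/\ continuous k, measurable D, (mu D < d%:E)%E
    & forall x : G, `|\1_A x - k x| <= \1_D x].
Proof.
move=> mA d0; have [_ outer inner] := haar.
have d2 : 0 < d / 2 by rewrite divr_gt0.
have fA : mu A \is a fin_num by rewrite (fine_mu_fin mA).
have [_ [U [oU AU] <-] UA] := lb_ereal_inf_adherent d2 (eq_ind _ (fun z => z \is a fin_num) fA _ (outer A mA)).
have [_ [K [cK KA] <-] AK] := ub_ereal_sup_adherent d2 (eq_ind _ (fun z => z \is a fin_num) fA _ (inner A mA)).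
rewrite -(outer A mA) in UA; rewrite -(inner A mA) in AK.
have mU := open_borel oU; have mK := closed_borel cK.
have KU : K `<=` U by move=> x /KA /AU.
exists (@Urysohn G R (~` U) K), ((U : set (Borel G)) `\` K); split.
- exact: Urysohn_continuous.
- exact: measurableD.
- have Uoo : (mu (U : set (Borel G)) < +oo)%E by rewrite (fine_mu_fin mU) ltry.
  rewrite measureD //.
  rewrite setIidr //; move: UA AK.
  rewrite (fine_mu_fin mU) (fine_mu_fin mK) (fine_mu_fin mA) -!EFinN -!EFinD !lte_fin.
  move=> h1 h2; apply: (@le_lt_trans _ _ ((fine (mu U))%:E - (fine (mu K))%:E)%E).
    by rewrite -(fine_mu_fin mU) -(fine_mu_fin mK).
  by rewrite -EFinB lte_fin; clear -h1 h2; lra.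
have sep : uniform_separator (~` U) K.
  have /(@normal_separatorP R) := compact_normal hG cG; apply => //.
    exact: open_closedC.
  by apply/disjoints_subset => x /= nU Kx; exact: nU (KU _ Kx).
have s0 := @Urysohn_sub0 G R _ _ sep; have s1 := @Urysohn_sub1 G R _ _ sep.
move=> x; have : `[0, 1]%classic (@Urysohn G R (~` U) K x).
  by apply: (@Urysohn_range G R (~` U) K); exists x.
rewrite /= in_itv /= => /andP[k0 k1].
have [Ux|Ux] := pselect (U x); last first.
  have -> : @Urysohn G R (~` U) K x = 0 by apply: s0; exists x.
  rewrite indicE memNset; last by move=> /AU.
  by rewrite indicE memNset ?subrr ?normr0 // => -[].
have [Kx|Kx] := pselect (K x).
  have -> : @Urysohn G R (~` U) K x = 1 by apply: s1; exists x.
  by rewrite indicE mem_set ?subrr ?normr0 //; exact: KA.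
rewrite [leRHS]indicE mem_set; last by split.
rewrite indicE; case: (_ \in _) => /=; rewrite ler_norml; apply/andP; split; lra.
Qed.

(** Continuous functions approximate indicators of Borel sets in mean, so r is
    orthogonal to the indicator of the set where it is nonnegative and to that of its
    complement. *)
Lemma continuous_orthogonal_ae0 (r : G -> R) : rint mu r ->
  (forall k : G -> R, continuous k -> RI mu (fun x => k x * r x) = 0) ->
  \forall x \ae mu, r x = 0.
Proof.
move=> ir orth; have mr := rint_meas ir.
have indic0 (A : set (Borel G)) : measurable A -> RI mu (fun x : G => \1_A x * r x) = 0.
  move=> mA; apply/eqP; rewrite -normr_eq0 eq_le normr_ge0 andbT.
  apply/ler_addgt0Pr => e e0; rewrite add0r.
  have [d [d0 dP]] := integral_normr_continuous ir e0.
  have [k [D [ck mD Dd kD]]] := urysohn_approx mA d0.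
  have [b kb] := rcont_bounded cG ck.
  have bound1 (B : set (Borel G)) (x : G) : `|\1_B x : R| <= 1.
    by rewrite indicE; case: (_ \in _); rewrite ?normr1 ?normr0.
  have i1 : rint mu (fun x => \1_A x * r x).
    under eq_fun do rewrite mulrC.
    by apply: (@rint_mul _ _ _ _ _ 1) => //; exact: measurable_indic.
  have i2 : rint mu (fun x => k x * r x).
    under eq_fun do rewrite mulrC.
    by apply: (@rint_mul _ _ _ _ _ b) => //; exact: rcont_rmeas.
  have i3 : rint mu (fun x => \1_D x * `|r x|).
    under eq_fun do rewrite mulrC.
    by apply: (@rint_mul _ _ _ _ _ 1); [exact: rint_abs|exact: measurable_indic|].
  rewrite -[X in `|X|]subr0 -(orth k ck) -RIB //.
  apply: (le_trans (RI_abs (rintB i1 i2))).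
  apply: (@le_trans _ _ (RI mu (fun x => \1_D x * `|r x|))).
    apply: RI_le => //; first by apply: rint_abs; exact: rintB.
    by move=> x; rewrite -mulrBl normrM ler_wpM2r.
  have := dP _ mD Dd; rewrite Rintegral_mkcond => H; apply: ltW; apply: le_lt_trans H.
  rewrite le_eqVlt; apply/orP; left; apply/eqP; congr Rintegral; apply/funext => x.
  by rewrite patchE indicE; case: ifPn; rewrite ?mul1r ?mul0r.
have mP : measurable ([set x : G | 0 <= r x] : set (Borel G)).
  rewrite (_ : [set x : G | 0 <= r x] = setT `&` (r : Borel G -> R) @^-1` `[0, +oo[%classic).
    by apply: mr.
  by apply/seteqP; split => x /=; rewrite in_itv /= andbT => // -[].
set P := [set x : G | 0 <= r x] in mP.
have a0 : RI mu (fun x => `|r x|) = 0.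
  rewrite (_ : (fun x => `|r x|) = fun x => \1_P x * r x - \1_(~` P) x * r x).
    rewrite RIB ?indic0 ?subr0 //; first exact: measurableC.
    - under eq_fun do rewrite mulrC.
      apply: (@rint_mul _ _ _ _ _ 1) => //; first exact: measurable_indic.
      by move=> x; rewrite indicE; case: (_ \in _); rewrite ?normr1 ?normr0.
    under eq_fun do rewrite mulrC.
    apply: (@rint_mul _ _ _ _ _ 1) => //; first by apply: measurable_indic; exact: measurableC.
    by move=> x; rewrite indicE; case: (_ \in _); rewrite ?normr1 ?normr0.
  apply/funext => x; rewrite !indicE in_setC.
  case: (boolP (x \in P)) => [/set_mem Px|/negP nP] /=.
    by rewrite mul1r mul0r subr0 ger0_norm.
  have : ~~ (0 <= r x) by apply/negP => H; apply: nP; exact: mem_set.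
  by rewrite -ltNge mul0r mul1r sub0r => /ltr0_norm.
have mEr : measurable_fun setT (fun x : Borel G => (r x)%:E) by apply/measurable_EFinP.
have /(ae_eq_integral_abs mu measurableT mEr) H : (\int[mu]_x `|(r x)%:E| = 0)%E.
  rewrite -[LHS]fineK; first by congr EFin; exact: a0.
  by rewrite ge0_fin_numE ?integral_ge0 //; have /integrableP[] := ir.
by apply: filterS H => x /(_ I) [].
Qed.

End regular_orthogonality.

(** * Fourier inversion in the Wiener algebra *)

Section characters_orthogonality.
Variables (R : realType) (G : topologicalZmodType).
Variable mu : probability (Borel G) R.
Hypothesis cG : compact [set: G].
Hypothesis haar : haar_measure mu.

Lemma character_eq (c d : character R G) : (forall x, c x = d x) -> c = d.
Proof.
case: c d => [c c1 c2 c3] [d d1 d2 d3] /= cd.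
have E : c = d by apply/funext.
by subst d; congr Character; exact: Prop_irrelevance.
Qed.

Lemma char_cint (c : character R G) : cintegrable mu c.
Proof. by apply: (ccont_cint _ cG); exact: char_ccont. Qed.

Lemma char_orthogonal (c d : character R G) : c != d -> fourier mu c d = 0.
Proof.
move=> cd; have [a ad] : exists a, c a != d a.
  apply: contrapT => H; move/eqP: cd; apply; apply: character_eq => x.
  by apply/eqP; rewrite -[_ == _]negbK; apply/negP => cx; apply: H; exists x.
have ic : cintegrable mu (fun x => c x * (d x)^*).
  apply: (ccont_cint _ cG); apply: ccontM; first exact: char_ccont.
  by apply: ccont_conj; exact: char_ccont.
have H : fourier mu c d = c a * (d a)^* * fourier mu c d.
  rewrite {1}/fourier -(cintegral_shift haar a ic) -cintegralZ //.
  by congr cintegral; apply/funext => x; rewrite !charD rmorphM /=; ring.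
have : (1 - c a * (d a)^*) * fourier mu c d = 0 by rewrite mulrBl mul1r -H subrr.
move=> /eqP; rewrite mulf_eq0 => /orP[|/eqP//]; rewrite subr_eq0 => /eqP H1.
case/eqP: ad; rewrite -[RHS]mul1r H1 -mulrA [_^* * _]mulrC mul_conjc char_norm.
by rewrite expr1n mulr1.
Qed.

Lemma char_normalized (c : character R G) : fourier mu c c = 1.
Proof.
rewrite /fourier (_ : (fun x => _) = fun=> 1) ?cintegral_cst //.
by apply/funext => x; rewrite mul_conjc char_norm expr1n.
Qed.

End characters_orthogonality.

Section fourier_inversion.
Variables (R : realType) (G : topologicalZmodType).
Variable mu : probability (Borel G) R.
Hypothesis cG : compact [set: G].
Hypothesis hG : hausdorff_space G.
Hypothesis haar : haar_measure mu.
Variable f : G -> R[i].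
Hypothesis wf : wiener_algebra mu f.

Let A : R := fine (wiener_norm mu f).
Let a (gamma : character R G) : R := normc (fourier mu f gamma).

Lemma wiener_norm_fin : wiener_norm mu f = A%:E.
Proof.
rewrite /A fineK // ge0_fin_numE; first by case: wf.
by apply: esum_ge0 => c _; rewrite lee_fin normc_ge0.
Qed.

Lemma wiener_sum_le (s : seq (character R G)) : uniq s -> \sum_(c <- s) a c <= A.
Proof.
move=> us; rewrite -lee_fin -wiener_norm_fin -sumEFin.
apply: esum_ge; exists [set` s]; first by split => //; exact: finite_seq.
by rewrite -fsbig_seq.
Qed.

Lemma wiener_tail e : 0 < e -> exists s : seq (character R G), uniq s /\
  forall t, uniq t -> (forall c, c \in t -> c \notin s) -> \sum_(c <- t) a c <= e.
Proof.
move=> e0; have fw : wiener_norm mu f \is a fin_num by rewrite wiener_norm_fin.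
have [_ [X [fX _] <-] Xe] := ub_ereal_sup_adherent e0 fw.
exists (fset_set X); split; first exact: fset_uniq.
move=> t ut tX.
have : \sum_(c <- enum_fset (fset_set X) ++ t) a c <= A.
  apply: wiener_sum_le; rewrite cat_uniq fset_uniq ut andbT /=.
  by apply/hasPn => c ct; exact: tX.
move: Xe; rewrite (wiener_norm_fin : ereal_sup _ = _) fsbig_finite // sumEFin -EFinB lte_fin.
by rewrite big_cat /=; set u := \sum_(i <- _) _; set v := \sum_(i <- t) _; lra.
Qed.

Definition partial_fourier (s : seq (character R G)) (x : G) : R[i] :=
  \sum_(c <- s) fourier mu f c * c x.

Lemma partial_fourier_ccont s : ccont (partial_fourier s).
Proof.
apply: ccont_sum => c _; apply: ccontM; first exact: ccont_cst.
exact: char_ccont.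
Qed.

Lemma partial_fourier_le s x : uniq s -> normc (partial_fourier s x) <= A.
Proof.
move=> us; apply: le_trans (wiener_sum_le us); apply: (le_trans (normc_sum _ _ _)).
by apply: ler_sum => c _; rewrite normcM char_norm mulr1.
Qed.

Let tail (s : seq (character R G)) e := forall t, uniq t ->
  (forall c, c \in t -> c \notin s) -> \sum_(c <- t) a c <= e.

Lemma partial_fourier_diff s t e1 e2 x : uniq s -> uniq t -> tail s e1 -> tail t e2 ->
  normc (partial_fourier s x - partial_fourier t x) <= e1 + e2.
Proof.
move=> us ut ts tt.
have bnd (r r' : seq (character R G)) e : uniq r -> tail r' e ->
    normc (\sum_(c <- r | c \notin r') fourier mu f c * c x) <= e.
  move=> ur tr; rewrite -big_filter; apply: (le_trans (normc_sum _ _ _)).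
  apply: le_trans (tr [seq c <- r | c \notin r'] (filter_uniq _ ur) _); last first.
    by move=> c; rewrite mem_filter => /andP[].
  by apply: ler_sum => c _; rewrite normcM char_norm mulr1.
rewrite /partial_fourier (bigID (mem t)) /= [X in _ - X](bigID (mem s)) /=.
rewrite (_ : \sum_(c <- s | c \in t) _ = \sum_(c <- t | c \in s) fourier mu f c * c x).
  rewrite opprD addrACA subrr add0r addrC (le_trans (normcD _ _)) // lerD //.
    by rewrite normc_opp; exact: bnd.
  exact: bnd.
rewrite -big_filter -[RHS]big_filter; apply: perm_big; apply: uniq_perm; try exact: filter_uniq.
by move=> c; rewrite !mem_filter andbC.
Qed.

(** The partial sums converge uniformly to a continuous function F with the Fourier
    coefficients of f. Convolutions of f - F with continuous functions are continuous
    with vanishing coefficients, hence vanish, so f - F is orthogonal to all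
    continuous functions. *)
Theorem fourier_inversion : exists F : G -> R[i],
  [/\ ccont F, forall x, normc (F x) <= A, \forall x \ae mu, f x = F x
    & forall e, 0 < e -> exists s, uniq s /\
        forall x, normc (F x - partial_fourier s x) <= e].
Proof.
have /choice[s sP] : forall n : nat, exists s : seq (character R G), uniq s /\ tail s n.+1%:R^-1.
  by move=> n; apply: wiener_tail; rewrite invr_gt0 ltr0n.
have us n : uniq (s n) by case: (sP n).
have ts n : tail (s n) n.+1%:R^-1 by case: (sP n).
(* The ultrafilter only serves to name the limit; the tail bound gives the rate. *)
have [U [UU Uoo]] := @ultraFilterLemma _ (\oo : set_system nat) _.
have PU : ProperFilter U := ultra_proper.
have /choice[F Fl] : forall x, exists l, clim U (fun n => partial_fourier (s n) x) l.
  by move=> x; apply: (@ultra_bounded_clim _ _ _ _ A) => n; exact: partial_fourier_le.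
have Fn n x : normc (F x - partial_fourier (s n) x) <= n.+1%:R^-1.
  apply/ler_addgt0Pr => e e0; have e2 : 0 < e / 2 by rewrite divr_gt0.
  have N1 : \forall m \near U, normc (partial_fourier (s m) x - F x) <= e / 2.
    exact: clim_normc (Fl x) e2.
  have N2 : \forall n \near U, n.+1%:R^-1 < e / 2 :> R.
    by apply: Uoo; exact: near_infty_natSinv_lt (PosNum e2).
  have [m [H1 H2]] := filter_ex (filterI N1 N2).
  have H3 := partial_fourier_diff x (us n) (us m) (ts n) (ts m).
  rewrite -[F x](subrK (partial_fourier (s m) x)) -addrA (le_trans (normcD _ _)) //.
  rewrite normcB in H1; rewrite normcB in H3.
  apply: (le_trans (lerD H1 H3)); rewrite [in leRHS](splitr e).
  by rewrite addrC -addrA lerD2l lerD2r ltW.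
have small e : 0 < e -> exists n, n.+1%:R^-1 < e :> R.
  move=> e0; have := near_infty_natSinv_lt (PosNum e0).
  by move=> [N _ /(_ N (leqnn N))]; exists N.
have cF : ccont F.
  apply: ccont_from_unif => e e0; have e3 : 0 < e / 3 by rewrite divr_gt0.
  have [n nP] := small _ e3.
  apply: filterS (ccont_unif cG (partial_fourier_ccont (s n)) e3) => y H x.
  have -> : F (x + y) - F x = (F (x + y) - partial_fourier (s n) (x + y)) +
    (partial_fourier (s n) (x + y) - partial_fourier (s n) x) +
    (partial_fourier (s n) x - F x) by ring.
  apply: (le_trans (normcD _ _)).
  have h1 := Fn n (x + y); have h2 := H x; have h3 := Fn n x; rewrite normcB in h3.
  apply: (@le_trans _ _ ((e / 3 + e / 3) + e / 3)); last by lra.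
  apply: lerD; last by rewrite (le_trans h3) // ltW.
  by rewrite (le_trans (normcD _ _)) // lerD // (le_trans h1) // ltW.
have iF := ccont_cint mu cG cF; have [intf _] := wf.
have FE c : fourier mu F c = fourier mu f c.
  apply/eqP; rewrite -subr_eq0; apply/eqP/eq0_normc/eqP.
  rewrite eq_le normc_ge0 andbT; apply/ler_addgt0Pr => e e0; rewrite add0r.
  have e2 : 0 < e / 2 by rewrite divr_gt0.
  have [n nP] := small _ e2.
  have pc := partial_fourier_ccont (s n).
  have H1 : normc (fourier mu F c - fourier mu (partial_fourier (s n)) c) <= n.+1%:R^-1.
    have cc := char_ccont c.
    rewrite /fourier -cintegralB; last 2 first.
      by apply: (ccont_cint _ cG); apply: ccontM => //; exact: ccont_conj.
      by apply: (ccont_cint _ cG); apply: ccontM => //; exact: ccont_conj.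
    under eq_fun do rewrite -mulrBl.
    apply: normc_cintegral_bounded => [|x]; last by rewrite normcM normc_conj char_norm mulr1.
    apply: cmeasM; last by apply: ccont_cmeas; exact: ccont_conj.
    apply: ccont_cmeas; rewrite (_ : (fun x => _) = fun x => F x + (-1) * partial_fourier (s n) x).
      by apply: ccontD => //; apply: ccontM => //; exact: ccont_cst.
    by apply/funext => x; rewrite mulN1r.
  have H2 : normc (fourier mu (partial_fourier (s n)) c - fourier mu f c) <= n.+1%:R^-1.
    have -> : fourier mu (partial_fourier (s n)) c =
        \sum_(d <- s n) fourier mu f d * fourier mu d c.
      rewrite /fourier -/(fourier mu f) /partial_fourier.
      rewrite (_ : (fun x => _) = fun x => \sum_(d <- s n) fourier mu f d * (d x * (c x)^*)).
        have ii (d : character R G) : cintegrable mu (fun x : G => d x * (c x)^*).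
          exact: (ccont_cint _ cG (ccontM (char_ccont d) (ccont_conj (char_ccont c)))).
        rewrite cintegral_sum; last by move=> d _; exact: cintZ.
        by apply: eq_bigr => d _; rewrite cintegralZ.
      by apply/funext => x; rewrite mulr_suml; apply: eq_bigr => d _; rewrite mulrA.
    have [cs|cs] := boolP (c \in s n).
      rewrite (bigD1_seq c) //= char_normalized mulr1 big1 ?addr0 ?subrr ?normc_0 ?invr_ge0 ?ler0n //.
      by move=> d dc; rewrite char_orthogonal ?mulr0.
    rewrite big1_seq ?sub0r ?normc_opp.
      have := ts n [:: c] isT; rewrite big_seq1; apply => d.
      by rewrite inE => /eqP ->.
    by move=> d /andP[_ ds]; rewrite char_orthogonal ?mulr0 //; apply: contraNneq cs => <-.
  rewrite -[X in normc (X - _)](subrK (fourier mu (partial_fourier (s n)) c)) -addrA.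
  rewrite (le_trans (normcD _ _)) // [e]splitr.
  by apply: lerD; [apply: (le_trans H1)|apply: (le_trans H2)]; exact: ltW.
exists F; split => //.
- move=> x; apply/ler_addgt0Pr => e e0; have [n nP] := small _ e0.
  rewrite -[F x](subrK (partial_fourier (s n) x)) addrC (le_trans (normcD _ _)) // lerD //.
    exact: partial_fourier_le.
  by apply: (le_trans (Fn n x)); exact: ltW.
- pose g x := f x - F x.
  have ig : cintegrable mu g by exact: cintB.
  have g0 c : fourier mu g c = 0.
    rewrite /fourier /g; under eq_fun do rewrite mulrBl.
    have mc : cmeas (fun x : G => (c x)^*) by apply: ccont_cmeas; apply: ccont_conj; exact: char_ccont.
    have nc x : normc ((c x)^*) <= 1 by rewrite normc_conj char_norm.
    rewrite cintegralB; [|exact: cintM_bounded nc|exact: cintM_bounded nc].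
    by have := FE c; rewrite /fourier => ->; rewrite subrr.
  suff H k : ccont k -> cintegral mu (fun x => k x * g x) = 0.
    have orthr (k : G -> R) : continuous k -> RI mu (fun x => k x * Re (g x)) = 0 /\
        RI mu (fun x => k x * Im (g x)) = 0.
      move=> ck; have /H kg : ccont (fun x => (k x)%:C%C).
        by split => //= x; exact: cvg_cst.
      split; [have := congr1 (@complex.Re R) kg|have := congr1 (@complex.Im R) kg] => /= <-;
        congr Rintegral; apply/funext => x; rewrite ?Re_mulc ?Im_mulc /=; ring.
    have [igr igi] := ig.
    have r0 := continuous_orthogonal_ae0 cG hG haar igr (fun k ck => (orthr k ck).1).
    have i0 := continuous_orthogonal_ae0 cG hG haar igi (fun k ck => (orthr k ck).2).
    apply: (@filterS2 _ (almost_everywhere mu) _ _ _ _ _ r0 i0) => x rx ix.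
    by apply/eqP; rewrite -subr_eq0; apply/eqP; apply: complex_eqP.
  move=> ck.
  pose k' (x : G) := k (- x).
  have ck' : ccont k' by apply: ccont_comp => //; exact: opp_continuous.
  have -> : cintegral mu (fun x => k x * g x) = convol mu k' g 0.
    by congr cintegral; apply/funext => y; rewrite /k' sub0r opprK.
  apply: (continuous_fourier_unique cG haar (convol_ccont cG ck' ig)) => c.
  have cc := char_ccont c.
  have ccj : ccont (fun x => (c x)^*) := ccont_conj cc.
  have ccv : ccont (convol mu k' g) := convol_ccont cG ck' ig.
  set N := RI mu (fun y => normc (g y)).
  have N0 : 0 <= N by apply: RI_ge0 => x; exact: normc_ge0.
  set K := normc (fourier mu k' c).
  have K0 : 0 <= K by exact: normc_ge0.
  apply: eq0_normc; apply/eqP; rewrite eq_le normc_ge0 andbT.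
  apply/ler_addgt0Pr => e e0; rewrite add0r.
  have P0 : 0 < N * (1 + K) + 1 by rewrite ltr_wpDl // mulr_ge0 // addr_ge0.
  pose e1 := e / (N * (1 + K) + 1).
  have e10 : 0 < e1 by rewrite divr_gt0.
  have Un : nbhs (0 : G) [set y | (forall x, normc (k' (x - y) - k' x) <= e1) /\
      (forall x, normc ((c (x + y))^* - (c x)^*) <= e1)].
    apply: filterI; last exact: (ccont_unif cG ccj e10).
    have : nbhs (- (0 : G)) [set y | forall x, normc (k' (x + y) - k' x) <= e1].
      by rewrite oppr0; exact: ccont_unif.
    by move=> /opp_continuous.
  have [n [x [E [mE _ EU pE]]]] := @cells_in R G cG _ _ measurableT (ex_intro _ (0 : Borel G) I) Un.
  have gT y : ~ [set: Borel G] y -> g y = 0 by move=> /(_ I).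
  have [bk kb] := ccont_bounded cG ck'.
  (* The convolution is a uniform limit of combinations of translates of k', whose
     coefficient at c is that of k' times a Riemann sum for the one of g. *)
  pose S (y : G) : R[i] := \sum_(i < n) weight mu g (E i) * k' (y - x i).
  have cS : ccont S.
    apply: ccont_sum => i _; apply: ccontM; [exact: ccont_cst|exact: ccont_shiftr].
  have H1 y : normc (S y - convol mu k' g y) <= e1 * N.
    have cky : ccont (fun t => k' (y - t)) := sub_ccont y ck'.
    have := @riemann_sum _ _ mu setT n x E g (fun t => k' (y - t)) bk e1 mE pE gT ig
      (ccont_cmeas cky) (fun t => kb (y - t)).
    rewrite /convol (_ : (fun t => g t * _) = fun t => k' (y - t) * g t); last first.
      by apply/funext => t; rewrite mulrC.
    apply => i t /EU [/= h _]; have := h (y - x i).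
    by rewrite opprB addrA subrK.
  have H2 : normc (fourier mu S c - fourier mu (convol mu k' g) c) <= e1 * N.
    rewrite /fourier -cintegralB; last 2 first.
      by apply: (ccont_cint _ cG); exact: ccontM.
      by apply: (ccont_cint _ cG); exact: ccontM.
    under eq_fun do rewrite -mulrBl.
    apply: normc_cintegral_bounded => [|y]; last by rewrite normcM normc_conj char_norm mulr1.
    apply: ccont_cmeas; apply: ccontM => //.
    rewrite (_ : (fun x => _) = fun x => S x + (-1) * convol mu k' g x).
      by apply: ccontD => //; apply: ccontM => //; exact: ccont_cst.
    by apply/funext => y; rewrite mulN1r.
  have SE : fourier mu S c = (\sum_(i < n) weight mu g (E i) * (c (x i))^*) * fourier mu k' c.
    have ik i : cintegrable mu (fun y => k' (y - x i) * (c y)^*).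
      by apply: (ccont_cint _ cG); apply: ccontM => //; exact: ccont_shiftr.
    rewrite /fourier -/(fourier mu k' c) /S.
    rewrite (_ : (fun y => _) = fun y => \sum_(i < n) weight mu g (E i) * (k' (y - x i) * (c y)^*)).
      rewrite cintegral_sum; last by move=> i _; exact: cintZ.
      rewrite mulr_suml; apply: eq_bigr => i _; rewrite cintegralZ // -mulrA; congr (_ * _).
      rewrite -(cintegral_shift haar (x i)) // /fourier -cintegralZ; last first.
        by apply: (ccont_cint _ cG); exact: ccontM.
      congr cintegral; apply/funext => y.
      by rewrite charD rmorphM /= [x i + y]addrC addrK; ring.
    by apply/funext => y; rewrite mulr_suml; apply: eq_bigr => i _; rewrite mulrA.
  have H3 : normc (\sum_(i < n) weight mu g (E i) * (c (x i))^*) <= e1 * N.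
    have := @riemann_sum _ _ mu setT n x E g (fun t => (c t)^*) 1 e1 mE pE gT ig
      (ccont_cmeas ccj).
    rewrite -/(fourier mu g c) g0 subr0; apply => [y|i y /EU [/= _ h]].
      by rewrite normc_conj char_norm.
    by have := h (x i); rewrite [x i + _]addrC subrK.
  rewrite -[fourier mu (convol mu k' g) c](subrK (fourier mu S c)) (le_trans (normcD _ _)) //.
  apply: (@le_trans _ _ (e1 * N + e1 * N * K)).
    by apply: lerD; [rewrite normcB | rewrite SE normcM ler_wpM2r].
  have -> : e1 * N + e1 * N * K = e1 * (N * (1 + K)) by ring.
  by rewrite /e1 mulrAC ler_pdivrMr // ler_wpM2l ?(ltW e0) // lerDl.
- move=> e e0; have [n nP] := small _ e0; exists (s n); split => // x.
  by apply: (le_trans (Fn n x)); exact: ltW.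
Qed.

End fourier_inversion.

(** * Differentiation at the origin as a combination of evaluations *)

Section bernstein.
Variable R : realFieldType.

(** An n-th difference annihilates the polynomials of degree less than n. *)
Lemma finite_difference0 n k (a b : R) : (k < n)%N ->
  \sum_(r < n.+1) (-1) ^+ r * 'C(n, r)%:R * (a * r%:R + b) ^+ k = 0.
Proof.
elim: n k => // n IH k kn.
pose g (x : R) := x ^+ k.
have step : \sum_(r < n.+2) (-1) ^+ r * 'C(n.+1, r)%:R * g (a * r%:R + b) =
    \sum_(r < n.+1) (-1) ^+ r * 'C(n, r)%:R * (g (a * r%:R + b) - g (a * r%:R + b + a)).
  rewrite big_ord_recl /= bin0.
  under eq_bigr => r _ do rewrite /bump /= add1n binS natrD mulrDr mulrDl.
  rewrite big_split /= addrA.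
  have -> : (-1) ^+ 0 * 1 * g (a * 0 + b) +
      \sum_(i < n.+1) (-1) ^+ i.+1 * 'C(n, i.+1)%:R * g (a * i.+1%:R + b) =
      \sum_(i < n.+1) (-1) ^+ i * 'C(n, i)%:R * g (a * i%:R + b).
    rewrite big_ord_recr /= [X in _ + (_ + X)](_ : _ = 0); last first.
      by rewrite bin_small // mulr0 mul0r.
    rewrite addr0 [RHS]big_ord_recl /= bin0.
    by congr (_ + _).
  rewrite -big_split /=; apply: eq_bigr => r _.
  rewrite exprS -natr1 (_ : a * (r%:R + 1) + b = a * r%:R + b + a); last by ring.
  by ring.
rewrite -/g step {step} /g.
under eq_bigr => r _.
  rewrite (exprDn (a * r%:R + b) a) big_ord_recl /= subn0 expr0 mulr1 bin0 mulr1n opprD addrA subrr add0r.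
  rewrite -sumrN mulr_sumr; over.
rewrite exchange_big /= big1 // => i _.
transitivity (- (a ^+ i.+1 *+ 'C(k, i.+1)) *
   \sum_(r < n.+1) (-1) ^+ r * 'C(n, r)%:R * (a * r%:R + b) ^+ (k - i.+1)).
  rewrite mulr_sumr; apply: eq_bigr => r _; rewrite /bump /= add1n.
  move: ((-1) ^+ r * 'C(n, r)%:R) ((a * r%:R + b) ^+ _) => u v.
  by rewrite mulrN mulNr mulrnAr mulrnAl mulrA [a ^+ _ * _]mulrC.
rewrite IH ?mulr0 //; have := ltn_ord i; lia.
Qed.

Lemma alternating_ge (b : nat -> R) m : (forall j, 0 <= b j) ->
  (forall j, b j.+1 <= b j) -> (0 < m)%N ->
  b 0%N - b 1%N <= \sum_(j < m) (-1) ^+ j * b j.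
Proof.
move=> b0 bd; have gen n k : 0 <= \sum_(j < n) (-1) ^+ j * b (k + j)%N <= b k.
  elim: n k => [|n IH] k; first by rewrite big_ord0 lexx b0.
  rewrite big_ord_recl /= expr0 mul1r addn0.
  under eq_bigr => j _ do rewrite /bump /= add1n exprS mulN1r mulNr addnS -addSn.
  rewrite sumrN; have /andP[h1 h2] := IH k.+1.
  by rewrite subr_ge0 (le_trans h2) //= lerBlDr lerDl.
case: m => // -[|m] _.
  by rewrite big_ord1 expr0 mul1r lerBlDr lerDl.
rewrite big_ord_recl big_ord_recl /= expr0 expr1 mul1r mulN1r /bump /= addn0 addrA lerDl.
have /andP[h1 _] := gen m 2%N.
by under eq_bigr => j _ do rewrite /= !add1n -signr_odd /= negbK signr_odd -add2n.
Qed.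

Lemma sum_inv_odd_sqr m : \sum_(j < m) ((2 * j%:R + 1) ^+ 2)^-1 <= 2 :> R.
Proof.
case: m => [|m]; first by rewrite big_ord0.
suff : \sum_(j < m.+1) ((2 * j%:R + 1) ^+ 2)^-1 <= 2 - (m.+1%:R)^-1 :> R.
  by move=> /le_trans; apply; rewrite gerBl invr_ge0 ler0n.
elim: m => [|m IH]; first by rewrite big_ord1 mulr0 add0r expr1n invr1; lra.
rewrite big_ord_recr /= -[m.+2%:R]natr1; set x : R := m.+1%:R in IH *.
have x0 : 0 < x by rewrite ltr0n.
apply: (le_trans (lerD IH (lexx _))).
rewrite -subr_ge0.
have -> : 2 - (x + 1)^-1 - (2 - x^-1 + ((2 * x + 1) ^+ 2)^-1) =
   (3 * x ^+ 2 + 3 * x + 1) / (x * (x + 1) * (2 * x + 1) ^+ 2).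
  by field; apply/and3P; split; apply/eqP; lra.
by rewrite divr_ge0 ?mulr_ge0 ?addr_ge0 ?sqr_ge0 ?mulr_ge0 ?(ltW x0).
Qed.

(** Bernstein's inequality at the origin, in dual form. The nodes are the odd
    multiples of 1 / n, and dividing the weights of an n-th difference by the squares
    of the nodes kills all moments except the first. *)
Lemma derivative_at0_functional N : (0 < N)%N -> exists s : seq (R * R),
  [/\ forall p, p \in s -> `|p.2| <= 1,
      forall k, (k <= N)%N -> \sum_(p <- s) p.1 * p.2 ^+ k = (k == 1%N)%:R
    & \sum_(p <- s) `|p.1| <= 8 * N%:R].
Proof.
move=> N0; pose n := (N.*2.-1)%N.
have nE : n.+1 = (N + N)%N by rewrite /n addnn; lia.
pose x (j : nat) : R := 2 * j%:R + 1.
have x0 j : 0 < x j by rewrite ltr_wpDl // mulr_ge0.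
pose B (j : nat) : R := 'C(n, N + j)%:R.
pose b (j : nat) : R := B j / x j.
have Bd j : B j.+1 <= B j.
  rewrite ler_nat addnS -(leq_pmul2l (ltn0Sn (N + j))) mul_bin_left leq_mul2r.
  by apply/orP; right; rewrite /n; lia.
have B0 j : 0 <= B j by rewrite ler0n.
have Ble j : B j <= B 0%N by elim: j => // j IH; exact: le_trans (Bd j) IH.
have Bp : 0 < B 0%N by rewrite ltr0n addn0 bin_gt0; lia.
have xS j : x j <= x j.+1 by rewrite lerD2r ler_pM2l // ler_nat.
have bd j : b j.+1 <= b j.
  rewrite /b ler_pdivrMr // mulrAC ler_pdivlMr //.
  by apply: ler_pM => //; exact: ltW.
have b0 j : 0 <= b j by rewrite divr_ge0 // ltW.
pose S := \sum_(j < N) (-1) ^+ j * b j.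
have SB : B 0%N / 2 <= S.
  apply: le_trans (alternating_ge b0 bd N0).
  have -> : b 0%N = B 0%N by rewrite /b /x mulr0 add0r divr1.
  have : b 1%N <= B 0%N / 3.
    rewrite /b /x mulr1 (_ : 2 + 1 = 3 :> R); last by ring.
    by rewrite ler_pM2r ?invr_gt0.
  by move: Bp; move: (B 0%N) (b 1%N) => u v; lra.
have S0 : 0 < S by apply: lt_le_trans SB; rewrite divr_gt0.
have n0 : 0 < n%:R :> R by rewrite ltr0n; lia.
(* Opposite weights at opposite nodes kill the even moments; division by the square
   of the node reduces the odd moments from the third on to n-th differences of
   polynomials of degree at most N - 2. *)
pose c j : R := n%:R / (2 * S) * ((-1) ^+ j * B j / x j ^+ 2).
pose t j : R := x j / n%:R.
exists ([seq (c j, t j) | j <- index_iota 0 N] ++ [seq (- c j, - t j) | j <- index_iota 0 N]).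
split.
- have tb j : (j < N)%N -> `|t j| <= 1.
    move=> jN; rewrite ger0_norm ?divr_ge0 ?(ltW (x0 _)) // ler_pdivrMr // mul1r.
    by rewrite /x -natrM natr1 ler_nat /n; lia.
  move=> p; rewrite mem_cat => /orP[] /mapP[j]; rewrite mem_index_iota => jN -> /=.
    exact: tb.
  by rewrite normrN; exact: tb.
- move=> k kN; rewrite big_cat /= !big_map !big_mkord -big_split /=.
  have [odd_k|even_k] := boolP (odd k); last first.
    rewrite big1; first by case: (k =P 1%N) even_k => // ->.
    by move=> j _; rewrite exprNn -signr_odd (negbTE even_k) expr0; ring.
  have term (j : nat) : c j * t j ^+ k + - c j * (- t j) ^+ k = 2 * c j * t j ^+ k.
    by rewrite exprNn -signr_odd odd_k expr1; ring.
  under eq_bigr => j _ do rewrite term.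
  have [->|k1] := eqVneq k 1%N.
    transitivity (S^-1 * S); last by rewrite mulVf ?gt_eqF.
    rewrite {2}/S mulr_sumr; apply: eq_bigr => j _; rewrite /c /t /b.
    by field; rewrite !gt_eqF ?x0.
  have k3 : (2 <= k)%N by case: k odd_k k1 {kN term} => // -[].
  have kE : k = (k - 2).+2 by lia.
  pose q := (k - 2)%N.
  have odd_q : odd q by rewrite /q oddB // odd_k.
  have := @finite_difference0 n q 2 (- n%:R).
  rewrite nE big_split_ord /= => /(_ _) H.
  have {}H : \sum_(j < N) (-1) ^+ j * B j * x j ^+ q = 0.
    have qn : (q < n)%N by rewrite /q /n; lia.
    have {H} := H qn.
    rewrite [X in X + _](reindex_inj rev_ord_inj) /= -big_split /=.
    under eq_bigr => j _.
      have jN := ltn_ord j.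
      have e1 : 2 * (N - j.+1)%:R + - n%:R = - x j :> R.
        rewrite natrB // -[n%:R](addrK 1) natr1 nE natrD -natr1 /x; ring.
      have e2 : 2 * (N + j)%:R + - n%:R = x j :> R.
        rewrite natrD -[n%:R](addrK 1) natr1 nE natrD /x; ring.
      have e3 : 'C(n, N - j.+1) = 'C(n, N + j).
        rewrite -(@bin_sub n (N + j)); last by rewrite /n; lia.
        by congr binomial; rewrite /n; lia.
      have e4 : (-1) ^+ (N - j.+1) = - (-1) ^+ (N + j) :> R.
        rewrite -signr_odd -[in RHS]signr_odd -signrN; congr (_ ^+ _).
        rewrite (_ : odd (N + j) = ~~ odd (N - j.+1)) ?negbK //.
        by rewrite oddB // oddS oddD; case: (odd N); case: (odd j).
      rewrite e1 e2 e3 e4 [(- x j) ^+ q]exprNn -[(-1) ^+ q]signr_odd odd_q expr1.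
      rewrite (_ : _ + _ = 2 * (-1) ^+ N * ((-1) ^+ j * B j * x j ^+ q)); last first.
        by rewrite /B exprD; ring.
      over.
    rewrite -mulr_sumr => /eqP; rewrite mulf_eq0 mulf_eq0 signr_eq0 pnatr_eq0 /=.
    by move=> /eqP.
  transitivity (n%:R / S / n%:R ^+ k * \sum_(j < N) (-1) ^+ j * B j * x j ^+ q).
    rewrite mulr_sumr; apply: eq_bigr => j _; rewrite /c /t expr_div_n.
    have -> : x j ^+ k = x j ^+ 2 * x j ^+ q by rewrite -exprD /q; congr (_ ^+ _); lia.
    by field; rewrite !gt_eqF ?exprn_gt0 ?x0.
  by rewrite H mulr0.
rewrite big_cat /= !big_map !big_mkord /=.
under [X in _ + X]eq_bigr => j _ do rewrite normrN.
have cb j : `|c j| <= n%:R / (2 * S) * B 0%N * (x j ^+ 2)^-1.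
  rewrite !normrM normrX normrN1 expr1n mul1r !ger0_norm ?invr_ge0 ?sqr_ge0 ?divr_ge0 ?mulr_ge0 ?(ltW S0) //.
  by rewrite -!mulrA ler_wpM2l ?ler_wpM2l ?invr_ge0 ?mulr_ge0 ?(ltW S0) // ler_wpM2r ?invr_ge0 ?sqr_ge0.
have -> : forall u : R, u + u = 2 * u by move=> u; ring.
have H : \sum_(j < N) `|c j| <= n%:R / (2 * S) * B 0%N * 2.
  apply: (@le_trans _ _ (\sum_(j < N) n%:R / (2 * S) * B 0%N * (x j ^+ 2)^-1)).
    by apply: ler_sum => j _; exact: cb.
  rewrite -mulr_sumr ler_wpM2l //; last exact: sum_inv_odd_sqr.
  by rewrite mulr_ge0 ?divr_ge0 ?mulr_ge0 ?(ltW S0).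
apply: (@le_trans _ _ (2 * (n%:R / (2 * S) * B 0%N * 2))); first by rewrite ler_pM2l.
have -> : 2 * (n%:R / (2 * S) * B 0%N * 2) = 2 * n%:R * (B 0%N / S) by field; rewrite gt_eqF.
have BS : B 0%N / S <= 2 by rewrite ler_pdivrMr //; move: SB; lra.
apply: (@le_trans _ _ (2 * n%:R * 2)); first by rewrite ler_wpM2l ?mulr_ge0.
have : n%:R <= 2 * N%:R :> R by rewrite -natrM ler_nat /n; lia.
by move: (n%:R) (N%:R) => u v; lra.
Qed.
End bernstein.

(** * Words in unimodular letters *)

Section words.
Variables (R : realType) (n : nat).
Implicit Types (s : {ffun 'I_n -> 'I_3}) (z : 'I_n -> R[i]).

Local Notation words := {ffun 'I_n -> 'I_3}.

(** The letters 0, 1, 2 stand for the exponents 0, 1, -1. *)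
Definition letter (u : R[i]) (j : 'I_3) : R[i] :=
  if j == 0 then 1 else if j == 1 then u else u^*.

Definition word z s : R[i] := \prod_i letter (z i) (s i).

Definition wt s : nat := #|[pred i | s i != 0]|.

Definition single (i : 'I_n) (j : 'I_3) : {ffun 'I_n -> 'I_3} :=
  [ffun k => if k == i then j else 0].

Definition word0 : {ffun 'I_n -> 'I_3} := [ffun=> 0].

Lemma big3 (F : 'I_3 -> R[i]) : \sum_j F j = F 0 + F 1 + F 2.
Proof.
rewrite !big_ord_recl big_ord0 addr0 addrA.
by congr (F _ + F _ + F _); apply: val_inj.
Qed.

Lemma wt_prod s (r : R[i]) : \prod_i (if s i == 0 then 1 else r) = r ^+ wt s.
Proof.
rewrite /wt -prodr_const [RHS]big_mkcond; apply: eq_bigr => i _ /=.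
by rewrite inE; case: (s i == 0).
Qed.

(** Expanding the product chooses a letter at each place. *)
Lemma word_expansion (z w : 'I_n -> R[i]) (r : R[i]) :
  \sum_(s : words) r ^+ wt s * word w s * word z s =
  \prod_i (1 + r * (w i * z i) + r * (w i * z i)^*).
Proof.
transitivity (\sum_(s : words) \prod_i ((if s i == 0 then 1 else r) * letter (w i) (s i) * letter (z i) (s i))).
  by apply: eq_bigr => s _; rewrite !big_split /= wt_prod.
rewrite -(bigA_distr_bigA (fun i (j : 'I_3) => (if j == 0 then 1 else r) * letter (w i) j * letter (z i) j)).
apply: eq_bigr => i _; rewrite big3 /letter /= !mul1r rmorphM /=.
by rewrite !mulrA.
Qed.

Lemma normc_letter u j : normc u = 1 -> normc (letter u j) = 1.
Proof.
by rewrite /letter; case: ifP => _; [rewrite normc_1|case: ifP => // _; rewrite normc_conj].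
Qed.

Lemma normc_word z s : (forall i, normc (z i) = 1) -> normc (word z s) = 1.
Proof.
by move=> z1; rewrite normc_prod big1 // => i _; exact: normc_letter.
Qed.

Lemma sum_half_wt : \sum_(s : words) (2 : R)^-1 ^+ wt s = 2 ^+ n.
Proof.
apply: complexI; rewrite rmorph_sum /=.
transitivity (\sum_(s : words) (2^-1 : R)%:C%C ^+ wt s * word (fun=> 1) s * word (fun=> 1) s).
  apply: eq_bigr => s _; rewrite rmorphXn.
  have -> : word (fun=> 1) s = 1.
    by rewrite /word big1 // => i _; rewrite /letter rmorph1; do 2 case: ifP => //.
  by rewrite !mulr1.
rewrite word_expansion (eq_bigr (fun=> (2 : R)%:C%C)).
  by rewrite prodr_const card_ord -rmorphXn.
move=> i _; rewrite !mulr1 rmorph1 mulr1 -[X in X + _ + _](rmorph1 (real_complex R)).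
by rewrite -!rmorphD /=; congr (_%:C)%C; field.
Qed.

Lemma wt_word0 : wt word0 = 0%N.
Proof. by rewrite /wt eq_card0 // => i; rewrite inE ffunE eqxx. Qed.

Lemma word_word0 z : word z word0 = 1.
Proof. by rewrite /word big1 // => i _; rewrite ffunE. Qed.

Lemma word_single z i j : word z (single i j) = letter (z i) j.
Proof.
rewrite /word (bigD1 i) //= ffunE eqxx big1 ?mulr1 // => k ki.
by rewrite ffunE (negbTE ki).
Qed.

Lemma wt_single i j : j != 0 -> wt (single i j) = 1%N.
Proof.
move=> j0; rewrite /wt (fintype.eq_card1 (x := i)) // => k; rewrite !inE ffunE.
by have [_|_] := eqVneq k i; rewrite ?j0 ?eqxx.
Qed.

(** A word of weight one has a single nontrivial letter, which is 1 or 2. *)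
Lemma sum_wt1 (V : zmodType) (F : {ffun 'I_n -> 'I_3} -> V) :
  \sum_(s : words | wt s == 1%N) F s = \sum_i (F (single i 1) + F (single i 2)).
Proof.
have wt1P s i : (wt s == 1%N) && (s i != 0) = (s == single i 1) || (s == single i 2).
  apply/idP/idP => [/andP[/eqP w1 si]|/orP[/eqP ->|/eqP ->]]; last 2 first.
  - by rewrite wt_single // ffunE !eqxx.
  - by rewrite wt_single // ffunE !eqxx.
  have z k : k != i -> s k = 0.
    move=> ki; apply/eqP; rewrite -[_ == _]negbK; apply/negP => sk.
    have : (1 < wt s)%N.
      rewrite /wt (cardD1 i) inE si ltnS lt0n; apply/existsP; exists k.
      by rewrite !inE ki.
    by rewrite w1.
  have : (s i == 1) || (s i == 2).
    by move: si; case: (s i) => -[|[|[|//]]] H.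
  by case/orP => /eqP sij; apply/orP; [left|right]; apply/eqP/ffunP => k;
    rewrite ffunE; have [->|/z] := eqVneq k i.
transitivity (\sum_i \sum_(s : words | (wt s == 1%N) && (s i != 0)) F s).
  transitivity (\sum_(s : words | wt s == 1%N) \sum_(i | s i != 0) F s).
    by apply: eq_bigr => s /eqP w1; rewrite sumr_const (_ : #|_| = 1%N).
  by rewrite (exchange_big_dep predT).
apply: eq_bigr => i _; rewrite (eq_bigl _ _ (fun s => wt1P s i)).
rewrite (bigD1 (single i 1)) ?eqxx //=; congr (_ + _).
rewrite (big_pred1 (single i 2)) // => s /=.
have [->|] := eqVneq s (single i 1); last by rewrite /= andbT.
by rewrite andbF; apply/esym/negbTE/eqP => /ffunP /(_ i); rewrite !ffunE eqxx.
Qed.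

End words.

(** * Riesz products *)

Lemma Re_realM (R : realType) (r : R) (z : R[i]) : Re (r%:C%C * z) = r * Re z.
Proof. by rewrite Re_mulc /= mul0r subr0. Qed.

Section riesz.
Variables (R : realType) (G : topologicalZmodType) (n : nat).
Variable lam : 'I_n -> character R G.
Local Notation words := {ffun 'I_n -> 'I_3}.

Definition wordc (s : words) (x : G) : R[i] := word (fun i => lam i x) s.

(** Words are integrated against a measure h dmu: Phi, I_ and J stand for the
    integrals of word * f, of word, and for the modulus of the integral of
    word * c. The discrete probability P dominates the transform of the measure,
    and A, M are the norm of f in the Wiener algebra and its supremum on the
    support. *)
Variables (Phi I_ : words -> R[i]) (J : character R G -> words -> R).
Variables (P : seq (R * G)) (M A : R).

Definition rho (s : words) : R := Re (\sum_(p <- P) (p.1)%:C%C * wordc s p.2).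

Hypothesis P0 : forall p, p \in P -> 0 <= p.1.
Hypothesis P1 : \sum_(p <- P) p.1 = 1.
Hypothesis Hdis : forall s, s != word0 n -> rho s <= 2^-1 ^+ n.
Hypothesis HJ : forall c s, J c s <= Re (\sum_(p <- P) (p.1)%:C%C * (c p.2 * wordc s p.2)).
Hypothesis HI : forall s, normc (I_ s) <= rho s.
Hypothesis M0 : 0 <= M.
Hypothesis Hpos : forall c : words -> R[i], (forall x, 0 <= \sum_s c s * wordc s x) ->
  normc (\sum_s c s * Phi s) <= M * Re (\sum_s c s * I_ s).
Hypothesis Hwie : forall a : words -> R, (forall s, 0 <= a s) ->
  (forall c, \sum_s a s * J c s <= 2) -> \sum_s a s * normc (Phi s) <= 2 * A.

Local Notation hw s := ((2 : R)^-1 ^+ wt s).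

Let hw0 (s : words) : 0 <= hw s. Proof. by rewrite exprn_ge0 // invr_ge0. Qed.

(** The trivial word contributes 1, and the total weight of the others, at most 2 ^ n,
    is compensated by their small transforms. *)
Lemma sum_rho : \sum_(s : words) hw s * rho s <= 2.
Proof.
rewrite (bigD1 (word0 n)) //= wt_word0 expr0 mul1r.
have -> : rho (word0 n) = 1.
  rewrite /rho; under eq_bigr => p _ do rewrite /wordc word_word0 mulr1.
  by rewrite -(rmorph_sum (real_complex R)) P1.
rewrite (_ : 2 = 1 + 1 :> R) // lerD2l.
apply: (@le_trans _ _ (\sum_(s : words | s != word0 n) hw s * 2^-1 ^+ n)).
  by apply: ler_sum => s s0; rewrite ler_wpM2l ?hw0 //; exact: Hdis.
rewrite -mulr_suml; apply: (@le_trans _ _ ((\sum_(s : words) hw s) * 2^-1 ^+ n)).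
  rewrite ler_wpM2r ?exprn_ge0 ?invr_ge0 //.
  rewrite [leRHS](bigID (fun s : words => s != word0 n)) /= lerDl.
  by apply: sumr_ge0.
by rewrite sum_half_wt -exprMn divff ?expr1n // pnatr_eq0.
Qed.

(** Each factor 1 + t Re (w_i lam_i x) of the product is nonnegative. *)
Lemma riesz_product (w : 'I_n -> R[i]) (t : R) x : (forall i, normc (w i) = 1) -> `|t| <= 1 ->
  exists2 r : R, 0 <= r &
    \sum_(s : words) ((t / 2)%:C%C ^+ wt s * word w s) * wordc s x = r%:C%C.
Proof.
move=> w1 t1; exists (\prod_i (1 + t * Re (w i * lam i x))).
  apply: prodr_ge0 => i _; rewrite -lerBlDl sub0r lerNl.
  have : `|t * Re (w i * lam i x)| <= 1.
    rewrite normrM -[leRHS]mul1r ler_pM //.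
    by rewrite (le_trans (Re_le_normc _)) // normcM w1 char_norm mulr1.
  by rewrite ler_norml => /andP[h _]; rewrite lerNl.
rewrite word_expansion (rmorph_prod (real_complex R)); apply: eq_bigr => i _.
by apply: complex_eqP; rewrite ?Re_addc ?Im_addc ?Re_mulc ?Im_mulc ?Re_conjc ?Im_conjc /=
  ?Re_mulc ?Im_mulc; [field | ring].
Qed.

(** Nonnegativity of the Riesz product bounds each of its Fourier coefficients with
    respect to P by its mean. *)
Lemma sum_J c : \sum_(s : words) hw s * J c s <= 2.
Proof.
apply: le_trans sum_rho.
have E1 x : exists2 r : R, 0 <= r & \sum_(s : words) (hw s)%:C%C * wordc s x = r%:C%C.
  have [|] := @riesz_product (fun=> 1) 1 x (fun=> normc_1 R); first by rewrite normr1.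
  move=> r r0 E; exists r => //; rewrite -E; apply: eq_bigr => s _; congr (_ * _).
  rewrite mul1r rmorphXn (_ : word _ s = 1) ?mulr1 //.
  by rewrite /word big1 // => i _; rewrite /letter rmorph1; do 2 case: ifP => //.
have E2 (d : G -> R[i]) : \sum_(s : words) hw s * Re (\sum_(p <- P) (p.1)%:C%C * (d p.2 * wordc s p.2))
   = \sum_(p <- P) p.1 * Re (d p.2 * \sum_(s : words) (hw s)%:C%C * wordc s p.2).
  transitivity (\sum_(s : words) \sum_(p <- P) p.1 * (hw s * Re (d p.2 * wordc s p.2))).
    apply: eq_bigr => s _; rewrite Re_sumc mulr_sumr; apply: eq_bigr => p _.
    by rewrite Re_realM mulrCA.
  rewrite exchange_big /=; apply: eq_bigr => p _; rewrite -mulr_sumr; congr (_ * _).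
  rewrite mulr_sumr Re_sumc; apply: eq_bigr => s _.
  by rewrite mulrCA Re_realM.
apply: (@le_trans _ _ (\sum_(s : words) hw s *
    Re (\sum_(p <- P) (p.1)%:C%C * (c p.2 * wordc s p.2)))).
  by apply: ler_sum => s _; rewrite ler_wpM2l ?hw0.
have -> : \sum_(s : words) hw s * rho s =
   \sum_(s : words) hw s * Re (\sum_(p <- P) (p.1)%:C%C * (1 * wordc s p.2)).
  by apply: eq_bigr => s _; rewrite /rho; under [in RHS]eq_bigr do rewrite mul1r.
rewrite E2 (E2 (fun=> 1)) !big_seq; apply: ler_sum => p pP.
rewrite ler_wpM2l ?P0 // mul1r; have [r r0 ->] := E1 p.2.
rewrite (le_trans (ler_norm _)) // (le_trans (Re_le_normc _)) //.
by rewrite normcM char_norm mul1r normc_real ger0_norm.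
Qed.

Lemma sum_Phi : \sum_(s : words) hw s * normc (Phi s) <= 2 * A.
Proof. by apply: Hwie; [move=> s; exact: hw0 | exact: sum_J]. Qed.

(** The integral of f against the Riesz product with parameter t, a polynomial in t. *)
Definition phi_poly (w : 'I_n -> R[i]) (t : R) : R[i] :=
  \sum_(s : words) ((t / 2)%:C%C ^+ wt s * word w s) * Phi s.

Lemma phi_poly_le w t : (forall i, normc (w i) = 1) -> `|t| <= 1 ->
  normc (phi_poly w t) <= 2 * M.
Proof.
move=> w1 t1; apply: (le_trans (Hpos _)).
  by move=> x; have [r r0 ->] := riesz_product x w1 t1; rewrite ler0c.
rewrite mulrC ler_wpM2r //; apply: le_trans sum_rho.
rewrite (le_trans (ler_norm _)) // (le_trans (Re_le_normc _)) // (le_trans (normc_sum _ _ _)) //.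
apply: ler_sum => s _; rewrite !normcM normc_word // mulr1 normcX normc_real.
rewrite ler_pM ?exprn_ge0 ?normc_ge0 // lerXn2r ?nnegrE ?invr_ge0 //.
by rewrite normrM (@ger0_norm _ 2^-1) ?invr_ge0 // -[leRHS]mul1r ler_wpM2r ?invr_ge0.
Qed.

(** The polynomial is bounded by 2 M on [-1, 1], and the functional of degree N
    extracts its linear coefficient. Evaluating at half the nodes makes the terms of
    degree above N smaller by the factor 2 ^ N that compensates A. *)
Lemma linear_part_le N w : (0 < N)%N -> A <= 2 ^+ N * M -> (forall i, normc (w i) = 1) ->
  normc (\sum_(s : words | wt s == 1%N) word w s * Phi s) <= 128 * N%:R * M.
Proof.
move=> N0 AM w1; have [q [q1 qm qN]] := derivative_at0_functional R N0.
pose m k := \sum_(p <- q) p.1 * p.2 ^+ k.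
have mb k : `|m k| <= 8 * N%:R.
  apply: le_trans qN; apply: (le_trans (ler_norm_sum _ _ _)).
  rewrite !big_seq; apply: ler_sum => p pq; rewrite normrM normrX ler_piMr //.
  by rewrite exprn_ile1 // q1.
pose g k : R := 4^-1 ^+ k * m k.
have E : \sum_(p <- q) (p.1)%:C%C * phi_poly w (p.2 / 2) =
    \sum_(s : words) (g (wt s))%:C%C * (word w s * Phi s).
  rewrite /phi_poly; under eq_bigr do rewrite mulr_sumr.
  rewrite exchange_big /=; apply: eq_bigr => s _.
  rewrite /g /m mulr_sumr rmorph_sum /= mulr_suml; apply: eq_bigr => p _.
  rewrite -[in LHS]rmorphXn /= !mulrA -rmorphM; congr (_ %:C%C * _ * _).
  by rewrite [_ * p.1]mulrC -[RHS]mulrA -exprMn; congr (_ * _ ^+ _); field.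
have g1 : g 1%N = 4^-1 by rewrite /g /m expr1 qm ?mulr1.
have gs k : (k <= N)%N -> k != 1%N -> g k = 0.
  by move=> kN k1; rewrite /g /m qm // (negbTE k1) mulr0.
have gl k : (N < k)%N -> `|g k| <= 8 * N%:R * 2^-1 ^+ N * 2^-1 ^+ k.
  move=> Nk; rewrite normrM normrX ger0_norm ?invr_ge0 // mulrC -mulrA.
  rewrite ler_pM ?exprn_ge0 ?invr_ge0 //.
  have -> : (4 : R)^-1 = 2^-1 * 2^-1 by field.
  rewrite exprMn ler_wpM2r ?exprn_ge0 ?invr_ge0 //.
  by rewrite ler_wiXn2l ?invr_ge0 ?invf_le1 ?ler1n // ltnW.
have L : normc (\sum_(p <- q) (p.1)%:C%C * phi_poly w (p.2 / 2)) <= 8 * N%:R * (2 * M).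
  apply: (le_trans (normc_sum _ _ _)).
  apply: (@le_trans _ _ (\sum_(p <- q) `|p.1| * (2 * M))).
    rewrite !big_seq; apply: ler_sum => p pq; rewrite normcM normc_real ler_wpM2l //.
    apply: phi_poly_le => //; rewrite normrM (@ger0_norm _ 2^-1) ?invr_ge0 //.
    by rewrite ler_pdivrMr // mul1r (le_trans (q1 p pq)) // ler1n.
  by rewrite -mulr_suml ler_wpM2r ?mulr_ge0.
pose T := \sum_(s : words | wt s == 1%N) word w s * Phi s.
pose Err := \sum_(s : words | (wt s != 1%N)) (g (wt s))%:C%C * (word w s * Phi s).
have LE : \sum_(p <- q) (p.1)%:C%C * phi_poly w (p.2 / 2) = (4^-1)%:C%C * T + Err.
  rewrite E (bigID (fun s : words => wt s == 1%N)) /=; congr (_ + _).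
  by rewrite /T mulr_sumr; apply: eq_bigr => s /eqP ->; rewrite g1.
have Errb : normc Err <= 8 * N%:R * 2^-1 ^+ N * (2 * A).
  apply: (@le_trans _ _ (8 * N%:R * 2^-1 ^+ N * \sum_(s : words) hw s * normc (Phi s))); last first.
    by rewrite ler_wpM2l ?sum_Phi //; do ?apply: mulr_ge0; rewrite ?exprn_ge0 ?invr_ge0.
  apply: (le_trans (normc_sum _ _ _)); rewrite mulr_sumr big_mkcond /=.
  apply: ler_sum => s _; rewrite mulrA; case: ifPn => w_1; last first.
    by do ?apply: mulr_ge0; rewrite ?exprn_ge0 ?invr_ge0 ?normc_ge0.
  rewrite !normcM normc_word // ?mul1r ?mulr1 normc_real ?mulrA ler_wpM2r ?normc_ge0 //.
  have [sN|Ns] := leqP (wt s) N; last exact: gl.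
  by rewrite gs // normr0; do ?apply: mulr_ge0; rewrite ?exprn_ge0 ?invr_ge0.
have Errb2 : normc Err <= 8 * N%:R * (2 * M).
  apply: (le_trans Errb); rewrite -mulrA ler_wpM2l ?mulr_ge0 //.
  rewrite mulrCA ler_wpM2l //.
  have -> : M = 2^-1 ^+ N * (2 ^+ N * M) by rewrite mulrA -exprMn mulVf ?expr1n ?mul1r // pnatr_eq0.
  by rewrite ler_wpM2l ?exprn_ge0 ?invr_ge0.
have : normc ((4^-1)%:C%C * T) <= 32 * N%:R * M.
  rewrite -[_ * T](addrK Err) -LE (le_trans (normcD _ _)) // normc_opp.
  apply: (le_trans (lerD L Errb2)); rewrite le_eqVlt; apply/orP; left; apply/eqP; ring.
rewrite normcM normc_real ger0_norm ?invr_ge0 // -/T ler_pdivrMl //.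
by move=> /le_trans; apply; rewrite le_eqVlt; apply/orP; left; apply/eqP; ring.
Qed.

(** The phases w_i are chosen so that the coefficients at the conjugate letters become
    positive; the same bound for the phases multiplied by the imaginary unit removes
    the coefficients at the letters themselves. *)
Theorem riesz_bound N : (0 < N)%N -> A <= 2 ^+ N * M ->
  \sum_i normc (Phi (single i 2)) <= 128 * N%:R * M.
Proof.
move=> N0 AM.
have /choice[v vP] : forall i, exists v : R[i], normc v = 1 /\
    v * Phi (single i 2) = (normc (Phi (single i 2)))%:C%C.
  by move=> i; have [u u1 uE] := phaseP (Phi (single i 2)); exists u.
pose w i := (v i)^*.
pose I0 : R[i] := Complex 0 1.
have I1 : normc I0 = 1 by rewrite /= expr0n expr1n add0r sqrtr1.
have Ic : I0^* = - I0 by apply: complex_eqP; rewrite ?Re_conjc ?Im_conjc /= ?oppr0.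
have II : I0 * I0 = -1 by rewrite -expr2 sqr_i.
have w1 i : normc (w i) = 1 by rewrite normc_conj; case: (vP i).
have w2 i : normc (I0 * w i) = 1 by rewrite normcM I1 w1 mulr1.
have TE (z : 'I_n -> R[i]) : \sum_(s : words | wt s == 1%N) word z s * Phi s =
    \sum_i (z i * Phi (single i 1) + (z i)^* * Phi (single i 2)).
  by rewrite sum_wt1; apply: eq_bigr => i _; rewrite !word_single.
have H1 := linear_part_le N0 AM w1; have H2 := linear_part_le N0 AM w2.
have D : (\sum_(s : words | wt s == 1%N) word w s * Phi s) +
    I0 * (\sum_(s : words | wt s == 1%N) word (fun i => I0 * w i) s * Phi s) =
   ((2 : R) * \sum_i normc (Phi (single i 2)))%:C%C.
  rewrite !TE mulr_sumr -big_split /= rmorphM rmorph_sum /= mulr_sumr; apply: eq_bigr => i _.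
  have [_ <-] := vP i; rewrite rmorphM /= Ic /w conjCK.
  rewrite mulrDr !mulrA II !mulNr !mulrN II.
  rewrite (_ : (2 : R)%:C%C = 2); last by rewrite rmorph_nat.
  by ring.
have : normc ((2 * \sum_i normc (Phi (single i 2)))%:C%C : R[i]) <= 2 * (128 * N%:R * M).
  rewrite -D (le_trans (normcD _ _)) // normcM I1 mul1r.
  by apply: (le_trans (lerD H1 H2)); rewrite le_eqVlt; apply/orP; left; apply/eqP; ring.
rewrite normc_real ger0_norm ?ler_pM2l // mulr_ge0 // sumr_ge0 // => i _.
exact: normc_ge0.
Qed.

End riesz.

(** * Geometry of Bohr sets *)

Section bohr_geometry.
Variables (R : realType) (G : topologicalZmodType).
Implicit Types (gamma : character R G) (Gamma : {fset character R G}) (z w : R[i]).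

Lemma pi_le4 : pi <= 4 :> R.
Proof. by have [/andP[_ h] _] := @pihalf_02_cos_pihalf R; lra. Qed.

Lemma sin_le_id (x : R) : 0 <= x -> sin x <= x.
Proof.
rewrite le_eqVlt => /predU1P[<-|x0]; first by rewrite sin0.
have [|c _] := @MVT R (@sin R) (@cos R) 0 x x0 (fun y _ => is_derive_sin y).
  by apply: continuous_subspaceT => y; exact: continuous_sin.
by rewrite sin0 !subr0 => ->; rewrite ler_piMl ?(ltW x0) // cos_le1.
Qed.

Lemma Re_unit z : normc z = 1 -> -1 <= Re z <= 1.
Proof. by move=> z1; rewrite -ler_norml -z1 Re_le_normc. Qed.

Lemma acos_Re_bounds z : normc z = 1 ->
  [/\ 0 <= acos (Re z), acos (Re z) <= pi & cos (acos (Re z)) = Re z].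
Proof.
move=> z1; have b := Re_unit z1; split; [exact: acos_ge0|exact: acos_lepi|].
by rewrite acosK // in_itv.
Qed.

(** A chord is at most the arc it cuts off. *)
Lemma dist1_le_circle_norm z : normc z = 1 -> normc (1 - z) <= 2 * pi * circle_norm z.
Proof.
move=> z1; have [a0 api ac] := acos_Re_bounds z1.
rewrite circle_normE // mulrA mulfV ?mul1r; last by rewrite mulf_neq0 // gt_eqF // pi_gt0.
set a := acos _ in a0 api ac *.
rewrite -(@ler_pXn2r _ 2) ?nnegrE ?normc_ge0 //.
have -> : normc (1 - z) ^+ 2 = 2 - 2 * cos a.
  rewrite ac normcE2 Re_subc Im_subc /=.
  have : Re z ^+ 2 + Im z ^+ 2 = 1 by rewrite -normcE2 z1 expr1n.
  by move=> E; rewrite sub0r sqrrN sqrrB expr1n mul1r; move: E; move: (Re z ^+ 2) (Im z ^+ 2) => u v; lra.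
have -> : cos a = 1 - 2 * sin (a / 2) ^+ 2.
  have -> : cos a = cos (a / 2 *+ 2) by congr cos; rewrite mulr2n -splitr.
  by rewrite cos_mulr2n cos2sin2; ring.
have s0 : 0 <= sin (a / 2) by apply: sin_ge0_pi; lra.
have sa : sin (a / 2) <= a / 2 by apply: sin_le_id; lra.
have : sin (a / 2) ^+ 2 <= (a / 2) ^+ 2 by rewrite ler_pXn2r ?nnegrE //; lra.
by rewrite exprMn exprVn; move: (sin _ ^+ 2) (a ^+ 2) => u v; lra.
Qed.

(** As acos decreases, it suffices to compare cosines. The addition formula gives
    cos (a + b) <= Re (z w), because the sines of a and b are the moduli of the
    imaginary parts. *)
Lemma circle_normM z w : normc z = 1 -> normc w = 1 ->
  circle_norm (z * w) <= circle_norm z + circle_norm w.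
Proof.
move=> z1 w1; have zw1 : normc (z * w) = 1 by rewrite normcM z1 w1 mulr1.
rewrite !circle_normE // -mulrDr ler_wpM2l ?invr_ge0 ?mulr_ge0 ?pi_ge0 //.
have [a0 api ac] := acos_Re_bounds z1; have [b0 bpi bc] := acos_Re_bounds w1.
have [c0 cpi cc] := acos_Re_bounds zw1.
have [ab|ab] := leP pi (acos (Re z) + acos (Re w)); first exact: le_trans ab.
rewrite leNgt; apply/negP => lt.
have : cos (acos (Re (z * w))) < cos (acos (Re z) + acos (Re w)).
  by rewrite ltr_cos // in_itv /= ?c0 ?cpi ?addr_ge0 ?(ltW ab).
rewrite cc cosD ac bc Re_mulc ltrD2l ltrN2 => h.
have sE (v : R[i]) : normc v = 1 -> sin (acos (Re v)) = `|Im v|.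
  move=> v1; have [v0 vpi vc] := acos_Re_bounds v1.
  have s0 : 0 <= sin (acos (Re v)) by apply: sin_ge0_pi; rewrite v0 vpi.
  apply/eqP; rewrite -(@eqrXn2 _ 2) // sin2cos2 vc real_normK ?num_real //.
  by rewrite subr_eq addrC -normcE2 v1 expr1n.
move: h; rewrite (sE z z1) (sE w w1) ltNge => /negP; apply.
by rewrite -normrM ler_norm.
Qed.

Lemma circle_norm_conj z : normc z = 1 -> circle_norm z^* = circle_norm z.
Proof. by move=> z1; rewrite !circle_normE ?normc_conj // Re_conjc. Qed.

Lemma bohrD Gamma r s (x y : G) : bohr Gamma r x -> bohr Gamma s y ->
  bohr Gamma (r + s) (x + y : G).
Proof.
move=> xr ys gamma gG; rewrite charD.
apply: (le_trans (circle_normM (char_norm _ _) (char_norm _ _))).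
by apply: lerD; [exact: xr | exact: ys].
Qed.

Lemma bohrN Gamma r (x : G) : bohr Gamma r x -> bohr Gamma r (- x : G).
Proof. by move=> xr gamma gG; rewrite charN circle_norm_conj ?char_norm //; exact: xr. Qed.

Lemma bohr0 Gamma r : 0 <= r -> bohr Gamma r (0 : G).
Proof.
move=> r0 gamma _; rewrite char0 circle_normE ?normc_1 //=.
by rewrite acos1 mulr0.
Qed.

Lemma bohr_le Gamma r s (x : G) : r <= s -> bohr Gamma r x -> bohr Gamma s x.
Proof. by move=> rs xr gamma gG; exact: le_trans (xr _ gG) rs. Qed.

Lemma bohr_sub Gamma Gamma' r (x : G) : {subset Gamma <= Gamma'} ->
  bohr Gamma' r x -> bohr Gamma r x.
Proof. by move=> sG xr gamma gG; apply: xr; exact: sG. Qed.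

Definition char_one : character R G :=
  @Character R G (fun=> 1) (fun=> normc_1 R) (fun _ _ => esym (mulr1 1))
    (fun x => @cvg_cst _ (1 : R[i]^o) _ _ _).

Fact char_mul_norm c d (x : G) : normc ((c : character R G) x * (d : character R G) x) = 1.
Proof. by rewrite normcM !char_norm mulr1. Qed.
Fact char_mulD c d (x y : G) : (c : character R G) (x + y) * (d : character R G) (x + y) =
  c x * d x * (c y * d y).
Proof. by rewrite !charD; ring. Qed.
Fact char_mul_continuous c d :
  continuous ((fun x => (c : character R G) x * (d : character R G) x) : G -> R[i]^o).
Proof. by move=> x; apply: cvgM; exact: char_continuous. Qed.
Definition char_mul c d : character R G :=
  Character (char_mul_norm c d) (char_mulD c d) (@char_mul_continuous c d).

End bohr_geometry.

(** * Integration over a Bohr set *)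

Section cutoff.
Variables (R : realType) (G : topologicalZmodType).
Variable mu : probability (Borel G) R.
Variables (Gamma : {fset character R G}) (delta : R).

Let B : set (Borel G) := bohr Gamma delta.
Let mB : measurable B := measurable_bohr Gamma delta.
Let m : R := fine (mu B).
Let beta := bohr_cutoff mu Gamma delta.
Hypothesis m0 : m != 0.

Lemma bohr_mass_gt0 : 0 < m.
Proof. by rewrite lt0r m0 fine_ge0. Qed.

Lemma cutoffE (A : set (Borel G)) : measurable A -> beta A = ((fine (mu (A `&` B))) / m)%:E.
Proof.
move=> mA; have mAB : measurable (A `&` B) by exact: measurableI.
have E : mu B = m%:E := fine_mu_fin mu mB.
rewrite /beta /bohr_cutoff /= /mnormalize /= /mrestr /= setTI -/B E ifF.
  by rewrite EFinM -(fine_mu_fin mu mAB).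
by rewrite eqe (negbTE m0).
Qed.

Lemma ge0_integral_cutoff (f : Borel G -> \bar R) : measurable_fun setT f ->
  (forall x, (0 <= f x)%E) ->
  (\int[beta]_x f x = m^-1%:E * \int[mu]_(x in B) f x)%E.
Proof.
move=> mf f0; have mN : measurable (~` B) by exact: measurableC.
have bN : beta (~` B) = 0 by rewrite cutoffE // setICl measure0 mul0r.
rewrite (ge0_negligible_integral mN measurableT mf _ bN) //.
rewrite setTD setCK.
have i0 : 0 <= m^-1 by rewrite invr_ge0 ltW // bohr_mass_gt0.
rewrite (eq_measure_integral (mscale (NngNum i0) mu)); last first.
  move=> A mA AB; rewrite /mscale /= cutoffE // setIidl // EFinM muleC.
  by rewrite -(fine_mu_fin mu mA).
by rewrite ge0_integral_mscale //; exact: measurable_funTS.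
Qed.

Lemma RI_cutoff (u : G -> R) : rint mu u ->
  rint beta u /\ RI beta u = m^-1 * RI mu (fun x => \1_B x * u x).
Proof.
move=> iu; have mu_ := rint_meas iu.
have mEu : measurable_fun setT (fun x : Borel G => (u x)%:E) by apply/measurable_EFinP.
have iB : mu.-integrable B (fun x : Borel G => (u x)%:E).
  exact: integrableS iu.
have fin (g : Borel G -> \bar R) : measurable_fun setT g -> (forall x, (0 <= g x)%E) ->
   (forall x : Borel G, (g x <= `|(u x)%:E|)%E) -> (\int[mu]_(x in B) g x < +oo)%E.
  move=> mg g0 gu; have /integrableP[_] := iB; apply: le_lt_trans.
  apply: ge0_le_integral => //.
  - exact: measurable_funTS.
  - by apply: measurable_funTS; exact: measurableT_comp.
have mabs : measurable_fun setT (fun x : Borel G => `|(u x)%:E|%E) by exact: measurableT_comp.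
split.
  apply/integrableP; split => //; rewrite ge0_integral_cutoff //.
  have h : (\int[mu]_(x in B) `|(u x)%:E| < +oo)%E by exact: fin.
  have p0 : (0 <= \int[mu]_(x in B) `|(u x)%:E|)%E by apply: integral_ge0.
  by rewrite -[X in (_ * X)%E]fineK ?ge0_fin_numE // -EFinM ltry.
have -> : RI mu (fun x => \1_B x * u x) = fine (\int[mu]_(x in B) (u x)%:E)%E.
  rewrite /RI -[RHS]/(Rintegral mu B u) [RHS]Rintegral_mkcond; congr Rintegral; apply/funext => x.
  by rewrite patchE indicE; case: ifPn; rewrite ?mul1r ?mul0r.
have mp := measurable_funepos mEu; have mn := measurable_funeneg mEu.
pose p := (\int[mu]_(x in B) (fun x : Borel G => (u x)%:E)^\+ x)%E.
pose q := (\int[mu]_(x in B) (fun x : Borel G => (u x)%:E)^\- x)%E.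
have pf : p \is a fin_num.
  rewrite ge0_fin_numE; last by apply: integral_ge0.
  by apply: fin => // x; rewrite funeposE ge_max lee_abs abse_ge0.
have qf : q \is a fin_num.
  rewrite ge0_fin_numE; last by apply: integral_ge0.
  by apply: fin => // x; rewrite funenegE ge_max abse_ge0 andbT -abseN lee_abs.
have -> : RI beta u = fine (m^-1%:E * p - m^-1%:E * q)%E.
  by rewrite /RI /Rintegral integralE !ge0_integral_cutoff.
have -> : (\int[mu]_(x in B) (u x)%:E = p - q)%E by rewrite integralE.
by rewrite -(fineK pf) -(fineK qf) -!EFinM -!EFinB /= mulrBr.
Qed.

Lemma cintegral_cutoff (f : G -> R[i]) : cintegrable mu f ->
  cintegral beta f = (m^-1)%:C%C * cintegral mu (fun x => (\1_B x)%:C%C * f x).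
Proof.
move=> [fr fi]; have [_ er] := RI_cutoff fr; have [_ ei] := RI_cutoff fi.
apply: complex_eqP; rewrite ?Re_mulc ?Im_mulc /= !mul0r ?subr0 ?addr0.
  rewrite -[LHS]/(RI beta (fun x => Re (f x))) er; congr (_ * _); congr RI.
  by apply/funext => x; rewrite Re_mulc /= mul0r subr0.
rewrite -[LHS]/(RI beta (fun x => Im (f x))) ei; congr (_ * _); congr RI.
by apply/funext => x; rewrite Im_mulc /= mul0r addr0.
Qed.

Lemma ae_cutoff (Q : G -> Prop) : (\forall x \ae beta, Q x) ->
  \forall x \ae mu, B x -> Q x.
Proof.
move=> [N [mN bN NQ]]; exists (N `&` B); split; first exact: measurableI.
  have mNB : measurable (N `&` B) by exact: measurableI.
  move: bN; rewrite cutoffE // (fine_mu_fin mu mNB) => -[] /eqP.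
  by rewrite mulf_eq0 invr_eq0 (negbTE m0) orbF => /eqP ->.
move=> x /= nQ; have [Bx|nB] := pselect (B x); last by exfalso; apply: nQ.
by split => //; apply: NQ => /= Qx; apply: nQ.
Qed.

Lemma cutoff_ae (Q : G -> Prop) : (\forall x \ae mu, Q x) -> \forall x \ae beta, Q x.
Proof.
move=> [N [mN mN0 NQ]]; exists N; split => //.
have mNB : measurable (N `&` B) by exact: measurableI.
rewrite cutoffE // (_ : mu (N `&` B) = 0) ?mul0r //.
by apply/eqP; rewrite eq_le measure_ge0 andbT -mN0 le_measure ?inE.
Qed.

End cutoff.

(** * Functionals on the Wiener algebra *)

Section wiener_functional.
Variables (R : realType) (G : topologicalZmodType).
Variable mu : probability (Borel G) R.

Lemma cintegral_ae f g : cintegrable mu f -> cintegrable mu g ->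
  (\forall x \ae mu, f x = g x) -> cintegral mu f = cintegral mu g.
Proof.
move=> [fr fi] [gr gi] fg; apply: complex_eqP; rewrite /= /Rintegral; congr fine.
  apply: ae_eq_integral => //; [exact: (measurable_int _ fr)|exact: (measurable_int _ gr)|].
  by apply: (@filterS _ (almost_everywhere mu) _ _ _ _ fg) => x -> _.
apply: ae_eq_integral => //; [exact: (measurable_int _ fi)|exact: (measurable_int _ gi)|].
by apply: (@filterS _ (almost_everywhere mu) _ _ _ _ fg) => x -> _.
Qed.

Hypothesis cG : compact [set: G].
Hypothesis hG : hausdorff_space G.
Hypothesis haar : haar_measure mu.
Variable f : G -> R[i].
Hypothesis wf : wiener_algebra mu f.
Let A : R := fine (wiener_norm mu f).

(** By Fourier inversion f is a superposition of characters of total mass A up to a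
    null set, so a bound valid for characters passes to f with the factor A. *)
Lemma wiener_functional (I : finType) (u : I -> G -> R[i]) (a : I -> R) b K :
  0 <= b -> (forall i, cmeas (u i)) -> (forall i x, normc (u i x) <= b) ->
  (forall i, 0 <= a i) ->
  (forall c : character R G, \sum_i a i * normc (cintegral mu (fun x => c x * u i x)) <= K) ->
  \sum_i a i * normc (cintegral mu (fun x => f x * u i x)) <= A * K.
Proof.
move=> b0 mu_ ub a0 H; have [F [cF FA fF Fs]] := fourier_inversion cG hG haar wf.
have [intf _] := wf; have iF := ccont_cint mu cG cF.
have K0 : 0 <= K.
  apply: le_trans (H (char_one R G)); apply: sumr_ge0 => i _.
  by rewrite mulr_ge0 ?normc_ge0.
set T := \sum_i a i; have T0 : 0 <= T by apply: sumr_ge0.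
have icu (h : G -> R[i]) i : cintegrable mu h -> cintegrable mu (fun x => h x * u i x).
  by move=> ih; apply: (cintM_bounded ih (mu_ i) (ub i)).
rewrite (eq_bigr (fun i => a i * normc (cintegral mu (fun x => F x * u i x)))); last first.
  move=> i _; congr (_ * normc _); apply: cintegral_ae; [exact: icu|exact: icu|].
  by apply: (@filterS _ (almost_everywhere mu) _ _ _ _ fF) => x ->.
apply/ler_addgt0Pr => e e0.
have P0 : 0 < T * b + 1 by rewrite ltr_wpDl // mulr_ge0.
have d0 : 0 < e / (T * b + 1) by rewrite divr_gt0.
have [s [us Fp]] := Fs _ d0; set d := e / (T * b + 1) in d0 Fp.
set p := partial_fourier mu f s in Fp.
have cp : ccont p := partial_fourier_ccont mu f s.
have ip := ccont_cint mu cG cp.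
have step i : normc (cintegral mu (fun x => F x * u i x)) <=
    normc (cintegral mu (fun x => p x * u i x)) + d * b.
  rewrite -[cintegral mu (fun x => F x * u i x)](subrK (cintegral mu (fun x => p x * u i x))).
  rewrite addrC (le_trans (normcD _ _)) // lerD2l -cintegralB; [|exact: icu|exact: icu].
  apply: normc_cintegral_bounded => [|x].
    by apply: (@cint_meas _ _ mu); apply: cintB; exact: icu.
  by rewrite -mulrBl normcM ler_pM ?normc_ge0.
apply: (@le_trans _ _ (\sum_i a i * (normc (cintegral mu (fun x => p x * u i x)) + d * b))).
  by apply: ler_sum => i _; rewrite ler_wpM2l.
under eq_bigr do rewrite mulrDr.
rewrite big_split -mulr_suml -/T; apply: lerD; last first.
  have -> : T * (d * b) = e * (T * b / (T * b + 1)) by rewrite /d; ring.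
  by rewrite ler_piMr ?(ltW e0) // ler_pdivrMr // mul1r lerDl.
apply: (@le_trans _ _ (\sum_i \sum_(c <- s) normc (fourier mu f c) *
    (a i * normc (cintegral mu (fun x => (c : character R G) x * u i x))))).
  apply: ler_sum => i _.
  have -> : cintegral mu (fun x => p x * u i x) =
      \sum_(c <- s) fourier mu f c * cintegral mu (fun x => (c : character R G) x * u i x).
    have ic (c : character R G) : cintegrable mu (fun x : G => c x * u i x).
      exact: (icu _ i (char_cint mu cG c)).
    under eq_bigr do rewrite -cintegralZ //.
    rewrite -cintegral_sum; last by move=> c _; exact: cintZ.
    congr cintegral; apply/funext => x; rewrite /p /partial_fourier mulr_suml.
    by apply: eq_bigr => c _; rewrite mulrA.
  apply: (le_trans (ler_wpM2l (a0 i) (normc_sum _ _ _))).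
  rewrite mulr_sumr; apply: ler_sum => c _; rewrite normcM.
  by rewrite le_eqVlt; apply/orP; left; apply/eqP; ring.
rewrite exchange_big.
apply: (@le_trans _ _ (\sum_(c <- s) normc (fourier mu f c) * K)).
  by apply: ler_sum => c _; rewrite -mulr_sumr ler_wpM2l ?normc_ge0.
by rewrite -mulr_suml ler_wpM2r // wiener_sum_le.
Qed.

Variables (Gamma : {fset character R G}) (delta : R).
Let B : set (Borel G) := bohr Gamma delta.
Let beta := bohr_cutoff mu Gamma delta.
Hypothesis m0 : fine (mu B) != 0.
Hypothesis M0 : Linfty_norm beta f != 0%E.
Let M : R := fine (Linfty_norm beta f).

(** The continuous representative of f is bounded by A everywhere. *)
Lemma Linfty_norm_cutoff :
  [/\ 0 < M, M <= A & \forall x \ae mu, B x -> normc (f x) <= M].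
Proof.
have [F [_ FA fF _]] := fourier_inversion cG hG haar wf.
have bT : (0 < beta [set: Borel G])%E.
  by have -> : beta [set: Borel G] = 1%E by exact: probability_setT.
have le : (Linfty_norm beta f <= A%:E)%E.
  apply/ess_supP; have bF := cutoff_ae m0 fF.
  by apply: (@filterS _ (almost_everywhere beta) _ _ _ _ bF) => x ->; rewrite lee_fin; exact: FA.
have ge : (0 <= Linfty_norm beta f)%E.
  by apply: ess_sup_gee => //; apply: nearW => x; rewrite lee_fin normc_ge0.
have E : Linfty_norm beta f = M%:E.
  by rewrite fineK // ge0_fin_numE // (le_lt_trans le) ?ltry.
split.
- by move: ge M0; rewrite E lee_fin eqe lt_neqAle eq_sym => -> ->.
- by move: le; rewrite E lee_fin.
apply: (ae_cutoff m0); have := ess_sup_ge beta (fun x : Borel G => (normc (f x))%:E).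
rewrite -[ess_sup _ _]/(Linfty_norm beta f) E => bM.
by apply: (@filterS _ (almost_everywhere beta) _ _ _ _ bM) => x; rewrite lee_fin.
Qed.

End wiener_functional.

(** * Means of characters over a regular Bohr set *)

Section bohr_mean.
Variables (R : realType) (G : topologicalZmodType).
Variable mu : probability (Borel G) R.
Variable Gamma : {fset character R G}.

Definition bohr_mean r (c : G -> R[i]) : R[i] := cintegral (bohr_cutoff mu Gamma r) c.

Local Notation mass r := (fine (mu (bohr Gamma r : set (Borel G)))).
Local Notation ind r := (\1_(bohr Gamma r : set (Borel G)) : Borel G -> R).

Lemma RI_indic (A : set (Borel G)) : measurable A ->
  rint mu (\1_A : Borel G -> R) /\ RI mu (\1_A : Borel G -> R) = fine (mu A).
Proof.
move=> mA; split.
  apply: (@rint_bounded _ _ mu _ 1); first exact: measurable_indic.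
  by move=> x; rewrite indicE; case: (_ \in _) => /=; rewrite ?normr1 ?normr0.
by rewrite /RI /Rintegral; congr fine; rewrite integral_indic // setIT.
Qed.

Lemma mass_le r s : r <= s -> mass r <= mass s.
Proof.
move=> rs; rewrite -lee_fin -!fine_mu_fin; try exact: measurable_bohr.
apply: le_measure; rewrite ?inE; try exact: measurable_bohr.
by move=> x; exact: bohr_le.
Qed.

Variables (cR CR r : R).
Hypothesis cR0 : 0 < cR.
Hypothesis reg : regular_bohr cR CR mu Gamma r.
Local Notation d := (#|` Gamma|%:R : R).

(** Otherwise the regularity inequality for the dilation 0 would read |0 / 0 - 1| <= 0,
    where 0 / 0 = 0. *)
Lemma regular_mass_neq0 : mass r != 0.
Proof.
apply/eqP => m0; have := reg (kappa := 0).
rewrite normr0 !(mul0r, mulr0) addr0 mul1r m0 invr0 mulr0 sub0r normrN normr1.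
by move=> /(_ (ltW cR0)); rewrite ler10.
Qed.

Lemma regular_mass_gt0 : 0 < mass r.
Proof. exact: (bohr_mass_gt0 regular_mass_neq0). Qed.

Lemma regular_mass_diff kappa : `|kappa| * d <= cR ->
  `|mass ((1 + kappa) * r) - mass r| <= CR * `|kappa| * d * mass r.
Proof.
move=> /reg h; have m0 := regular_mass_gt0.
rewrite -ler_pdivrMr // -[X in _ / X](gtr0_norm m0) -normf_div mulrBl divff //.
by rewrite gt_eqF.
Qed.

Hypothesis r0 : 0 <= r.
Hypothesis cG : compact [set: G].
Hypothesis haar : haar_measure mu.

(** Multiplying the mean by 1 - c x compares the Bohr set with its translate by x, and
    the two differ only in the shell between the widths (1 - kappa) r and
    (1 + kappa) r. *)
Lemma char_dist1_bohr_mean (c : character R G) kappa x : 0 <= kappa -> kappa * d <= cR ->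
  bohr Gamma (kappa * r) x ->
  normc (1 - c x) * normc (bohr_mean r c) <= 2 * CR * kappa * d.
Proof.
move=> k0 kd Bx; have m0 := regular_mass_neq0.
have ic := char_cint mu cG c.
rewrite /bohr_mean (cintegral_cutoff m0 ic) normcM normc_real.
have mgt := regular_mass_gt0.
rewrite (ger0_norm (ltW _)) ?invr_gt0 // mulrCA ler_pdivrMl // -normcM.
have mr s : measurable (bohr Gamma s : set (Borel G)) by exact: measurable_bohr.
have id s : cintegrable mu (fun y => (ind s y)%:C%C * c y).
  have := cint_indic (mr s) ic; congr cintegrable; apply/funext => y; exact: mulrC.
have ids : cintegrable mu (fun y => (ind r (- x + y : G))%:C%C * c y).
  have := cint_shift haar (- x) (cintZ (c x) (id r)).
  congr cintegrable; apply/funext => y.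
  rewrite mulrCA -charD addrA subrr add0r.
  by [].
have -> : (1 - c x) * cintegral mu (fun y => (ind r y)%:C%C * c y) =
    cintegral mu (fun y => (ind r y)%:C%C * c y - (ind r (- x + y : G))%:C%C * c y).
  rewrite cintegralB // mulrBl mul1r; congr (_ - _).
  rewrite -cintegralZ // -(cintegral_shift haar (- x)); last exact: cintZ.
  congr cintegral; apply/funext => y.
  by rewrite mulrCA -charD addrA subrr add0r.
have [ip pE] := RI_indic (mr ((1 + kappa) * r)).
have [im mE] := RI_indic (mr ((1 - kappa) * r)).
apply: (@le_trans _ _ (RI mu (fun y => ind ((1 + kappa) * r) y - ind ((1 - kappa) * r) y))).
  apply: normc_cintegral_le; [exact: cintB|exact: rintB|].
  move=> y; rewrite -mulrBl normcM char_norm mulr1 -(rmorphB (real_complex R)) normc_real.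
  have kr : 0 <= kappa * r by rewrite mulr_ge0.
  have Bx' := bohrN Bx.
  rewrite !indicE.
  have ap : y \in bohr Gamma r -> y \in bohr Gamma ((1 + kappa) * r).
    by rewrite !inE; apply: bohr_le; lra.
  have bp : (- x + y : G) \in bohr Gamma r -> y \in bohr Gamma ((1 + kappa) * r).
    by rewrite !inE => h; have := bohrD Bx h; rewrite addNKr mulrDl mul1r addrC.
  have qa : y \in bohr Gamma ((1 - kappa) * r) -> y \in bohr Gamma r.
    by rewrite !inE; apply: bohr_le; lra.
  have qb : y \in bohr Gamma ((1 - kappa) * r) -> (- x + y : G) \in bohr Gamma r.
    by rewrite !inE => h; have := bohrD Bx' h; apply: bohr_le; lra.
  move: ap bp qa qb; do 4!case: (_ \in _) => /=; move=> ap bp qa qb;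
    rewrite ?(subrr, subr0, sub0r, normrN, normr0, normr1) //;
    by [have := ap isT|have := bp isT|have := qa isT|have := qb isT].
rewrite RIB // pE mE.
have := regular_mass_diff (kappa := kappa); rewrite ger0_norm // => /(_ kd) h1.
have := regular_mass_diff (kappa := - kappa); rewrite normrN ger0_norm // => /(_ kd) h2.
move: h1 h2; rewrite !ler_norml => /andP[_ h1] /andP[h2 _].
by lra.
Qed.

End bohr_mean.

(** * Discrete measures on a Bohr set *)

Section word_characters.
Variables (R : realType) (G : topologicalZmodType).
Implicit Types (c : character R G).

Fact char_inv_norm c (x : G) : normc (c (- x)) = 1. Proof. exact: char_norm. Qed.
Fact char_invD c (x y : G) : c (- (x + y)) = c (- x) * c (- y).
Proof. by rewrite opprD charD. Qed.
Fact char_inv_continuous c : continuous ((fun x => c (- x)) : G -> R[i]^o).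
Proof.
move=> x; apply: (@continuous_comp _ _ _ (-%R : G -> G) (c : G -> R[i]^o)).
  exact: opp_continuous.
exact: char_continuous.
Qed.
Definition char_inv c : character R G :=
  Character (char_inv_norm c) (char_invD c) (@char_inv_continuous c).

Definition char_letter c (j : 'I_3) : character R G :=
  if j == 0 then char_one R G else if j == 1 then c else char_inv c.

Definition char_prod (cs : seq (character R G)) : character R G :=
  foldr (@char_mul R G) (char_one R G) cs.

Lemma char_prodE cs x : char_prod cs x = \prod_(c <- cs) c x.
Proof. by elim: cs => [|c cs IH]; rewrite ?big_nil // big_cons -IH. Qed.

Variables (n : nat) (lam : 'I_n -> character R G).

Definition char_word (s : {ffun 'I_n -> 'I_3}) : character R G :=
  char_prod [seq char_letter (lam i) (s i) | i <- index_enum 'I_n].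

Lemma char_wordE s x : char_word s x = wordc lam s x.
Proof.
rewrite char_prodE big_map; apply: eq_bigr => i _.
rewrite /char_letter /letter; case: ifP => // _; case: ifP => // _.
by rewrite -charN.
Qed.

End word_characters.

Section weighted_points.
Variables (R : realType) (G : topologicalZmodType).
Implicit Types (P Q : seq (R * G)) (c : character R G).

(** A list of pairs of a mass and a point encodes a discrete measure; this is its
    transform at c. *)
Definition phat P (c : G -> R[i]) : R[i] := \sum_(p <- P) (p.1)%:C%C * c p.2.

Definition pweights (B : set G) P :=
  [/\ forall p, p \in P -> 0 <= p.1, \sum_(p <- P) p.1 = 1 & forall p, p \in P -> B p.2].

(** The transform becomes the real part of that of P, because reflecting a measure
    conjugates its transform. *)
Definition psym P : seq (R * G) :=
  [seq (p.1 / 2, p.2) | p <- P] ++ [seq (p.1 / 2, - p.2) | p <- P].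

Lemma psym_weights (B : set G) P : (forall x, B x -> B (- x)) ->
  pweights B P -> pweights B (psym P).
Proof.
move=> BN [P0 P1 PB]; split.
- by move=> p; rewrite mem_cat => /orP[] /mapP[q /P0 q0 ->] /=; rewrite divr_ge0.
- rewrite big_cat !big_map /= -mulr_suml P1; lra.
- move=> p; rewrite mem_cat => /orP[] /mapP[q /PB qB ->] //=; exact: BN.
Qed.

Lemma phat_psym P c : phat (psym P) c = (Re (phat P c))%:C%C.
Proof.
rewrite /phat big_cat !big_map /= -big_split /= Re_sumc rmorph_sum /=.
apply: eq_bigr => p _; rewrite charN.
by apply: complex_eqP; rewrite ?(Re_addc, Im_addc, Re_mulc, Im_mulc, Re_conjc, Im_conjc) /=; lra.
Qed.

Definition pconv P Q : seq (R * G) := [seq (p.1 * q.1, p.2 + q.2) | p <- P, q <- Q].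

Lemma big_pconv (V : nmodType) P Q (F : R * G -> V) :
  \sum_(r <- pconv P Q) F r = \sum_(p <- P) \sum_(q <- Q) F (p.1 * q.1, p.2 + q.2).
Proof. by rewrite /pconv big_allpairs_dep. Qed.

Lemma pconv_weights (B C D : set G) P Q :
  (forall x y, B x -> C y -> D (x + y)) ->
  pweights B P -> pweights C Q -> pweights D (pconv P Q).
Proof.
move=> BCD [P0 P1 PB] [Q0 Q1 QC]; split.
- by move=> r /allpairsP[[p q] /= [/P0 p0 /Q0 q0 ->]] /=; rewrite mulr_ge0.
- by rewrite big_pconv /=; under eq_bigr do rewrite -mulr_sumr Q1 mulr1.
- by move=> r /allpairsP[[p q] /= [/PB pB /QC qC ->]] /=; exact: BCD.
Qed.

Lemma phat_pconv P Q c : phat (pconv P Q) c = phat P c * phat Q c.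
Proof.
rewrite /phat big_pconv mulr_suml; apply: eq_bigr => p _; rewrite mulr_sumr.
by apply: eq_bigr => q _; rewrite /= charD rmorphM /=; ring.
Qed.

Fixpoint ppow P n : seq (R * G) :=
  if n is m.+1 then pconv P (ppow P m) else [:: (1, 0)].

Lemma phat_ppow P n c : phat (ppow P n) c = phat P c ^+ n.
Proof.
elim: n => [|n IH] /=; last by rewrite phat_pconv IH exprS.
by rewrite /phat big_seq1 /= char0 mulr1.
Qed.

Lemma ppow_weights (Gamma : {fset character R G}) r P n :
  pweights (bohr Gamma r) P -> pweights (bohr Gamma (n%:R * r)) (ppow P n).
Proof.
move=> wP; elim: n => [|n IH] /=.
  split => [p||p]; rewrite ?big_seq1 ?inE //; first by move/eqP => ->.
  by move=> /eqP -> /=; rewrite mul0r; exact: bohr0.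
apply: (pconv_weights _ wP IH) => x y Bx By.
have -> : n.+1%:R * r = r + n%:R * r by rewrite -natr1; ring.
exact: bohrD.
Qed.

End weighted_points.

Section sampling.
Variables (R : realType) (G : topologicalZmodType).
Variable mu : probability (Borel G) R.
Hypothesis cG : compact [set: G].
Variables (Gamma : {fset character R G}) (r : R).
Let B : set (Borel G) := bohr Gamma r.
Hypothesis m0 : fine (mu B) != 0.

(** Finitely many characters are uniformly continuous, so one partition into small
    cells gives a quadrature rule for all of them. *)
Lemma sample_points (cs : seq (character R G)) e : 0 < e ->
  exists P : seq (R * G), pweights B P /\
    forall c, c \in cs -> normc (phat P c - bohr_mean mu Gamma r c) <= e.
Proof.
move=> e0; have mB : measurable B := measurable_bohr Gamma r.
pose m := fine (mu B); have mgt : 0 < m := bohr_mass_gt0 m0.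
have B0 : B !=set0.
  apply: contrapT => nB; have BE : B = set0.
    by apply/seteqP; split => // x Bx; apply: nB; exists x.
  by move/eqP: m0; apply; rewrite /m BE measure0.
have U0 : nbhs (0 : G) [set y | forall c, c \in cs -> forall x, normc ((c : character R G) (x + y) - c x) <= e].
  elim: cs => [|c cs IH]; first by apply: filterS filterT => y _ c.
  apply: filterS (filterI IH (ccont_unif cG (char_ccont c) e0)) => y [h1 h2] d.
  by rewrite inE => /orP[/eqP ->|/h1].
have [n [x [E [mE xB EU pE]]]] := @cells_in R G cG B _ mB B0 U0.
have mBE i : measurable (B `&` E i) by exact: measurableI.
pose g (y : G) : R[i] := (m^-1 * \1_B y)%:C%C.
have [iB iBE] := RI_indic mu mB.
have gn y : normc (g y) = m^-1 * \1_B y.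
  rewrite normc_real ger0_norm // mulr_ge0 // ?invr_ge0 ?(ltW mgt) //.
have ig : cintegrable mu g.
  apply: (@cint_bounded _ _ mu _ (m^-1)).
    by apply: cmeas_real; apply: rint_meas; apply: rintZ; exact: iB.
  move=> y; rewrite gn ler_piMr ?invr_ge0 ?(ltW mgt) //.
have gB y : ~ B y -> g y = 0.
  by move=> By; rewrite /g indicE memNset // mulr0.
have wE i : weight mu g (E i) = (m^-1 * fine (mu (B `&` E i)))%:C%C.
  have [iBi iBiE] := RI_indic mu (mBE i).
  rewrite /weight -iBiE -RIZ // -cintegral_real; congr cintegral; apply/funext => y.
  by rewrite /g indicI -(rmorphM (real_complex R)) mulrA.
pose P := [seq (m^-1 * fine (mu (B `&` E i)), x i) | i <- iota 0 n].
have bigP (V : nmodType) (F : R * G -> V) : \sum_(p <- P) F p =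
    \sum_(i < n) F (m^-1 * fine (mu (B `&` E i)), x i).
  by rewrite big_map -(big_mkord xpredT (fun i => F (m^-1 * fine (mu (B `&` E i)), x i))) /index_iota subn0.
exists P; split.
  split.
  - by move=> p /mapP[i _ ->] /=; rewrite mulr_ge0 ?fine_ge0 // invr_ge0 ltW.
  - rewrite bigP /= -mulr_sumr.
    rewrite (eq_bigr (fun i : 'I_n => RI mu (\1_(B `&` E i) : Borel G -> R))); last first.
      by move=> i _; have [_ ->] := RI_indic mu (mBE i).
    have -> : \sum_(i < n) RI mu (\1_(B `&` E i) : Borel G -> R) = m.
      rewrite -[RHS]iBE.
      have -> : \sum_(i < n) RI mu (\1_(B `&` E i) : Borel G -> R) =
          Re (cintegral mu (fun y => \sum_(i < n) (\1_(B `&` E i) y : R)%:C%C)).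
        rewrite cintegral_sum ?Re_sumc; last first.
          move=> i _; apply: (@cint_bounded _ _ mu _ 1); first exact: cmeas_indic.
          by move=> y; exact: normc_indic.
        by apply: eq_bigr => i _; rewrite cintegral_real.
      rewrite -[RHS]/(Re (RI mu (\1_B : Borel G -> R))%:C%C) -cintegral_real.
      congr (Re (cintegral mu _)); apply/funext => y.
      rewrite -(rmorph_sum (real_complex R)); congr (_%:C%C).
      rewrite -[RHS]mul1r -[in RHS](_ : \1_B y * \1_B y = \1_B y).
        rewrite mul1r -[X in _ = X * _](pE y) mulr_suml; apply: eq_bigr => i _.
        by rewrite indicI mulrC.
      by rewrite indicE; case: (_ \in _); rewrite ?mulr1 ?mulr0.
    by rewrite mulVf.
  - by move=> p /mapP[i _ ->] /=.
move=> c cc; rewrite /phat bigP /bohr_mean (cintegral_cutoff m0 (char_cint mu cG c)).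
have := @riemann_sum _ _ mu B n x E g c 1 e mE pE gB ig (ccont_cmeas (char_ccont c)).
have -> : RI mu (fun y => normc (g y)) = 1.
  by rewrite (_ : (fun y => _) = fun y => m^-1 * \1_B y) ?RIZ // ?iBE ?mulVf //; apply/funext.
rewrite mulr1 -cintegralZ; last first.
  have := cint_indic mB (char_cint mu cG c); congr cintegrable; apply/funext => y; exact: mulrC.
have -> : (fun x0 => m^-1%:C%C * ((\1_B x0)%:C%C * c x0)) = (fun y => g y * c y).
  by apply/funext => y; rewrite /g (rmorphM (real_complex R)) mulrA.
move=> H; under eq_bigr do rewrite -wE; apply: H => [y|i y Eiy].
  by rewrite char_norm.
by have := EU _ _ Eiy _ cc (x i); rewrite [x i + _]addrC subrK.
Qed.

(** After symmetrisation the transform is real, and at most 1/3 + 1/6 = 1/2 in modulus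
    where the mean has modulus at most 1/3. An even convolution power makes it nonnegative
    everywhere and small there. *)
Lemma positive_sample (cs : seq (character R G)) (n : nat) :
  exists P : seq (R * G), [/\ pweights (bohr Gamma ((2 * n)%N%:R * r)) P,
    forall c : character R G, exists2 t : R, 0 <= t & phat P c = t%:C%C
  & forall c : character R G, c \in cs -> normc (bohr_mean mu Gamma r c) <= 3^-1 ->
      Re (phat P c) <= 2^-1 ^+ n].
Proof.
have e0 : 0 < 6^-1 :> R by rewrite invr_gt0.
have [P [wP Pc]] := sample_points cs e0.
exists (ppow (psym P) (2 * n)); split.
- by apply: ppow_weights; apply: psym_weights wP => x; exact: bohrN.
- move=> c; exists (Re (phat P c) ^+ (2 * n)); first by rewrite exprM exprn_ge0 ?sqr_ge0.
  by rewrite phat_ppow phat_psym rmorphXn.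
move=> c /Pc h1 h2; rewrite phat_ppow phat_psym -(rmorphXn (real_complex R)) /=.
have h : `|Re (phat P c)| <= 2^-1.
  apply: (le_trans (Re_le_normc _)).
  rewrite -[phat P c](subrK (bohr_mean mu Gamma r c)) (le_trans (normcD _ _)) //.
  by move: h1 h2; lra.
have t1 : Re (phat P c) ^+ 2 <= 2^-1.
  rewrite -[_ ^+ 2]real_normK ?num_real //; move: h (normr_ge0 (Re (phat P c))).
  by rewrite expr2; move: `|_| => v; nra.
by rewrite exprM; apply: lerXn2r; rewrite ?nnegrE ?sqr_ge0 ?invr_ge0.
Qed.

End sampling.

(** * Smoothing the cutoff *)

Section bounded_representative.
Variables (R : realType) (G : topologicalZmodType).
Variable mu : probability (Borel G) R.
Hypothesis cG : compact [set: G].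
Hypothesis hG : hausdorff_space G.
Hypothesis haar : haar_measure mu.
Variables (Gamma : {fset character R G}) (delta : R).
Let B : set (Borel G) := bohr Gamma delta.
Let beta := bohr_cutoff mu Gamma delta.
Hypothesis m0 : fine (mu B) != 0.

(** Changing f on a null set affects no transform and turns the essential bound on
    the Bohr set into a pointwise one. *)
Lemma bounded_representative f : wiener_algebra mu f -> Linfty_norm beta f != 0%E ->
  exists g, [/\ wiener_algebra mu g, wiener_norm mu g = wiener_norm mu f,
    forall c, fourier beta g c = fourier beta f c
  & forall x, B x -> normc (g x) <= fine (Linfty_norm beta f)].
Proof.
move=> wf M0; have [Mgt _ fM] := Linfty_norm_cutoff cG hG haar wf m0 M0.
set M := fine _ in Mgt fM *; have [intf wlt] := wf.
pose L : set (Borel G) := [set x | M < normc (f x)].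
have mL : measurable L.
  have := cmeas_normc (cint_meas intf) measurableT (measurable_itv `]M, +oo[).
  by rewrite setTI (_ : _ @^-1` _ = L) //; apply/seteqP; split => x /=; rewrite in_itv /= andbT.
have mD : measurable (~` (B `&` L)).
  by apply: measurableC; apply: measurableI => //; exact: measurable_bohr.
pose g x := f x * (\1_(~` (B `&` L)) x : R)%:C%C.
have ig : cintegrable mu g by exact: cint_indic.
have gf : \forall x \ae mu, g x = f x.
  apply: (@filterS _ (almost_everywhere mu) _ _ _ _ fM) => x h.
  rewrite /g indicE mem_set ?mulr1 // => -[Bx]; rewrite /L /= ltNge => /negP; apply.
  exact: h.
have icc h (c : character R G) : cintegrable mu h -> cintegrable mu (fun x => h x * (c x)^*).
  move=> ih; apply: (@cintM_bounded _ _ mu _ _ 1 ih).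
    by apply: ccont_cmeas; apply: ccont_conj; exact: char_ccont.
  by move=> x; rewrite normc_conj char_norm.
have gF c : fourier mu g c = fourier mu f c.
  apply: cintegral_ae; [exact: icc|exact: icc|].
  by apply: (@filterS _ (almost_everywhere mu) _ _ _ _ gf) => x ->.
have wE : wiener_norm mu g = wiener_norm mu f by apply: eq_esum => c _; rewrite gF.
exists g; split; [by split; rewrite ?wE|exact: wE| |].
- move=> c; rewrite /fourier (cintegral_cutoff m0 (icc _ c ig)) (cintegral_cutoff m0 (icc _ c intf)).
  congr (_ * _); apply: cintegral_ae.
  + have := cint_indic (measurable_bohr Gamma delta) (icc _ c ig).
    by congr cintegrable; apply/funext => x; exact: mulrC.
  + have := cint_indic (measurable_bohr Gamma delta) (icc _ c intf).
    by congr cintegrable; apply/funext => x; exact: mulrC.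
  by apply: (@filterS _ (almost_everywhere mu) _ _ _ _ gf) => x ->.
move=> x Bx; rewrite /g indicE; have [Lx|Lx] := pselect (L x).
  rewrite memNset; last by move=> /(_ (conj Bx Lx)).
  by rewrite -[(false%:R : R)]/(0 : R) mulr0 normc_0 ltW.
rewrite mem_set ?mulr1; last by move=> [_ /Lx].
by rewrite leNgt; apply/negP.
Qed.

End bounded_representative.

Section smooth_cutoff.
Variables (R : realType) (G : topologicalZmodType).
Variable mu : probability (Borel G) R.
Hypothesis cG : compact [set: G].
Hypothesis haar : haar_measure mu.
Variables (Gamma : {fset character R G}) (delta sigma : R) (P : seq (R * G)).
Hypothesis wP : pweights (bohr Gamma sigma) P.
Let B : set (Borel G) := bohr Gamma delta.
Let D : set (Borel G) := bohr Gamma (delta - sigma).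
Let m : R := fine (mu B).
Hypothesis m0 : m != 0.

(** The density of the convolution of P with the indicator of the narrower Bohr set,
    divided by the mass of the wide one. It stays below the normalised indicator of
    the wide Bohr set, while its transform is the one of P up to a factor of modulus
    at most 1. *)
Definition smooth_cutoff (x : G) : R :=
  m^-1 * \sum_(p <- P) p.1 * \1_D (- p.2 + x : G).
Local Notation h := smooth_cutoff.

Let mD : measurable D. Proof. exact: measurable_bohr. Qed.
Let mB : measurable B. Proof. exact: measurable_bohr. Qed.
Let mi0 : 0 <= m^-1. Proof. by rewrite invr_ge0 fine_ge0. Qed.

Lemma smooth_cutoff_ge0 x : 0 <= h x.
Proof.
have [P0 _ _] := wP; rewrite mulr_ge0 // big_seq sumr_ge0 // => p /P0 p0.
by rewrite mulr_ge0.
Qed.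

Lemma smooth_cutoff_le x : h x <= m^-1 * \1_B x.
Proof.
have [P0 PS PB] := wP; rewrite ler_wpM2l //.
have -> : \1_B x = \sum_(p <- P) p.1 * \1_B x :> R by rewrite -mulr_suml PS mul1r.
rewrite big_seq [leRHS]big_seq; apply: ler_sum => p pP; rewrite ler_wpM2l ?P0 //.
rewrite !indicE; case: (boolP ((- p.2 + x : G) \in D)) => [/set_mem Dx|_]; last by rewrite ler0n.
rewrite mem_set //; have := bohrD (PB p pP) Dx.
by rewrite addNKr addrC subrK.
Qed.

Lemma smooth_cutoff_notin x : ~ B x -> h x = 0.
Proof.
move=> Bx; apply/eqP; rewrite eq_le smooth_cutoff_ge0 andbT.
by apply: le_trans (smooth_cutoff_le x) _; rewrite indicE memNset // mulr0.
Qed.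

Lemma smooth_cutoff_rint : rint mu h.
Proof.
apply: rintZ; elim: P => [|p Q IH].
  by under eq_fun do rewrite big_nil; exact: rint_cst.
under eq_fun do rewrite big_cons; apply: rintD => //.
by apply: rintZ; have [iD _] := RI_indic mu mD; exact: (rint_shift haar _ iD).
Qed.

Lemma smooth_cutoff_normc x : normc (h x)%:C%C <= m^-1.
Proof.
rewrite normc_real ger0_norm ?smooth_cutoff_ge0 // (le_trans (smooth_cutoff_le x)) //.
by rewrite ler_piMr // indicE; case: (x \in B).
Qed.

Lemma smooth_cutoff_transform (c : character R G) :
  cintegral mu (fun x => c x * (h x)%:C%C) =
  phat P c * ((m^-1)%:C%C * cintegral mu (fun x => c x * (\1_D x)%:C%C)).
Proof.
have ic : cintegrable mu (fun x => c x * (\1_D x)%:C%C).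
  by apply: cint_indic => //; exact: char_cint.
have is_ a : cintegrable mu (fun x => c x * (\1_D (- a + x : G))%:C%C).
  have := cint_shift haar (- a) (cintZ (c a) ic).
  by congr cintegrable; apply/funext => x; rewrite mulrA -charD addNKr.
have -> : (fun x => c x * (h x)%:C%C) = fun x => \sum_(p <- P)
    ((m^-1)%:C%C * (p.1)%:C%C) * (c x * (\1_D (- p.2 + x : G))%:C%C).
  apply/funext => x; rewrite /h (rmorphM (real_complex R)) (rmorph_sum (real_complex R)).
  rewrite !mulr_sumr; apply: eq_bigr => p _; rewrite (rmorphM (real_complex R)) /=; ring.
rewrite cintegral_sum; last by move=> p _; exact: cintZ.
rewrite /phat mulr_suml; apply: eq_bigr => p _; rewrite cintegralZ //.
have -> : cintegral mu (fun x => c x * (\1_D (- p.2 + x : G))%:C%C) =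
    c p.2 * cintegral mu (fun x => c x * (\1_D x)%:C%C).
  rewrite -cintegralZ // -[RHS](cintegral_shift haar (- p.2)); last exact: cintZ.
  by congr cintegral; apply/funext => x; rewrite mulrA -charD addNKr.
ring.
Qed.

Lemma normc_smooth_cutoff_transform (c : character R G) : 0 <= sigma ->
  normc (cintegral mu (fun x => c x * (h x)%:C%C)) <= normc (phat P c).
Proof.
move=> s0; rewrite smooth_cutoff_transform normcM ler_piMr ?normc_ge0 //.
have mgt : 0 < m := bohr_mass_gt0 m0.
rewrite normcM normc_real ger0_norm // ler_pdivrMl // mulr1.
have [iD iDE] := RI_indic mu mD.
apply: (@le_trans _ _ (RI mu (\1_D : Borel G -> R))).
  apply: normc_cintegral_le => //.
    by apply: cint_indic => //; exact: char_cint.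
  by move=> x; rewrite normcM char_norm mul1r normc_real ger0_norm.
by rewrite iDE; apply: mass_le; rewrite gerBl.
Qed.

Lemma RI_smooth_cutoff : RI mu h = m^-1 * fine (mu D).
Proof.
have [iD iDE] := RI_indic mu mD.
have := smooth_cutoff_transform (char_one R G) => /=.
have -> : (fun x => 1 * (h x)%:C%C) = (fun x => (h x)%:C%C) :> (G -> R[i]).
  by apply/funext => x; rewrite mul1r.
have -> : (fun x => 1 * (\1_D x)%:C%C) = (fun x => (\1_D x)%:C%C) :> (G -> R[i]).
  by apply/funext => x; rewrite mul1r.
rewrite !cintegral_real iDE; have [_ PS _] := wP.
have -> : phat P (fun=> 1) = 1.
  by rewrite /phat; under eq_bigr do rewrite mulr1; rewrite -(rmorph_sum (real_complex R)) PS.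
by rewrite mul1r -(rmorphM (real_complex R)) => /(congr1 (@complex.Re R)).
Qed.

End smooth_cutoff.

(** * Dissociated tuples in the large spectrum *)

Section dissociated.
Variables (R : realType) (G : topologicalZmodType).
Variable mu : probability (Borel G) R.
Hypothesis cG : compact [set: G].
Hypothesis hG : hausdorff_space G.
Hypothesis haar : haar_measure mu.
Variables (Gamma : {fset character R G}) (delta r cR CR : R).
Hypothesis cR0 : 0 < cR.
Hypothesis delta0 : 0 < delta.
Hypothesis reg : regular_bohr cR CR mu Gamma delta.
Hypothesis r0 : 0 <= r.
Hypothesis mr0 : fine (mu (bohr Gamma r : set (Borel G))) != 0.
Local Notation d := (#|` Gamma|%:R : R).
Local Notation beta := (bohr_cutoff mu Gamma delta).

(** The entries need not be distinct. *)
Definition dissociated n (lam : 'I_n -> character R G) :=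
  forall s, s != word0 n -> normc (bohr_mean mu Gamma r (char_word lam s)) <= 3^-1.

(** Smoothing the cutoff by a discrete measure with small transform at all nontrivial
    words costs at most half of each large coefficient, by regularity; the Riesz
    product bound then limits the number of such coefficients. *)
Lemma dissociated_bounded_bound (f : G -> R[i]) (M eps : R) n (lam : 'I_n -> character R G) N :
  wiener_algebra mu f -> 0 < M ->
  (forall x, bohr Gamma delta x -> normc (f x) <= M) ->
  dissociated lam ->
  let kappa := (2 * n)%N%:R * r / delta in
  kappa * d <= cR -> CR * kappa * d <= eps / 2 ->
  (0 < N)%N -> fine (wiener_norm mu f) <= 2 ^+ N * M ->
  (forall i, eps * M <= normc (fourier beta f (lam i))) ->
  n%:R * eps <= 256 * N%:R.
Proof.
move=> wf M0 fM dis kappa kd ke N0 AM big.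
have m0 := regular_mass_neq0 cR0 reg.
have mgt := regular_mass_gt0 cR0 reg.
set m := fine _ in m0 mgt.
have [P [wP Ppos Psmall]] := positive_sample cG mr0
  [seq char_word lam s | s <- enum {: {ffun 'I_n -> 'I_3}}] n.
set sigma := (2 * n)%N%:R * r in kappa kd ke wP.
have s0 : 0 <= sigma by rewrite mulr_ge0.
have k0 : 0 <= kappa by rewrite divr_ge0 // ltW.
pose h := smooth_cutoff mu Gamma delta sigma P.
have h0 x : 0 <= h x by exact: smooth_cutoff_ge0.
have hB x : h x <= m^-1 * \1_(bohr Gamma delta : set (Borel G)) x by exact: smooth_cutoff_le.
have hN x : ~ bohr Gamma delta x -> h x = 0 by exact: smooth_cutoff_notin.
have ih : rint mu h by exact: smooth_cutoff_rint.
have hm x : normc (h x)%:C%C <= m^-1 by exact: smooth_cutoff_normc.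
have mh : cmeas (fun x => (h x)%:C%C) by apply: cmeas_real; exact: (rint_meas ih).
have trans (c : character R G) : normc (cintegral mu (fun x => c x * (h x)%:C%C)) <= Re (phat P c).
  apply: (le_trans (normc_smooth_cutoff_transform cG haar P m0 c s0)).
  by have [t t0 ->] := Ppos c; rewrite normc_real ger0_norm.
pose u (s : {ffun 'I_n -> 'I_3}) (x : G) := char_word lam s x * (h x)%:C%C.
have mu_ s : cmeas (u s) by apply: cmeasM => //; apply: ccont_cmeas; exact: char_ccont.
have un s x : normc (u s x) <= m^-1 by rewrite normcM char_norm mul1r.
have iu s : cintegrable mu (u s) by exact: cint_bounded (mu_ s) (un s).
have [intf _] := wf.
have ifu s : cintegrable mu (fun x => f x * u s x) by exact: cintM_bounded (mu_ s) (un s).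
pose Phi s := cintegral mu (fun x => f x * u s x).
pose I_ s := cintegral mu (u s).
pose J (c : character R G) s := normc (cintegral mu (fun x => c x * u s x)).
have rhoE s : rho lam P s = Re (phat P (char_word lam s)).
  by congr Re; apply: eq_bigr => p _; rewrite char_wordE.
have [P0 P1 _] := wP.
have H : \sum_i normc (Phi (single i 2)) <= 128 * N%:R * M.
  apply: (@riesz_bound _ _ n lam Phi I_ J P M (fine (wiener_norm mu f))) => //.
  - move=> s sn; rewrite rhoE; apply: Psmall; last exact: dis.
    by apply: map_f; rewrite mem_enum.
  - move=> c s; have := trans (char_mul c (char_word lam s)).
    rewrite /J (_ : (fun x => char_mul _ _ x * _) = fun x => c x * u s x).
      move=> /le_trans; apply; rewrite le_eqVlt; apply/orP; left; apply/eqP.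
      by congr Re; apply: eq_bigr => p _; rewrite /= char_wordE.
    by apply/funext => x; rewrite /u mulrA.
  - by move=> s; rewrite rhoE; exact: trans.
  - exact: ltW.
  - move=> c pos; pose p x := \sum_s c s * wordc lam s x.
    have pE x : p x = (Re (p x))%:C%C /\ 0 <= Re (p x).
      have := pos x; rewrite -/(p x) lecE /= => /andP[/eqP pi0 pr]; split => //.
      exact: complex_eqP.
    have ip : cintegrable mu (fun x => p x * (h x)%:C%C) /\
        cintegral mu (fun x => p x * (h x)%:C%C) = \sum_s c s * I_ s.
      have -> : (fun x => p x * (h x)%:C%C) = fun x => \sum_s c s * u s x.
        apply/funext => x; rewrite mulr_suml; apply: eq_bigr => s _.
        by rewrite /u char_wordE mulrA.
      split; first by apply: cint_sum => s _; exact: cintZ.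
      rewrite cintegral_sum; last by move=> s _; exact: cintZ.
      by apply: eq_bigr => s _; rewrite cintegralZ.
    have -> : \sum_s c s * Phi s = cintegral mu (fun x => f x * (p x * (h x)%:C%C)).
      have -> : (fun x => f x * (p x * (h x)%:C%C)) = fun x => \sum_s c s * (f x * u s x).
        apply/funext => x; rewrite mulr_suml mulr_sumr; apply: eq_bigr => s _.
        by rewrite /u char_wordE; ring.
      rewrite cintegral_sum; last by move=> s _; exact: cintZ.
      by apply: eq_bigr => s _; rewrite cintegralZ.
    have [ip1 <-] := ip; have [ipr _] := ip1.
    rewrite -[X in M * X]/(RI mu (fun x => Re (p x * (h x)%:C%C))) -RIZ //.
    apply: normc_cintegral_le; [|exact: rintZ|].
      have -> : (fun x => f x * (p x * (h x)%:C%C)) = fun x => \sum_s c s * (f x * u s x).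
        apply/funext => x; rewrite mulr_suml mulr_sumr; apply: eq_bigr => s _.
        by rewrite /u char_wordE; ring.
      by apply: cint_sum => s _; exact: cintZ.
    move=> x; have [pE1 pE2] := pE x; rewrite pE1 -(rmorphM (real_complex R)) /=.
    have ph0 : 0 <= Re (p x) * h x by exact: (mulr_ge0 pE2 (h0 x)).
    rewrite normcM normc_real (ger0_norm ph0).
    have [Bx|Bx] := pselect (bohr Gamma delta x); last by rewrite hN // !mulr0.
    by rewrite ler_wpM2r ?fM.
  - move=> a a0 aJ; rewrite mulrC.
    apply: (wiener_functional cG hG haar wf (b := m^-1)) => //.
    by rewrite invr_ge0; exact: ltW.
pose k x := m^-1 * \1_(bohr Gamma delta : set (Borel G)) x - h x.
have mB : measurable (bohr Gamma delta : set (Borel G)) by exact: measurable_bohr.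
have [iB iBE] := RI_indic mu mB.
have k_ge0 x : 0 <= k x by rewrite subr_ge0.
have ik : rint mu k by apply: rintB => //; exact: rintZ.
have kI : RI mu k <= eps / 2.
  rewrite RIB //; last exact: rintZ.
  rewrite RIZ // iBE (RI_smooth_cutoff cG haar delta wP) -mulrBr ler_pdivrMl //.
  have := regular_mass_diff cR0 reg (kappa := - kappa).
  rewrite normrN ger0_norm // => /(_ kd).
  have -> : (1 - kappa) * delta = delta - sigma.
    by rewrite /kappa mulrBl mul1r divfK // gt_eqF.
  rewrite -/m ler_norml => /andP[h1 _].
  have h2 : CR * kappa * d * m <= eps / 2 * m by rewrite ler_pM2r.
  lra.
have each i : eps * M / 2 <= normc (Phi (single i 2)).
  have -> : Phi (single i 2) = cintegral mu (fun x => f x * ((lam i x)^* * (h x)%:C%C)).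
    congr cintegral; apply/funext => x; rewrite /u char_wordE /wordc word_single.
    by rewrite /letter /=.
  have mconj : cmeas (fun x => (lam i x)^*) by apply: ccont_cmeas; apply: ccont_conj; exact: char_ccont.
  have nconj x : normc ((lam i x)^*) <= 1 by rewrite normc_conj char_norm.
  have icj : cintegrable mu (fun x => f x * (lam i x)^*) by exact: cintM_bounded nconj.
  have ich : cintegrable mu (fun x => f x * ((lam i x)^* * (h x)%:C%C)).
    have := cintM_bounded icj mh hm.
    by congr cintegrable; apply/funext => x; rewrite mulrA.
  have icB : cintegrable mu (fun x => f x * (lam i x)^* * (\1_(bohr Gamma delta : set (Borel G)) x)%:C%C).
    by exact: cint_indic.
  have fE : fourier beta f (lam i) = cintegral mu (fun x => (m^-1)%:C%C *
      (f x * (lam i x)^* * (\1_(bohr Gamma delta : set (Borel G)) x)%:C%C)).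
    rewrite cintegralZ // /fourier (cintegral_cutoff m0 icj); congr (_ * _).
    by congr cintegral; apply/funext => x; exact: mulrC.
  have diff : normc (fourier beta f (lam i) -
      cintegral mu (fun x => f x * ((lam i x)^* * (h x)%:C%C))) <= M * (eps / 2).
    rewrite fE -cintegralB //; last exact: cintZ.
    apply: (@le_trans _ _ (RI mu (fun x => M * k x))); last by rewrite RIZ // ler_pM2l.
    apply: normc_cintegral_le; [by apply: cintB => //; exact: cintZ|exact: rintZ|].
    move=> x; rewrite (_ : _ - _ = f x * (lam i x)^* * (k x)%:C%C); last first.
      have kE : (k x)%:C%C = (m^-1)%:C%C * (\1_(bohr Gamma delta : set (Borel G)) x)%:C%C - (h x)%:C%C.
        rewrite /k (rmorphB (real_complex R)); congr (_ - _).
        exact: (rmorphM (real_complex R)).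
      by rewrite kE; ring.
    rewrite !normcM normc_conj char_norm mulr1 normc_real ger0_norm //.
    have [Bx|Bx] := pselect (bohr Gamma delta x); first by rewrite ler_wpM2r // fM.
    by rewrite /k hN // indicE memNset // mulr0 subr0 !mulr0.
  have := big i; rewrite -[fourier _ _ _](subrK (cintegral mu (fun x => f x * ((lam i x)^* * (h x)%:C%C)))).
  have := normcD (fourier beta f (lam i) -
      cintegral mu (fun x => f x * ((lam i x)^* * (h x)%:C%C)))
      (cintegral mu (fun x => f x * ((lam i x)^* * (h x)%:C%C))).
  by move: diff; lra.
have : \sum_(i < n) (eps * M / 2) <= 128 * N%:R * M.
  by apply: le_trans H; apply: ler_sum => i _; exact: each.
rewrite sumr_const card_ord -[leLHS]mulr_natl.
have -> : n%:R * (eps * M / 2) = (n%:R * eps / 2) * M by ring.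
by rewrite ler_pM2r //; lra.
Qed.

End dissociated.

(** * The large spectrum is spanned by few characters *)

Lemma last_success (P : nat -> Prop) K : P 0%N -> ~ P K.+1 ->
  exists n, [/\ (n <= K)%N, P n & ~ P n.+1].
Proof.
move=> P0; elim: K => [|K IH] nP; first by exists 0%N.
have [PK|/IH[n [nK Pn nPn]]] := pselect (P K.+1); first by exists K.+1.
by exists n; split => //; exact: leqW.
Qed.

Section spanning.
Variables (R : realType) (G : topologicalZmodType).
Implicit Types (x : G).

Lemma dist1_mul (z w : R[i]) : normc z = 1 -> normc (1 - z * w) <= normc (1 - z) + normc (1 - w).
Proof.
move=> z1; have -> : 1 - z * w = (1 - z) + z * (1 - w) by ring.
by rewrite (le_trans (normcD _ _)) // normcM z1 mul1r.
Qed.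

Lemma dist1_conj (z : R[i]) : normc (1 - z^*) = normc (1 - z).
Proof. by rewrite -[RHS]normc_conj rmorphB rmorph1. Qed.

Lemma dist1_letter (z : R[i]) j : normc (1 - letter z j) <= normc (1 - z).
Proof.
rewrite /letter; case: ifP => _; first by rewrite subrr normc_0 normc_ge0.
by case: ifP => _ //; rewrite dist1_conj.
Qed.

Lemma dist1_word n (z : 'I_n -> R[i]) s : (forall i, normc (z i) = 1) ->
  normc (1 - word z s) <= \sum_i normc (1 - z i).
Proof.
move=> z1; rewrite /word; elim: (index_enum _) => [|i r IH].
  by rewrite !big_nil subrr normc_0.
rewrite !big_cons; apply: (le_trans (dist1_mul _ _)); first exact: normc_letter.
by apply: lerD => //; exact: dist1_letter.
Qed.

Variables (n : nat) (lam : 'I_n -> character R G).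

Definition extend (gamma : character R G) (i : 'I_n.+1) : character R G :=
  if unlift ord0 i is Some j then lam j else gamma.

Lemma wordc_extend gamma (s : {ffun 'I_n.+1 -> 'I_3}) x :
  wordc (extend gamma) s x =
  letter (gamma x) (s ord0) * wordc lam [ffun j => s (lift ord0 j)] x.
Proof.
rewrite /wordc /word big_ord_recl /extend unlift_none; congr (_ * _).
by apply: eq_bigr => j _; rewrite liftK ffunE.
Qed.

Variable mu : probability (Borel G) R.
Variables (Gamma : {fset character R G}) (r cR CR : R).
Hypothesis cG : compact [set: G].
Hypothesis haar : haar_measure mu.
Hypothesis cR0 : 0 < cR.
Hypothesis r0 : 0 <= r.
Hypothesis reg : regular_bohr cR CR mu Gamma r.
Local Notation d := (#|` Gamma|%:R : R).

(** Some nontrivial word in the extended tuple has a mean of modulus more than 1/3,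
    and it involves gamma because lam is dissociated. So gamma or its conjugate is that word, which
    is close to 1 near 0 by regularity, times a word in lam. *)
Lemma spanned_dist1 gamma kappa x :
  dissociated mu Gamma r lam -> ~ dissociated mu Gamma r (extend gamma) ->
  0 <= kappa -> kappa * d <= cR -> bohr Gamma (kappa * r) x ->
  normc (1 - gamma x) <= 6 * CR * kappa * d + \sum_i normc (1 - lam i x).
Proof.
move=> dis ndis k0 kd Bx.
have [s [s0 sb]] : exists s, s != word0 n.+1 /\
    3^-1 < normc (bohr_mean mu Gamma r (char_word (extend gamma) s)).
  apply: contrapT => H; apply: ndis => s s0; rewrite leNgt; apply/negP => lt.
  by apply: H; exists s.
set w := char_word _ s in sb; pose s' := [ffun j => s (lift ord0 j)].
have wE y : w y = letter (gamma y) (s ord0) * wordc lam s' y by rewrite char_wordE wordc_extend.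
have [s00|s00] := eqVneq (s ord0) 0.
  have s'0 : s' != word0 n.
    apply: contra_neq s0 => s'0; apply/ffunP => i; rewrite ffunE.
    have [j ->|->] := unliftP ord0 i => //.
    by have := congr1 (fun t : {ffun _} => t j) s'0; rewrite !ffunE.
  have := dis _ s'0; rewrite leNgt => /negP; case.
  rewrite (_ : bohr_mean _ _ _ _ = bohr_mean mu Gamma r w) //; congr bohr_mean.
  by apply/funext => y; rewrite wE char_wordE s00 /letter eqxx mul1r.
have w1 : normc (1 - w x) <= 6 * CR * kappa * d.
  have h := char_dist1_bohr_mean cR0 reg r0 cG haar w k0 kd Bx.
  have h2 : normc (1 - w x) * 3^-1 <= normc (1 - w x) * normc (bohr_mean mu Gamma r w).
    by rewrite ler_wpM2l ?normc_ge0 // ltW.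
  by move: h h2; set a := normc (1 - w x); set b := a * normc _; lra.
have vn : normc (wordc lam s' x) = 1 by apply: normc_word => i; exact: char_norm.
have -> : normc (1 - gamma x) = normc (1 - letter (gamma x) (s ord0)).
  by rewrite /letter (negbTE s00); case: ifP => // _; rewrite dist1_conj.
have -> : letter (gamma x) (s ord0) = w x * (wordc lam s' x)^*.
  by rewrite wE -mulrA mul_conjc vn expr1n mulr1.
apply: (le_trans (dist1_mul _ (char_norm _ _))); apply: lerD => //.
by rewrite dist1_conj; apply: dist1_word => i; exact: char_norm.
Qed.

End spanning.

Lemma expR1_le4 (R : realType) : expR 1 <= 4 :> R.
Proof.
have h : 2^-1 <= expR (- 2^-1) :> R by have := @expR_ge1Dx R (- 2^-1); lra.
have -> : expR 1 = (expR (- 2^-1)) ^- 2 :> R.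
  by rewrite -expRM_natl -expRN; congr expR; lra.
rewrite -[4]invrK lef_pV2 ?posrE ?exprn_gt0 ?expR_gt0 ?invr_gt0 //.
by rewrite (_ : 4^-1 = 2^-1 ^+ 2 :> R) ?lerXn2r ?nnegrE ?expR_ge0 // expr2; lra.
Qed.

Lemma le_exp2_trunc_ln (R : realType) (a : R) : 1 <= a ->
  a <= 2 ^+ (2 * (Num.truncn (ln a)).+1).
Proof.
move=> a1; have a0 : 0 < a by exact: lt_le_trans a1.
have l0 : 0 <= ln a by exact: ln_ge0.
have /andP[_ lt] := truncn_itv l0.
rewrite exprM -[leLHS]lnK ?posrE //.
apply: (@le_trans _ _ (expR ((Num.truncn (ln a)).+1%:R))).
  by rewrite ler_expR ltW.
rewrite -[X in expR X]mulr1 expRM_natl; apply: lerXn2r; rewrite ?nnegrE ?expR_ge0 ?exprn_ge0 //.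
by rewrite expr2; have := @expR1_le4 R; lra.
Qed.

Theorem proposition7p4 (R : realType) (cR CR : R)
    (hreg : regularity_constants cR CR) :
  exists C c : R, [/\ 0 < C, 0 < c &
  forall (G : topologicalZmodType) (mu : probability (Borel G) R),
    compact [set: G] -> hausdorff_space G -> haar_measure mu ->
  forall (Gamma : {fset character R G}) (delta : R),
    Gamma != fset0%fset -> 0 < delta <= 1 -> regular_bohr cR CR mu Gamma delta ->
  forall (f : G -> R[i]) (epsilon eta : R),
    let d : R := #|` Gamma|%:R in
    let beta := bohr_cutoff mu Gamma delta in
    let M : R := fine (Linfty_norm beta f) in
    let A_f : R := fine (wiener_norm mu f) / M in
    wiener_algebra mu f -> Linfty_norm beta f != 0%E ->
    0 < epsilon <= 1 -> 0 < eta <= 1 ->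
  exists (Lambda : {fset character R G}) (delta' : R),
    [/\ 0 < delta' <= 1,
        #|` Lambda|%:R <= C * epsilon^-1 * (1 + ln A_f),
        c * epsilon ^+ 2 * eta * delta / (d ^+ 2 * (1 + ln A_f)) <= delta'
      & [set gamma : character R G | epsilon * M <= normc (fourier beta f gamma)]
        `<=` [set gamma : character R G |
               forall x, bohr (Gamma `|` Lambda)%fset delta' x ->
                 normc (1 - gamma x) <= eta]]].
Proof.
have [cR0 CR0 regex] := hreg.
(* tau bounds kappa * d wherever regularity is used: it keeps it admissible and
   makes the resulting errors at most epsilon / 2 and eta / 2. *)
pose tau : R := Num.min (Num.min cR (12 * CR)^-1) 1.
have CRi : 0 < (12 * CR)^-1 by rewrite invr_gt0 mulr_gt0.
have tau0 : 0 < tau by rewrite !lt_min cR0 CRi ltr01.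
have tau_cR : tau <= cR by rewrite !ge_min lexx.
have tau1 : tau <= 1 by rewrite !ge_min lexx !orbT.
have tau_CR : CR * tau <= 12^-1.
  have : tau <= (12 * CR)^-1 by rewrite !ge_min lexx !orbT.
  by rewrite -(ler_pM2l CR0) invfM mulrCA divff ?mulr1 ?gt_eqF.
have [c c0 cE] : exists2 c, 0 < c & 64 * (128 * c) = tau ^+ 2.
  exists (128^-1 * (64^-1 * tau ^+ 2)).
    by rewrite mulr_gt0 ?invr_gt0 ?mulr_gt0 ?exprn_gt0 ?ltr0n.
  by rewrite mulVKf ?mulVKf ?pnatr_eq0.
have taut : tau ^+ 2 <= 1 by rewrite expr_le1 // ltW.
have c1 : c <= 1 by lra.
exists 512, c; split; [by rewrite ltr0n|exact: c0|].
move=> G mu cG hG haar Gamma delta G0 /andP[delta0 delta1] reg f eps eta d beta M A_f.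
move=> wf L0 /andP[eps0 eps1] /andP[eta0 eta1].
have d1 : 1 <= d by rewrite ler1n cardfs_gt0.
have d0 : 0 < d by exact: lt_le_trans d1.
have m0 := regular_mass_neq0 cR0 reg.
have [M0 MA _] := Linfty_norm_cutoff cG hG haar wf m0 L0.
rewrite -/M in M0 MA.
have A1 : 1 <= A_f by rewrite ler_pdivlMr // mul1r.
set ell := 1 + ln A_f.
have ell1 : 1 <= ell by rewrite lerDl ln_ge0.
have ell0 : 0 < ell by exact: lt_le_trans ell1.
(* N is the degree beyond which the coefficients of the Riesz product are negligible. *)
have [N [N0 NE AN]] : exists N, [/\ (0 < N)%N, N%:R <= 2 * ell & A_f <= 2 ^+ N].
  exists (2 * (Num.truncn (ln A_f)).+1)%N; split; last exact: le_exp2_trunc_ln.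
    by rewrite muln_gt0.
  have /andP[h _] := truncn_itv (ln_ge0 A1).
  by rewrite natrM ler_pM2l ?ltr0n // -natr1 addrC lerD2l.
have {}AN : fine (wiener_norm mu f) <= 2 ^+ N * M by rewrite -ler_pdivrMr.
have N1 : 1 <= N%:R :> R by rewrite ler1n.
have [g [wg wgE gF gM]] := bounded_representative cG hG haar m0 wf L0.
(* K + 1 dissociated characters of the large spectrum would contradict the bound. *)
have [K [Kle Klt]] : exists K : nat, K%:R * eps <= 256 * N%:R /\ 256 * N%:R < K.+1%:R * eps.
  have q0 : 0 <= 256 * N%:R / eps by rewrite -mulrA mulr_ge0 ?divr_ge0 ?ler0n ?(ltW eps0).
  have /andP[h1 h2] := truncn_itv q0; exists (Num.truncn (256 * N%:R / eps)).
  by rewrite -ler_pdivlMr // -ltr_pdivrMr.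
have KE : K%:R * eps <= 512 * ell by lra.
have Keps : K.+1%:R * eps <= 514 * ell by rewrite -natr1 mulrDl mul1r; lra.
pose L : R := (2 * K.+1)%N%:R.
have L1 : 1 <= L by rewrite ler1n.
have Lgt : 0 < L by exact: lt_le_trans L1.
(* The L-fold sum of the inner Bohr set must have width at most a fraction
   epsilon * tau / d of delta. *)
pose delta0' := eps * delta * tau / (L * d).
have delta0'0 : 0 < delta0' by rewrite divr_gt0 ?mulr_gt0.
have delta0'1 : delta0' <= 1.
  rewrite ler_pdivrMr ?mulr_gt0 // mul1r.
  apply: (@le_trans _ _ 1); last by rewrite mulr_ege1.
  have ed1 : eps * delta <= 1 by exact: mulr_ile1 (ltW eps0) (ltW delta0) eps1 delta1.
  exact: mulr_ile1 (ltW (mulr_gt0 eps0 delta0)) (ltW tau0) ed1 tau1.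
have [r [/andP[r1 r2] regr]] := regex G mu cG hG haar Gamma delta0' G0
  (introT andP (conj delta0'0 delta0'1)).
have r0 : 0 < r by apply: lt_le_trans r1; rewrite divr_gt0.
have mr0 := regular_mass_neq0 cR0 regr.
pose S (gamma : character R G) := eps * M <= normc (fourier beta f gamma).
pose good n := exists lam : 'I_n -> character R G,
  (forall i, S (lam i)) /\ dissociated mu Gamma r lam.
have good0 : good 0%N.
  exists (fun i : 'I_0 => char_one R G); split => [[]//|s /eqP []].
  by apply/ffunP => -[].
have ngood : ~ good K.+1.
  move=> [lam [lamS dis]].
  have Lr : L * r / delta * d <= eps * tau.
    have : L * r * d <= L * delta0' * d by rewrite ler_pM2r // ler_pM2l // ltW.
    have -> : L * delta0' * d = eps * tau * delta.
      rewrite /delta0'; field; rewrite !gt_eqF //.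
    by rewrite -ler_pdivrMr // => h; rewrite mulrAC.
  have : K.+1%:R * eps <= 256 * N%:R.
    apply: (dissociated_bounded_bound cG hG haar cR0 delta0 reg (ltW r0) mr0 wg M0 gM dis).
    - by apply: (le_trans Lr); rewrite (le_trans _ tau_cR) // ler_piMl // ltW.
    - rewrite -mulrA; apply: (@le_trans _ _ (CR * (eps * tau))); first by rewrite ler_pM2l.
      rewrite mulrCA; have : eps * (CR * tau) <= eps * 12^-1 by rewrite ler_pM2l.
      by clear -eps0; lra.
    - exact: N0.
    - by rewrite wgE.
    - by move=> i; rewrite gF; exact: lamS.
  by rewrite leNgt Klt.
have [n [nK [lam [lamS dis]] ngoodn]] := last_success good0 ngood.
pose Lambda := [fset c in [seq lam i | i <- enum 'I_n]]%fset.
have lamL i : lam i \in Lambda by rewrite !inE map_f // mem_enum.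
have nR : n%:R * eps <= 512 * ell.
  by apply: le_trans KE; rewrite ler_pM2r // ler_nat.
have card_Lambda : (#|` Lambda| <= n)%N.
  rewrite card_fseq (leq_trans (size_undup _)) //.
  by rewrite size_map size_enum_ord.
pose q := eps * delta / d ^+ 2.
have dd0 : 0 < d ^+ 2 by rewrite exprn_gt0.
have qgt : 0 < q by rewrite divr_gt0 // mulr_gt0.
have q1 : q <= 1.
  rewrite ler_pdivrMr // mul1r; apply: (@le_trans _ _ 1); last by rewrite exprn_ege1.
  by rewrite mulr_ile1 // ltW.
pose delta' := c * eps ^+ 2 * eta * delta / (d ^+ 2 * ell).
have dE : delta' = eta * q * (c * eps / ell).
  by rewrite /delta' /q; field; rewrite !gt_eqF.
have ce0 : 0 < c * eps / ell by rewrite divr_gt0 // mulr_gt0.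
have delta'0 : 0 < delta' by rewrite dE mulr_gt0 // mulr_gt0.
have delta'1 : delta' <= 1.
  have ce1 : c * eps / ell <= 1.
    rewrite ler_pdivrMr // mul1r; apply: le_trans ell1.
    by rewrite mulr_ile1 // ltW.
  have eq1 : eta * q <= 1 by rewrite mulr_ile1 // ltW.
  by rewrite dE mulr_ile1 // ltW // mulr_gt0.
(* Half of eta is spent on the word with large mean, half on the word in lam. *)
pose kappa := eta * tau / d.
have kd : kappa * d = eta * tau by rewrite /kappa divfK // gt_eqF.
have kappa0 : 0 <= kappa by rewrite ltW // divr_gt0 // mulr_gt0.
have delta'r : delta' <= kappa * r.
  apply: (@le_trans _ _ (kappa * (delta0' / 2))); last by rewrite ler_wpM2l.
  have -> : kappa * (delta0' / 2) = eta * q * (tau ^+ 2 / (2 * L)).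
    by rewrite /kappa /delta0' /q; field; rewrite !gt_eqF.
  have eq0 : 0 < eta * q by exact: mulr_gt0.
  have L20 : 0 < 2 * L by rewrite mulr_gt0 ?ltr0n.
  rewrite dE (ler_pM2l eq0) (ler_pdivlMr _ _ L20) mulrAC (ler_pdivrMr _ _ ell0) -cE.
  have -> : c * eps * (2 * L) = 4 * c * (K.+1%:R * eps) by rewrite /L natrM; ring.
  have : 4 * c * (K.+1%:R * eps) <= 4 * c * (514 * ell) by rewrite ler_pM2l // mulr_gt0 ?ltr0n.
  have : 0 < c * ell by rewrite mulr_gt0.
  by move=> h1 h2; clear -h1 h2; lra.
have n_delta' : 8 * (n%:R * delta') <= eta / 2.
  have -> : n%:R * delta' = n%:R * eps * (c * eta * q / ell).
    by rewrite dE; field; rewrite gt_eqF.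
  have h1 : n%:R * eps * (c * eta * q / ell) <= 512 * ell * (c * eta * q / ell).
    have ceta : 0 < c * eta by exact: mulr_gt0.
    apply: ler_wpM2r nR; apply: ltW; apply: divr_gt0 ell0.
    exact: mulr_gt0.
  have h2 : 512 * ell * (c * eta * q / ell) = 512 * (c * eta * q) by field; rewrite gt_eqF.
  have h3 : c * eta * q <= c * eta by rewrite ler_piMr // ltW // mulr_gt0.
  have h4 : tau ^+ 2 * eta <= eta by rewrite ler_piMl // ltW.
  rewrite -cE in h4.
  by clear -h1 h2 h3 h4; lra.
exists Lambda, delta'; split; [by rewrite delta'0| |exact: lexx|].
  apply: (@le_trans _ _ n%:R); first by rewrite ler_nat.
  rewrite -(ler_pM2r eps0) -/ell (_ : _ * eps^-1 * ell * eps = 512 * ell); first exact: nR.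
  by field; rewrite gt_eqF.
move=> gamma gS x Bx.
have ndis : ~ dissociated mu Gamma r (extend lam gamma).
  move=> H; apply: ngoodn; exists (extend lam gamma); split => // i.
  by rewrite /extend; case: unliftP => [j _|_] //; exact: lamS.
have BG : bohr Gamma (kappa * r) x.
  by apply: bohr_le delta'r _; apply: bohr_sub Bx => c' c'G; rewrite inE c'G.
have kcR : kappa * d <= cR by rewrite kd (le_trans _ tau_cR) // ler_piMl // ltW.
apply: (le_trans (spanned_dist1 cG haar cR0 (ltW r0) regr dis ndis kappa0 kcR BG)).
have lamx i : normc (1 - lam i x) <= 8 * delta'.
  apply: (le_trans (dist1_le_circle_norm (char_norm _ _))).
  have cn : circle_norm (lam i x) <= delta' by apply: Bx; rewrite inE lamL orbT.
  have p4 := pi_le4 R; have p0 : 0 < pi :> R := pi_gt0 R.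
  apply: (@le_trans _ _ (2 * pi * delta')).
    by rewrite ler_wpM2l // mulr_ge0 // ltW.
  by rewrite ler_pM2r //; clear -p4; lra.
have s1 : \sum_i normc (1 - lam i x) <= 8 * (n%:R * delta').
  rewrite (_ : 8 * (n%:R * delta') = \sum_(i < n) 8 * delta'); first exact: ler_sum.
  by rewrite sumr_const card_ord -[RHS]mulr_natl mulrCA.
have s2 : 6 * CR * kappa * d <= eta / 2.
  rewrite -mulrA kd; have : eta * (CR * tau) <= eta * 12^-1 by rewrite ler_pM2l.
  have -> : 6 * CR * (eta * tau) = 6 * (eta * (CR * tau)) by ring.
  by move=> h; clear -h; lra.
by clear -s1 s2 n_delta'; lra.
Qed.
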